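(* For $c>0$, $$\operatorname{Tr}S_{[0,c],[0,1]}^2=c-\frac{\log(c)}{\pi^2}-\frac{1+\gamma+\log(2\pi)}{\pi^2}+\left(\frac2\pi c\left(\mathrm{Si}(2\pi c)-\frac\pi2\right)+\frac{\cos(2\pi c)}{\pi^2}+\frac{\mathrm{Ci}(2\pi c)}{\pi^2}\right).$$ Moreover, as $c\to\infty$ the following asymptotic expansion holds: $$\operatorname{Tr}S_{[0,c],[0,1]}^2\sim c-\frac{\log(c)}{\pi^2}-\frac{1+\gamma+\log(2\pi)}{\pi^2}-\frac{\cos(2\pi c)}{\pi^2}\sum_{n=1}^\infty(-1)^n\frac{(2n)!-(2n-1)!}{(2\pi c)^{2n}}-\frac{\sin(2\pi c)}{\pi^2}\sum_{n=1}^\infty(-1)^n\frac{(2n+1)!-(2n)!}{(2\pi c)^{2n+1}},$$ meaning that for each $N$, if both sums are replaced by their first $N$ terms, then the difference between the left-hand side and the right-hand side is $O\left(\frac1{c^{2N+2}}\right)$ as $c\to\infty$.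
   Context: The Fourier transform on $L^2(\mathbb{R})$ is $\mathcal{F}f(\xi)=\int_{\mathbb{R}}e^{-2\pi i x\xi}f(x)\,dx$. For a measurable set $A\subset\mathbb{R}$, $P_A$ is multiplication by the indicator $1_A$ and $Q_A=\mathcal{F}^{-1}P_A\mathcal{F}$. $S_{A,B}=P_AQ_BP_A$ on $L^2(\mathbb{R})$, trace class when $A,B$ have finite measure. $\mathrm{Si}(t)=\int_0^t\frac{\sin x}{x}\,dx$ is the sine integral, $\mathrm{Ci}(t)=-\int_t^\infty\frac{\cos x}{x}\,dx$ is the cosine integral and $\gamma$ is the Euler--Mascheroni constant. *)

(* Defs.v *)
From HB Require Import structures.
From mathcomp Require Import all_boot all_order all_algebra.
From mathcomp Require Import all_classical all_reals all_analysis.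
From mathcomp Require Import complex.

Set Implicit Arguments.
Unset Strict Implicit.
Unset Printing Implicit Defensive.

Import Order.TTheory GRing.Theory Num.Theory.
Import numFieldNormedType.Exports.

Local Open Scope classical_set_scope.
Local Open Scope ring_scope.
Local Open Scope complex_scope.

Section L2.
Context {R : realType}.
Implicit Types (f g : R -> R[i]) (A B : set R) (e : nat -> R -> R[i])
  (T : (R -> R[i]) -> R -> R[i]).

Local Notation leb := (@lebesgue_measure R).

Definition cintegral f : R[i] :=
  (\int[leb]_x complex.Re (f x)) +i* (\int[leb]_x complex.Im (f x)).

Definition normL2 f : \bar R :=
  Lnorm leb 2%:E (fun x => (Normc.normc (f x))%:E).

(* Elements of L^2(R) are represented by functions, two functions being
   identified when they agree almost everywhere. *)
Definition L2 f : Prop :=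
  [/\ measurable_fun [set: R] (fun x => complex.Re (f x)),
      measurable_fun [set: R] (fun x => complex.Im (f x)) &
      (normL2 f < +oo)%E].

Definition inner f g : R[i] := cintegral (fun x => f x * (g x)^*).

Definition cvgL2 (u : nat -> R -> R[i]) f : Prop :=
  normL2 (fun x => u n x - f x) @[n --> \oo] --> 0%E.

Definition expi (t : R) : R[i] := cos t +i* sin t.

Definition restr A f : R -> R[i] := fun x => (\1_A x)%:C * f x.

Definition fourierL1 f : R -> R[i] := fun xi =>
  cintegral (fun x => expi (- (2 * pi * x * xi)) * f x).

(* The extension of the Fourier integral to L^2(R): the L^2-limit of the
   Fourier integrals over [-n, n].  It is determined up to a null set, and
   [fourier] selects a representative. *)
Definition is_fourier f g : Prop :=
  L2 g /\ cvgL2 (fun n => fourierL1 (restr `[- n%:R, n%:R] f)) g.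

Definition fourier f : R -> R[i] := xget (fun=> 0) [set g | is_fourier f g].

Definition fourier_inv g : R -> R[i] :=
  xget (fun=> 0) [set f | L2 f /\ fourier f = g %[ae leb]].

Definition opP A := restr A.

Definition opQ A f := fourier_inv (opP A (fourier f)).

Definition opS A B f := opP A (opQ B (opP A f)).

Definition orthonormal_basis e : Prop :=
  [/\ forall n, L2 (e n),
      forall m n, inner (e m) (e n) = (m == n)%:R &
      forall f, L2 f ->
        cvgL2 (fun n x => \sum_(k < n) inner f (e k) * e k x) f].

(* Convergence of the diagonal series to the same sum in all orthonormal bases
   characterizes trace class among bounded operators.  L^2(R) is separable and
   infinite-dimensional, so its bases are indexed by nat. *)
Definition is_trace T (l : R[i]) : Prop :=
  forall e, orthonormal_basis e ->
    Normc.normc (\sum_(k < n) inner (T (e k)) (e k) - l) @[n --> \oo] --> (0 : R).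

Definition trace T : R[i] := xget 0 [set l | is_trace T l].

End L2.

Section special_functions.
Context {R : realType}.

Local Notation leb := (@lebesgue_measure R).

(* Only for 0 <= t; the value of the integrand at 0 is irrelevant. *)
Definition Si (t : R) : R := \int[leb]_(x in `[0, t]) (sin x / x).

(* Only for 0 < t.  The integral over [t, +oo[ converges only conditionally,
   hence the limit of integrals over [t, s]. *)
Definition Ci (t : R) : R :=
  - lim ((\int[leb]_(x in `[t, s]) (cos x / x)) @[s --> +oo]).

Definition euler_gamma : R :=
  limn (fun n : nat => \sum_(1 <= k < n.+1) k%:R^-1 - ln n%:R : R).

End special_functions.

(* Main.v *)
(* Let F be the Fourier transform, A = [0,c] and B = [0,1].  Almost everywhere
   S f (x) = <f, K_x> for x in A, where K_x(y) = 1_A(y) D(x - y)^* and D is the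
   (inverse) transform of 1_B.  As S is self-adjoint, <S^2 e, e> = |S e|^2, and
   Parseval's identity turns the diagonal series in any orthonormal basis into
     Tr S^2 = int_A |K_x|^2 dx = int_A int_A (sin(pi (x-y)) / (pi (x-y)))^2 dy dx,
   an expression in Si and Cin(x) = int_0^x (1 - cos u) / u du.

   Plancherel's identity comes from the symmetry int a F(b) = int F(a) b, which
   with Abel summation yields <F h, F k> = <h, k> for k a step function; the
   general case follows by density because the Haar functions form an
   orthonormal basis.

   The values Si(oo) = pi/2 and Cin(x) - log x -> gamma are read off from the
   Dirichlet kernel and its conjugate integrated over [0,pi], the error terms
   vanishing by the Riemann-Lebesgue lemma (an instance of Bessel's inequality).
   With f ~ sum (-1)^n (2n)! / x^(2n+1) and g ~ sum (-1)^n (2n+1)! / x^(2n+2)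
   truncated, (Si + f cos + g sin)' and (Cin - log + f sin - g cos)' are of the
   order of the first omitted term, whence the expansion. *)
Require Import Defs.
From HB Require Import structures.
From mathcomp Require Import all_boot all_order all_algebra.
From mathcomp Require Import all_classical all_reals all_analysis.
From mathcomp Require Import measurable_realfun complex ring lra zify.

Set Implicit Arguments.
Unset Strict Implicit.
Unset Printing Implicit Defensive.

Import Order.TTheory GRing.Theory Num.Theory.
Import numFieldNormedType.Exports.

Local Open Scope classical_set_scope.
Local Open Scope ring_scope.
Local Open Scope complex_scope.

(** [fourier], [fourier_inv] and [trace] are values picked by [xget], the first two fixed only up to
    null sets. So [opS] is never computed; it is compared almost everywhere with [concop], made of
    absolutely convergent integrals. Boundedness of A and B allows this: cutting to A makes an L^2
    function integrable, and cutting its transform to B does so again. The Abel factor is there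
    because the transform of a step function is square-integrable but not integrable. Once
    regularised, the inversion of a step is a difference of two arctangents, whose limit is
    explicit. The Haar system serves twice: it reduces Plancherel to step functions, and the
    existence of one orthonormal basis makes the number described by [is_trace] unique. Integrating
    the conjugate Dirichlet kernel produces harmonic numbers, which is how gamma enters. This gives
    limits along a single sequence of half-integral multiples of pi; the derivative bounds of the
    asymptotic part carry them over to all arguments. *)

Local Notation mu := (@lebesgue_measure _).
Local Notation intR f := (mu.-integrable setT (EFin \o f)).
Local Notation Re := complex.Re.
Local Notation Im := complex.Im.
Local Notation normc := Normc.normc.

(** * Square-integrable functions *)

Section ComplexIntegral.
Context {R : realType}.
Implicit Types (f g h : R -> R[i]) (p q : R -> R).

(** The squared modulus as a real polynomial in the components, so that [ring] and [nra] apply;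
    [normc] would bring in a square root. *)
Definition sqn (z : R[i]) : R := Re z ^+ 2 + Im z ^+ 2.

Definition cmf f := measurable_fun setT (fun x => Re (f x)) /\
  measurable_fun setT (fun x => Im (f x)).

Definition cint f := intR (fun x => Re (f x)) /\
  intR (fun x => Im (f x)).

Lemma cReD (z w : R[i]) : Re (z + w) = Re z + Re w.
Proof. by case: z w => a b [c d]. Qed.
Lemma cImD (z w : R[i]) : Im (z + w) = Im z + Im w.
Proof. by case: z w => a b [c d]. Qed.
Lemma cReN (z : R[i]) : Re (- z) = - Re z.
Proof. by case: z. Qed.
Lemma cImN (z : R[i]) : Im (- z) = - Im z.
Proof. by case: z. Qed.
Lemma cReM (z w : R[i]) : Re (z * w) =
  Re z * Re w - Im z * Im w.
Proof. by case: z w => a b [c d]. Qed.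
Lemma cImM (z w : R[i]) : Im (z * w) =
  Re z * Im w + Im z * Re w.
Proof. by case: z w => a b [c d]. Qed.
Lemma cReC (z : R[i]) : Re (z^*%R) = Re z.
Proof. by case: z. Qed.
Lemma cImC (z : R[i]) : Im (z^*%R) = - Im z.
Proof. by case: z. Qed.
Lemma complexP (z w : R[i]) : Re z = Re w ->
  Im z = Im w -> z = w.
Proof. by case: z w => a b [c d] /= -> ->. Qed.

Definition cE := (cReD, cImD, cReN, cImN, cReM, cImM, cReC, cImC).

Lemma sqn_ge0 (z : R[i]) : 0 <= sqn z.
Proof. by rewrite addr_ge0 ?sqr_ge0. Qed.

Lemma sqn_conj (z : R[i]) : sqn z^*%R = sqn z.
Proof. by rewrite /sqn !cE sqrrN. Qed.

Lemma sqnN (z : R[i]) : sqn (- z) = sqn z.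
Proof. by rewrite /sqn !cE !sqrrN. Qed.

Lemma sqnM (z w : R[i]) : sqn (z * w) = sqn z * sqn w.
Proof. by rewrite /sqn !cE; ring. Qed.

Lemma sqn0 : sqn 0 = 0.
Proof. by rewrite /sqn /= expr0n addr0. Qed.

Lemma sqn_eq0 (z : R[i]) : sqn z = 0 -> z = 0.
Proof.
move=> /eqP; rewrite paddr_eq0 ?sqr_ge0// !sqrf_eq0 => /andP[/eqP a /eqP b].
exact: complexP.
Qed.

Lemma conjCM (z w : R[i]) : (z * w)^*%R = z^*%R * w^*%R.
Proof. by apply: complexP; rewrite !cE; ring. Qed.
Lemma conjCD (z w : R[i]) : (z + w)^*%R = z^*%R + w^*%R.
Proof. by apply: complexP; rewrite !cE; ring. Qed.
Lemma conjCN (z : R[i]) : (- z)^*%R = - z^*%R.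
Proof. by apply: complexP; rewrite !cE. Qed.
Lemma conjCC (z : R[i]) : (z^*%R)^*%R = z.
Proof. by apply: complexP; rewrite !cE ?opprK. Qed.

Lemma mulCconj (z : R[i]) : z * z^*%R = (sqn z)%:C.
Proof. by apply: complexP; rewrite !cE /sqn /=; ring. Qed.

Lemma normc_sqrt (z : R[i]) : normc z = Num.sqrt (sqn z).
Proof. by case: z. Qed.

Lemma Re_sqr_le (z : R[i]) : Re z ^+ 2 <= sqn z.
Proof. by rewrite /sqn lerDl sqr_ge0. Qed.

Lemma Im_sqr_le (z : R[i]) : Im z ^+ 2 <= sqn z.
Proof. by rewrite /sqn lerDr sqr_ge0. Qed.

Lemma sqnD_le (z w : R[i]) : sqn (z + w) <= 2 * sqn z + 2 * sqn w.
Proof.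
rewrite /sqn !cE; have := sqr_ge0 (Re z - Re w).
have := sqr_ge0 (Im z - Im w); nra.
Qed.

Lemma ReM_le (z w : R[i]) : `|Re (z * w)| <= sqn z + sqn w.
Proof.
rewrite ler_norml /sqn !cE; set a := Re z; set b := Im z.
set c := Re w; set d := Im w.
have := sqr_ge0 (a - c); have := sqr_ge0 (a + c).
have := sqr_ge0 (b - d); have := sqr_ge0 (b + d) => *; apply/andP; split; nra.
Qed.

Lemma ImM_le (z w : R[i]) : `|Im (z * w)| <= sqn z + sqn w.
Proof.
rewrite ler_norml /sqn !cE; set a := Re z; set b := Im z.
set c := Re w; set d := Im w.
have := sqr_ge0 (a - d); have := sqr_ge0 (a + d).
have := sqr_ge0 (b - c); have := sqr_ge0 (b + c) => *; apply/andP; split; nra.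
Qed.

Lemma intR_meas p : intR p -> measurable_fun setT p.
Proof. by move=> /integrableP[/measurable_EFinP]. Qed.

Lemma intR_le p q : measurable_fun setT p -> (forall x, `|p x| <= q x) ->
  intR q -> intR p.
Proof.
move=> mp pq iq; apply: (le_integrable _ _ _ iq) => //.
  exact/measurable_EFinP.
by move=> x _ /=; rewrite lee_fin (le_trans (pq x))// ler_norm.
Qed.

Lemma intRD p q : intR p -> intR q -> intR (fun x => p x + q x).
Proof. by move=> ip iq; have := integrableD measurableT ip iq. Qed.

Lemma intRB p q : intR p -> intR q -> intR (fun x => p x - q x).
Proof. by move=> ip iq; have := integrableB measurableT ip iq. Qed.

Lemma intRZ (a : R) p : intR p -> intR (fun x => a * p x).
Proof. by move=> ip; have := integrableZl measurableT a ip. Qed.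

Lemma intRN p : intR p -> intR (fun x => - p x).
Proof.
by move=> /(intRZ (-1)); under eq_fun do rewrite mulN1r.
Qed.

Lemma RintN p : intR p -> \int[mu]_x (- p x) = - \int[mu]_x p x.
Proof.
by move=> ip; under eq_Rintegral do rewrite -mulN1r; rewrite RintegralZl// mulN1r.
Qed.

Lemma cmfD f g : cmf f -> cmf g -> cmf (fun x => f x + g x).
Proof.
move=> [a b] [c d]; split.
- by under eq_fun do rewrite cReD; exact: measurable_funD.
- by under eq_fun do rewrite cImD; exact: measurable_funD.
Qed.

Lemma cmfN f : cmf f -> cmf (fun x => - f x).
Proof.
move=> [a b]; split.
- by under eq_fun do rewrite cReN; exact: measurableT_comp.
- by under eq_fun do rewrite cImN; exact: measurableT_comp.
Qed.

Lemma cmfM f g : cmf f -> cmf g -> cmf (fun x => f x * g x).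
Proof.
move=> [a b] [c d]; split.
- under eq_fun do rewrite cReM; apply: measurable_funB; exact: measurable_funM.
- under eq_fun do rewrite cImM; apply: measurable_funD; exact: measurable_funM.
Qed.

Lemma cmf_conj f : cmf f -> cmf (fun x => (f x)^*%R).
Proof.
move=> [a b]; split.
- by under eq_fun do rewrite cReC.
- by under eq_fun do rewrite cImC; exact: measurableT_comp.
Qed.

Lemma cmf_cst (c : R[i]) : cmf (fun=> c).
Proof. by split; exact: measurable_cst. Qed.

Lemma cmf_real p : measurable_fun setT p -> cmf (fun x => (p x)%:C).
Proof. by move=> mp; split => //=; exact: measurable_cst. Qed.

Lemma cmf_sqn f : cmf f -> measurable_fun setT (fun x => sqn (f x)).
Proof. by move=> [a b]; apply: measurable_funD; exact: measurable_funX. Qed.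

Lemma cint_cmf f : cint f -> cmf f.
Proof. by move=> [/intR_meas a /intR_meas b]. Qed.

Lemma measurable_funE p : measurable_fun setT p ->
  measurable_fun setT (fun x => (p x)%:E).
Proof. by move=> mp; exact/measurable_EFinP. Qed.

Lemma cmf_sqnE f : cmf f -> measurable_fun setT (fun x => (sqn (f x))%:E).
Proof. by move=> mf; apply/measurable_EFinP; exact: cmf_sqn. Qed.

Lemma cintZ (a : R[i]) f : cint f -> cint (fun x => a * f x).
Proof.
move=> [c d]; split.
- by under eq_fun do rewrite cReM; apply: intRB; exact: intRZ.
- by under eq_fun do rewrite cImM; apply: intRD; exact: intRZ.
Qed.

Lemma cint_conj f : cint f -> cint (fun x => (f x)^*%R).
Proof.
move=> [c d]; split.
- by under eq_fun do rewrite cReC.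
- by under eq_fun do rewrite cImC; exact: intRN.
Qed.

Lemma cint_le f p : cmf f -> (forall x, `|Re (f x)| <= p x) ->
  (forall x, `|Im (f x)| <= p x) -> intR p -> cint f.
Proof. by move=> [a b] c d ip; split; apply: (intR_le _ _ ip). Qed.

Lemma cintegralD f g : cint f -> cint g ->
  cintegral (fun x => f x + g x) = cintegral f + cintegral g.
Proof.
move=> [a b] [c d]; apply: complexP; rewrite !cE /=.
- by under eq_Rintegral do rewrite cReD; exact: RintegralD.
- by under eq_Rintegral do rewrite cImD; exact: RintegralD.
Qed.

Lemma cintegralZ (a : R[i]) f : cint f ->
  cintegral (fun x => a * f x) = a * cintegral f.
Proof.
move=> [c d]; apply: complexP; rewrite !cE /=.
- under eq_Rintegral do rewrite cReM.
  by rewrite RintegralB ?RintegralZl//; exact: intRZ.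
- under eq_Rintegral do rewrite cImM.
  by rewrite RintegralD ?RintegralZl//; exact: intRZ.
Qed.

Lemma cintegral_conj f : cint f ->
  cintegral (fun x => (f x)^*%R) = (cintegral f)^*%R.
Proof.
move=> [a b]; apply: complexP; rewrite !cE /=.
- by under eq_Rintegral do rewrite cReC.
- by under eq_Rintegral do rewrite cImC; rewrite RintN.
Qed.

Lemma eq_cintegral f g : f =1 g -> cintegral f = cintegral g.
Proof. by move=> /funext ->. Qed.

Lemma cvgn_eq (u v : nat -> R) (l : R) : u =1 v ->
  u n @[n --> \oo] --> l -> v n @[n --> \oo] --> l.
Proof. by move=> /funext ->. Qed.

Lemma cvgn_eventually (N : nat) (u v : nat -> R) (l : R) :
  (forall n, (N <= n)%N -> u n = v n) ->
  u n @[n --> \oo] --> l -> v n @[n --> \oo] --> l.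
Proof.
move=> uv; apply: cvg_trans; apply: near_eq_cvg.
by exists N => // n /= Nn; exact: uv.
Qed.

Lemma cvgn_cst (c : R) : (fun=> c) n @[n --> \oo] --> c.
Proof. exact: cvg_cst. Qed.

Lemma cvgnD (u v : nat -> R) (a b : R) : u n @[n --> \oo] --> a ->
  v n @[n --> \oo] --> b -> (fun n => u n + v n) n @[n --> \oo] --> a + b.
Proof. by move=> U V; exact: (cvgD U V). Qed.

Lemma cvgnB (u v : nat -> R) (a b : R) : u n @[n --> \oo] --> a ->
  v n @[n --> \oo] --> b -> (fun n => u n - v n) n @[n --> \oo] --> a - b.
Proof. by move=> U V; exact: (cvgB U V). Qed.

Lemma cvgnM (u v : nat -> R) (a b : R) : u n @[n --> \oo] --> a ->
  v n @[n --> \oo] --> b -> (fun n => u n * v n) n @[n --> \oo] --> a * b.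
Proof. by move=> U V; exact: (cvgM U V). Qed.

Lemma cvgnZ (u : nat -> R) (a c : R) : u n @[n --> \oo] --> a ->
  (fun n => c * u n) n @[n --> \oo] --> c * a.
Proof. by move=> U; apply: cvgnM => //; exact: cvg_cst. Qed.

Lemma cvgn_squeeze0 (u v : nat -> R) : (forall n, `|u n| <= v n) ->
  v n @[n --> \oo] --> 0 -> u n @[n --> \oo] --> 0.
Proof.
move=> uv v0; apply: norm_cvg0.
apply: (@squeeze_cvgr _ _ _ _ (fun=> 0) v); [|exact: cvg_cst|exact: v0].
by apply: nearW => n; rewrite normr_ge0 uv.
Qed.

Lemma cvgn_sqrt0 (u : nat -> R) : u n @[n --> \oo] --> 0 ->
  Num.sqrt (u n) @[n --> \oo] --> 0.
Proof.
move=> H; have := cvg_comp _ _ H (@sqrt_continuous R 0).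
by rewrite sqrtr0.
Qed.

Lemma cvgn_cauchy (v : nat -> R) (e : R) : cvgn v -> 0 < e ->
  exists N, forall m n, (N <= m)%N -> (N <= n)%N -> `|v m - v n| <= e.
Proof.
move=> /cvgrPdist_le C e0; have [|N _ HN] := C (e / 2); first by rewrite divr_gt0.
exists N => m n Nm Nn; have := HN _ Nm; have := HN _ Nn => /= h1 h2.
rewrite -(subrKA (limn v)) (le_trans (ler_normD _ _))//.
by rewrite distrC (splitr e) lerD.
Qed.

Lemma aeS (P Q : R -> Prop) : (forall x, P x -> Q x) ->
  (\forall x \ae mu, P x) -> \forall x \ae mu, Q x.
Proof. by move=> PQ; apply: (@filterS _ _ (ae_filter_ringOfSetsType mu)). Qed.

Lemma aeS2 (P Q S : R -> Prop) : (forall x, P x -> Q x -> S x) ->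
  (\forall x \ae mu, P x) -> (\forall x \ae mu, Q x) -> \forall x \ae mu, S x.
Proof. by move=> PQ; apply: (@filterS2 _ _ (ae_filter_ringOfSetsType mu)). Qed.

Lemma aeq_cintegral f g : cmf f -> cmf g -> f = g %[ae mu] ->
  cintegral f = cintegral g.
Proof.
move=> [a b] [c d] fg; rewrite /cintegral /Rintegral; congr (fine _ +i* fine _).
- apply: ae_eq_integral => //; [exact/measurable_EFinP|exact/measurable_EFinP|].
  by apply: aeS fg => x /(_ I) fgx _ /=; rewrite fgx.
- apply: ae_eq_integral => //; [exact/measurable_EFinP|exact/measurable_EFinP|].
  by apply: aeS fg => x /(_ I) fgx _ /=; rewrite fgx.
Qed.

End ComplexIntegral.
Arguments cvgn_cst {R} c.
Arguments cvgnZ {R u a} c _.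

Section L2theory.
Context {R : realType}.
Implicit Types (f g h : R -> R[i]) (p q : R -> R) (u : nat -> R -> R[i]).

Definition nsq f : R := \int[mu]_x sqn (f x).

Lemma normL2E f : normL2 f = ((\int[mu]_x (sqn (f x))%:E) `^ 2^-1)%E.
Proof.
rewrite /normL2 unlock; congr (_ `^ _)%E; apply: eq_integral => x _.
by rewrite /= normc_sqrt ger0_norm ?sqrtr_ge0// powR_mulrn ?sqrtr_ge0//
  sqr_sqrtr ?sqn_ge0.
Qed.

Lemma L2P f : L2 f <-> cmf f /\ intR (fun x => sqn (f x)).
Proof.
split.
- move=> [a b fin]; have mf : cmf f by []; split=> //.
  apply/integrableP; split; first exact: cmf_sqnE.
  under eq_integral do rewrite gee0_abs ?lee_fin ?sqn_ge0//.
  rewrite ltNge leye_eq; apply/negP => /eqP E.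
  by move: fin; rewrite normL2E E poweRyr ?ltxx// invr_eq0.
- move=> [[a b] i]; split=> //; rewrite normL2E.
  by apply: poweR_lty; exact: (integrable_lty measurableT i).
Qed.

Lemma L2_cmf f : L2 f -> cmf f.
Proof. by move=> /L2P[]. Qed.

Lemma L2_sqn f : L2 f -> intR (fun x => sqn (f x)).
Proof. by move=> /L2P[]. Qed.

Lemma nsq_ge0 f : 0 <= nsq f.
Proof. by apply: Rintegral_ge0 => x _; exact: sqn_ge0. Qed.

(** The real integral in [nsq] is [fine] of the extended one and would turn +oo into 0; for [L2]
    functions the two agree. *)
Lemma nsqE f : L2 f -> (\int[mu]_x (sqn (f x))%:E)%E = (nsq f)%:E.
Proof. by move=> /L2_sqn i; rewrite /nsq /Rintegral fineK// integrable_fin_num. Qed.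

Lemma L2D f g : L2 f -> L2 g -> L2 (fun x => f x + g x).
Proof.
move=> /L2P[mf jf] /L2P[mg jg]; apply/L2P; split; first exact: cmfD.
apply: (@intR_le _ _ (fun x => 2 * sqn (f x) + 2 * sqn (g x))).
- by apply: cmf_sqn; exact: cmfD.
- by move=> x; rewrite ger0_norm ?sqn_ge0// sqnD_le.
- by apply: intRD; exact: intRZ.
Qed.

Lemma L2Z (a : R[i]) f : L2 f -> L2 (fun x => a * f x).
Proof.
move=> /L2P[mf jf]; apply/L2P; split; first exact: cmfM (cmf_cst a) mf.
by under eq_fun do rewrite sqnM; exact: intRZ.
Qed.

Lemma L2N f : L2 f -> L2 (fun x => - f x).
Proof. by move=> /(L2Z (-1)); under eq_fun do rewrite mulN1r. Qed.

Lemma L2B f g : L2 f -> L2 g -> L2 (fun x => f x - g x).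
Proof. by move=> F /L2N G; exact: L2D. Qed.

Lemma L2_conj f : L2 f -> L2 (fun x => (f x)^*%R).
Proof.
move=> /L2P[mf jf]; apply/L2P; split; first exact: cmf_conj.
by under eq_fun do rewrite sqn_conj.
Qed.

Lemma L20 : L2 (fun=> 0 : R[i]).
Proof.
apply/L2P; split; first exact: cmf_cst.
by under eq_fun do rewrite sqn0; exact: integrable0.
Qed.

Lemma L2_sum (I : Type) (s : seq I) (F : I -> R -> R[i]) :
  (forall i, L2 (F i)) -> L2 (fun x => \sum_(i <- s) F i x).
Proof.
move=> H; elim: s => [|a s IH]; first by under eq_fun do rewrite big_nil; exact: L20.
by under eq_fun do rewrite big_cons; exact: L2D.
Qed.

Lemma L2_le f g : cmf f -> (forall x, sqn (f x) <= sqn (g x)) -> L2 g -> L2 f.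
Proof.
move=> mf fg /L2P[_ i]; apply/L2P; split=> //; apply: intR_le i; first exact: cmf_sqn.
by move=> x; rewrite ger0_norm ?sqn_ge0.
Qed.

Lemma L2_cintM f g : L2 f -> L2 g -> cint (fun x => f x * g x).
Proof.
move=> /L2P[mf jf] /L2P[mg jg].
apply: (@cint_le _ _ (fun x => sqn (f x) + sqn (g x))); first exact: cmfM.
- by move=> x; exact: ReM_le.
- by move=> x; exact: ImM_le.
- exact: intRD.
Qed.

Lemma L2_cint_inner f g : L2 f -> L2 g -> cint (fun x => f x * (g x)^*%R).
Proof. by move=> F G; apply: L2_cintM => //; exact: L2_conj. Qed.

Lemma innerD f g h : L2 f -> L2 g -> L2 h ->
  inner (fun x => f x + g x) h = inner f h + inner g h.
Proof.
move=> F G H; rewrite /inner -cintegralD; [|exact: L2_cint_inner..].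
by apply: eq_cintegral => x; rewrite mulrDl.
Qed.

Lemma innerZ a f h : L2 f -> L2 h ->
  inner (fun x => a * f x) h = a * inner f h.
Proof.
move=> F H; rewrite /inner -cintegralZ; [|exact: L2_cint_inner].
by apply: eq_cintegral => x; rewrite mulrA.
Qed.

Lemma innerN f h : L2 f -> L2 h -> inner (fun x => - f x) h = - inner f h.
Proof. by move=> F H; under [X in inner X]eq_fun do rewrite -mulN1r; rewrite innerZ// mulN1r. Qed.

Lemma innerB f g h : L2 f -> L2 g -> L2 h ->
  inner (fun x => f x - g x) h = inner f h - inner g h.
Proof. by move=> F G H; rewrite innerD ?innerN//; exact: L2N. Qed.

Lemma inner_conj f g : L2 f -> L2 g -> inner g f = (inner f g)^*%R.
Proof.
move=> F G; rewrite /inner -cintegral_conj; last exact: L2_cint_inner.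
by apply: eq_cintegral => x; rewrite conjCM conjCC mulrC.
Qed.

Lemma innerDr f g h : L2 f -> L2 g -> L2 h ->
  inner h (fun x => f x + g x) = inner h f + inner h g.
Proof.
move=> F G H; rewrite (inner_conj _ H) ?innerD//; last exact: L2D.
by rewrite conjCD -!inner_conj.
Qed.

Lemma innerZr a f h : L2 f -> L2 h ->
  inner h (fun x => a * f x) = a^*%R * inner h f.
Proof.
move=> F H; rewrite (inner_conj _ H) ?innerZ//; last exact: L2Z.
by rewrite conjCM -inner_conj.
Qed.

Lemma innerNr f h : L2 f -> L2 h -> inner h (fun x => - f x) = - inner h f.
Proof.
move=> F H; rewrite (inner_conj _ H) ?innerN//; last exact: L2N.
by rewrite conjCN -inner_conj.
Qed.

Lemma innerBr f g h : L2 f -> L2 g -> L2 h ->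
  inner h (fun x => f x - g x) = inner h f - inner h g.
Proof. by move=> F G H; rewrite innerDr ?innerNr//; exact: L2N. Qed.

Lemma inner0 h : inner (fun=> 0) h = 0.
Proof.
rewrite /inner (_ : (fun _ => _) = fun=> 0); last by apply/funext => x; rewrite mul0r.
by apply: complexP; rewrite /= Rintegral_cst//= mul0r.
Qed.

Lemma nsq0 : nsq (fun=> 0) = 0.
Proof. by rewrite /nsq; under eq_Rintegral do rewrite sqn0; rewrite Rintegral_cst//= mul0r. Qed.

Lemma inner_self f : L2 f -> inner f f = (nsq f)%:C.
Proof.
move=> F; apply: complexP; rewrite /inner /=.
- by apply: eq_Rintegral => x _; rewrite mulCconj.
- under eq_Rintegral do rewrite mulCconj /=.
  by rewrite Rintegral_cst//= mul0r.
Qed.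

Lemma nsqZ a f : L2 f -> nsq (fun x => a * f x) = sqn a * nsq f.
Proof.
move=> F; rewrite /nsq -RintegralZl//; last exact: L2_sqn.
by apply: eq_Rintegral => x _; rewrite sqnM.
Qed.

Lemma nsqN f : nsq (fun x => - f x) = nsq f.
Proof. by apply: eq_Rintegral => x _; rewrite sqnN. Qed.

Lemma nsqC f g : nsq (fun x => f x - g x) = nsq (fun x => g x - f x).
Proof. by apply: eq_Rintegral => x _; rewrite -sqnN opprB. Qed.

Lemma nsqD f g : L2 f -> L2 g ->
  nsq (fun x => f x + g x) = nsq f + nsq g + 2 * Re (inner f g).
Proof.
move=> F G; have FG := L2D F G.
have : (nsq (fun x => f x + g x))%:C = (nsq f)%:C + (nsq g)%:C + inner f g + (inner f g)^*%R.
  rewrite -!inner_self// innerD ?innerDr// [in LHS](inner_conj F G); ring.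
by move=> /(congr1 (@complex.Re _)); rewrite !cE /= => ->; ring.
Qed.

Lemma nsqB f g : L2 f -> L2 g ->
  nsq (fun x => f x - g x) = nsq f + nsq g - 2 * Re (inner f g).
Proof. by move=> F G; rewrite nsqD ?nsqN ?innerNr ?cE//; [ring|exact: L2N]. Qed.

Lemma nsqD_le f g : L2 f -> L2 g ->
  nsq (fun x => f x + g x) <= 2 * nsq f + 2 * nsq g.
Proof.
move=> F G; have := nsq_ge0 (fun x => f x - g x); rewrite nsqB// nsqD//; lra.
Qed.

Lemma nsq_sub_le f g h : L2 f -> L2 g -> L2 h ->
  nsq (fun x => f x - h x) <=
    2 * nsq (fun x => f x - g x) + 2 * nsq (fun x => g x - h x).
Proof.
move=> F G H; rewrite (_ : (fun x => f x - h x) = (fun x => (f x - g x) + (g x - h x))).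
  by apply: nsqD_le; exact: L2B.
by apply/funext => x; ring.
Qed.

(** Scaling [g] by [t * z], with [z] the inner product and [t] real, makes the cross term real, so
    that the squared norm of the difference is a nonnegative real quadratic in [t]. *)
Lemma cauchy_schwarz f g : L2 f -> L2 g -> sqn (inner f g) <= nsq f * nsq g.
Proof.
move=> F G; set z := inner f g.
have H (t : R) : 0 <= nsq f - 2 * t * sqn z + t ^+ 2 * sqn z * nsq g.
  have := nsq_ge0 (fun x => f x - (t%:C * z) * g x).
  rewrite nsqB ?nsqZ ?innerZr// -/z ?sqnM; try exact: L2Z.
  by rewrite /sqn !cE /= => /le_trans; apply; rewrite le_eqVlt; apply/orP; left; apply/eqP; ring.
have [g0|g0] := eqVneq (nsq g) 0.
  rewrite g0 mulr0 leNgt; apply/negP => z0.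
  (* For [nsq g = 0] the quadratic is affine with negative slope; this [t] makes it negative. *)
  have := H ((nsq f + 1) / sqn z); rewrite g0.
  rewrite (_ : _ - _ + _ = - nsq f - 2).
    by have := nsq_ge0 f; lra.
  by field; rewrite gt_eqF.
have g1 : 0 < nsq g by rewrite lt_neqAle eq_sym g0 nsq_ge0.
have := H (nsq g)^-1; rewrite (_ : _ - _ + _ = nsq f - sqn z / nsq g); last by field.
by rewrite subr_ge0 ler_pdivrMr.
Qed.

Lemma nsq_eq0 f : L2 f -> nsq f = 0 -> f = (fun=> 0) %[ae mu].
Proof.
move=> F n0; have := nsqE F; rewrite n0 => E.
have [+ _] := ae_eq_integral_abs mu measurableT (cmf_sqnE (L2_cmf F)).
under eq_integral do rewrite gee0_abs ?lee_fin ?sqn_ge0//.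
by move=> /(_ E); apply: aeS => x /(_ I)[sq] _; exact: sqn_eq0.
Qed.

Lemma aeq_nsq f g : cmf f -> cmf g -> f = g %[ae mu] -> nsq f = nsq g.
Proof.
move=> mf mg fg; rewrite /nsq /Rintegral; congr fine.
apply: ae_eq_integral => //; [exact: cmf_sqnE..|].
by apply: aeS fg => x /(_ I) E _; rewrite E.
Qed.

Lemma aeq_inner f f' g g' : cmf f -> cmf f' -> cmf g -> cmf g' ->
  f = f' %[ae mu] -> g = g' %[ae mu] -> inner f g = inner f' g'.
Proof.
move=> mf mf' mg mg' ff gg; apply: aeq_cintegral.
- by apply: cmfM => //; exact: cmf_conj.
- by apply: cmfM => //; exact: cmf_conj.
- by apply: aeS2 ff gg => x /(_ I) + /(_ I) + _ => -> ->.
Qed.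

(** From here on L^2 convergence is handled through the real sequence of squared norms. *)
Lemma cvgL2P u f : (forall n, L2 (u n)) -> L2 f ->
  cvgL2 u f <-> nsq (fun x => u n x - f x) @[n --> \oo] --> 0.
Proof.
move=> U F; rewrite /cvgL2.
have E n : normL2 (fun x => u n x - f x) = (Num.sqrt (nsq (fun x => u n x - f x)))%:E.
  rewrite normL2E nsqE; last exact: L2B.
  by rewrite poweR_EFin powR12_sqrt// nsq_ge0.
under eq_fun do rewrite E.
split.
- move=> /fine_cvgP[_] H; have := cvgnM H H; rewrite mulr0.
  by apply: cvgn_eq => n; rewrite /= -expr2 sqr_sqrtr// nsq_ge0.
- move=> H; apply/fine_cvgP; split; first exact: nearW.
  exact: (cvgn_sqrt0 H).
Qed.

Lemma inner_cvg0 u g : (forall n, L2 (u n)) -> L2 g ->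
  nsq (u n) @[n --> \oo] --> 0 -> sqn (inner (u n) g) @[n --> \oo] --> 0.
Proof.
move=> U G H; apply: (@cvgn_squeeze0 _ _ (fun n => nsq (u n) * nsq g)).
- by move=> n; rewrite ger0_norm ?sqn_ge0// cauchy_schwarz.
- by rewrite -(mul0r (nsq g)); apply: cvgM => //; exact: cvg_cst.
Qed.

Lemma sqn_cvg0_Re (v : nat -> R[i]) : sqn (v n) @[n --> \oo] --> 0 ->
  Re (v n) @[n --> \oo] --> 0.
Proof.
move=> H; apply: (@cvgn_squeeze0 _ _ (fun n => Num.sqrt (sqn (v n)))).
- by move=> n; rewrite -sqrtr_sqr ler_sqrt ?sqn_ge0 ?Re_sqr_le.
- exact: cvgn_sqrt0.
Qed.

Lemma inner_cvg u f g : (forall n, L2 (u n)) -> L2 f -> L2 g ->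
  nsq (fun x => u n x - f x) @[n --> \oo] --> 0 ->
  Re (inner (u n) g) @[n --> \oo] --> Re (inner f g).
Proof.
move=> U F G H; apply/subr_cvg0.
have : sqn (inner (fun x => u n x - f x) g) @[n --> \oo] --> 0.
  by apply: inner_cvg0 => // n; exact: (L2B (U n) F).
move=> /sqn_cvg0_Re; apply: cvgn_eq => n.
by rewrite innerB// !cE.
Qed.

Lemma nsq_cvg u f : (forall n, L2 (u n)) -> L2 f ->
  nsq (fun x => u n x - f x) @[n --> \oo] --> 0 ->
  nsq (u n) @[n --> \oo] --> nsq f.
Proof.
move=> U F H.
have E n : nsq (u n) = nsq (fun x => u n x - f x) - nsq f + 2 * Re (inner (u n) f).
  by rewrite nsqB//; ring.
have := cvgnD (cvgnB H (cvgn_cst (nsq f))) (cvgnZ 2 (inner_cvg U F F H)).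
rewrite inner_self// [Re _%:C]/= (_ : 0 - nsq f + 2 * nsq f = nsq f); last by ring.
by apply: cvgn_eq => n; rewrite E.
Qed.

Lemma restr_cmf (A : set R) f : measurable A -> cmf f -> cmf (restr A f).
Proof.
move=> mA mf; apply: cmfM => //; apply: cmf_real; exact: measurable_indic.
Qed.

Lemma restrE (A : set R) f x : restr A f x = if x \in A then f x else 0.
Proof. by rewrite /restr indicE; case: (x \in A); rewrite ?mul1r ?mul0r. Qed.

Lemma restr_sqn_le (A : set R) f x : sqn (restr A f x) <= sqn (f x).
Proof. by rewrite restrE; case: ifP => // _; rewrite sqn0 sqn_ge0. Qed.

Lemma restr_L2 (A : set R) f : measurable A -> L2 f -> L2 (restr A f).
Proof.
move=> mA F; apply: (@L2_le _ f) => //; first exact/restr_cmf/L2_cmf.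
exact: restr_sqn_le.
Qed.

End L2theory.

(** * Completeness and orthonormal bases *)

Section RieszFischer.
Context {R : realType}.
Implicit Types (f g h : R -> R[i]) (p q : R -> R) (u : nat -> R -> R[i]).

Lemma geometric_increments_cvg (v : nat -> R) (C : R) :
  (forall k, `|v k.+1 - v k| <= C * 2^-1 ^+ k) -> cvgn v.
Proof.
move=> H; have C0 : 0 <= C by have := H 0%N; rewrite expr0 mulr1; apply: le_trans.
have E : v = (fun n => series (telescope v) n + v 0%N).
  by apply/funext => n; rewrite telescopeK /= subrK.
rewrite E; apply: is_cvgD; last exact: is_cvg_cst.
apply: normed_cvg; apply: (@series_le_cvg _ _ (geometric C 2^-1)).
- by move=> n; exact: normr_ge0.
- by move=> n; rewrite /geometric /= mulr_ge0// exprn_ge0.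
- by move=> n; exact: H.
- by apply: is_cvg_geometric_series; rewrite ger0_norm ?invf_lt1 ?ltr1n.
Qed.

(** Fatou's lemma as the stability of a bound under pointwise limits. It serves completeness of L^2
    and the removal of the Abel factor from an energy bound. *)
Lemma fatou_bound (A : nat -> R -> R) (B : R -> R) (e : R) :
  (forall n, measurable_fun setT (A n)) -> (forall n x, 0 <= A n x) ->
  (forall x, A n x @[n --> \oo] --> B x) ->
  (forall n, (\int[mu]_x (A n x)%:E <= e%:E)%E) -> (\int[mu]_x (B x)%:E <= e%:E)%E.
Proof.
move=> mA A0 AB Ae.
have := @fatou _ _ _ mu setT measurableT (fun n x => (A n x)%:E) _ _.
have -> : (\int[mu]_x limn_einf (fun n => (A n x)%:E) = \int[mu]_x (B x)%:E)%E.
  apply: eq_integral => x _; have H : (A n x)%:E @[n --> \oo] --> (B x)%:E.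
    by apply: cvg_EFin; [exact: nearW|exact: AB].
  by rewrite (cvg_limn_einf_sup H).
move=> /(_ _ _) /le_trans; apply.
- by move=> n; apply: measurable_funE.
- by move=> n x _; rewrite lee_fin.
rewrite limn_einf_lim; apply: lime_le; first exact: is_cvg_einfs.
apply: nearW => n; apply: le_trans (Ae n).
by apply: ereal_inf_lbound; exists n => /=.
Qed.

Definition L2_cauchy u := forall e : R, 0 < e -> exists N, forall m n,
  (N <= m)%N -> (N <= n)%N -> nsq (fun x => u m x - u n x) <= e.

(** A fast subsequence converges almost everywhere because a weighted sum of its squared increments
    has a finite integral. Fatou's lemma then turns the Cauchy bound into convergence in norm of the
    whole sequence. *)
Theorem riesz_fischer u : (forall n, L2 (u n)) -> L2_cauchy u ->
  exists f, L2 f /\ nsq (fun x => u n x - f x) @[n --> \oo] --> 0.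
Proof.
move=> U C.
(* The ratio 16 is 4 * 4: the weight 4^k in [g] leaves integrals at most 4^-k, which are summable,
   and where the weighted sum is finite the increments are at most a constant times 2^-k. *)
have pos k : 0 < 16^-1 ^+ k :> R by rewrite exprn_gt0.
pose N k := sval (cid (C _ (pos k))).
have NP k m n : (N k <= m)%N -> (N k <= n)%N ->
    nsq (fun x => u m x - u n x) <= 16^-1 ^+ k.
  by rewrite /N; case: cid => K /= HK; exact: HK.
pose phi k := (k + \max_(j < k.+1) N j)%N.
have phiN k : (N k <= phi k)%N.
  by rewrite (leq_trans _ (leq_addl _ _))//; exact: (@leq_bigmax _ (fun j : 'I_k.+1 => N j) ord_max).
have phiS k : (phi k <= phi k.+1)%N.
  by rewrite /phi leq_add// [leqRHS]big_ord_recr /= leq_max leqnn.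
pose d k x := u (phi k.+1) x - u (phi k) x.
have Ld k : L2 (d k) by exact: L2B.
have nd k : nsq (d k) <= 16^-1 ^+ k.
  by apply: NP => //; rewrite (leq_trans (phiN k)).
pose g k x := 4 ^+ k * sqn (d k x).
have mg k : measurable_fun setT (g k).
  by apply: measurable_funM; [exact: measurable_cst|exact: (cmf_sqn (L2_cmf (Ld k)))].
have g0 k x : 0 <= g k x by rewrite mulr_ge0 ?sqn_ge0 ?exprn_ge0.
pose G x := (\sum_(0 <= k <oo) (g k x)%:E)%E.
have G0 x : (0 <= G x)%E by apply: nneseries_ge0 => k _ _; rewrite lee_fin.
have mG : measurable_fun setT G.
  by apply: ge0_emeasurable_sum => //= k; [move=> x _; rewrite lee_fin|move=> _; exact: measurable_funE].
have intg k : (\int[mu]_x (g k x)%:E <= (4^-1 ^+ k)%:E)%E.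
  under eq_integral do rewrite EFinM.
  rewrite ge0_integralZl//; last 2 first.
  - exact: (cmf_sqnE (L2_cmf (Ld k))).
  - by move=> x _; rewrite lee_fin sqn_ge0.
  rewrite nsqE// -EFinM lee_fin; apply: (le_trans (ler_wpM2l _ (nd k))).
    by rewrite exprn_ge0.
  by rewrite -exprMn; apply: lerXn2r; rewrite ?nnegrE//; lra.
have Gfin : {ae mu, forall x, (G x < +oo)%E}.
  have : mu.-integrable setT G.
    apply/integrableP; split=> //.
    under eq_integral do rewrite (gee0_abs (G0 _)) /G.
    rewrite integral_nneseries//; last 2 first.
    - by move=> k; exact: measurable_funE.
    - by move=> k x _; rewrite lee_fin.
    apply: (@le_lt_trans _ _ 2%:E); last exact: ltry.
    apply: lime_le.
      by apply: is_cvg_nneseries => k _ _; apply: integral_ge0 => x _; rewrite lee_fin.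
    apply: nearW => n; apply: (@le_trans _ _ (\sum_(0 <= k < n) (4^-1 ^+ k)%:E)%E).
      by apply: lee_sum => k _; exact: intg.
    rewrite sumEFin lee_fin; have : \sum_(0 <= k < n) 4^-1 ^+ k <= 2 - 2 * 4^-1 ^+ n :> R.
      elim: n => [|n IH]; first by rewrite big_geq// expr0; lra.
      rewrite big_nat_recr//= exprS.
      have : 0 <= 4^-1 ^+ n :> R by rewrite exprn_ge0.
      move: IH; lra.
    by move=> /le_trans; apply; rewrite gerBl mulr_ge0// exprn_ge0.
  move=> /(integrable_ae measurableT); apply: aeS => x /(_ I).
  by rewrite fin_numElt => /andP[].
pose E := [set x | G x \is a fin_num].
have mE : measurable E.
  by rewrite -[E]setTI; exact: emeasurable_fin_num.
(* Cutting to the set of convergence makes the limit exist at every point, hence measurable, at the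
   price of a null set. *)
pose v k := restr E (u (phi k)).
have mv k : cmf (v k) by apply: restr_cmf => //; exact/L2_cmf.
have vcvg x : cvgn (fun k => Re (v k x)) /\ cvgn (fun k => Im (v k x)).
  have [Ex|nEx] := boolP (x \in E); last first.
    split; rewrite (_ : (fun _ => _) = fun=> 0); try exact: is_cvg_cst.
    + by apply/funext => k; rewrite /v restrE (negbTE nEx).
    + by apply/funext => k; rewrite /v restrE (negbTE nEx).
  have Gx : G x \is a fin_num by move: Ex; rewrite inE.
  have dk k : sqn (d k x) <= fine (G x) * (2^-1 ^+ k) ^+ 2.
    have : (g k x <= fine (G x)).
      rewrite -lee_fin fineK//.
      apply: (@le_trans _ _ (\sum_(0 <= j < k.+1) (g j x)%:E)%E).
        rewrite big_nat_recr//= leeDr// sume_ge0// => *; by rewrite lee_fin.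
      by apply: nneseries_lim_ge => *; rewrite lee_fin.
    rewrite /g => H; have -> : (2^-1 ^+ k) ^+ 2 = (4 ^+ k)^-1 :> R.
      by rewrite -exprM mulnC exprM -exprVn; congr (_ ^+ _); field.
    by rewrite ler_pdivlMr ?exprn_gt0// mulrC.
  have B k : Num.sqrt (fine (G x) * (2^-1 ^+ k) ^+ 2) = Num.sqrt (fine (G x)) * 2^-1 ^+ k.
    by rewrite sqrtrM ?fine_ge0// sqrtr_sqr ger0_norm// exprn_ge0.
  split; apply: (@geometric_increments_cvg _ (Num.sqrt (fine (G x)))) => k.
  + rewrite /v !restrE Ex -B -sqrtr_sqr ler_sqrt; last by rewrite mulr_ge0 ?fine_ge0 ?sqr_ge0.
    by apply: le_trans (dk k); rewrite -cReN -cReD; exact: Re_sqr_le.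
  + rewrite /v !restrE Ex -B -sqrtr_sqr ler_sqrt; last by rewrite mulr_ge0 ?fine_ge0 ?sqr_ge0.
    by apply: le_trans (dk k); rewrite -cImN -cImD; exact: Im_sqr_le.
pose f x := (limn (fun k => Re (v k x))) +i* (limn (fun k => Im (v k x))).
have mf : cmf f.
  split.
  - apply: (@measurable_fun_cvg _ _ _ _ (fun k x => Re (v k x))); first by move=> k; case: (mv k).
    by move=> x _; case: (vcvg x).
  - apply: (@measurable_fun_cvg _ _ _ _ (fun k x => Im (v k x))); first by move=> k; case: (mv k).
    by move=> x _; case: (vcvg x).
have uv k : u (phi k) = v k %[ae mu].
  by apply: aeS Gfin => x Gx _; rewrite /v restrE mem_set// /E /= ge0_fin_numE.
have Lv k : L2 (v k) by apply: restr_L2.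
(* For fixed n the other index runs to infinity along the subsequence; starting it at [K + k] keeps
   it within the range of the Cauchy bound. *)
have key e : 0 < e -> exists K, forall n, (K <= n)%N ->
    (\int[mu]_x (sqn (u n x - f x))%:E <= e%:E)%E.
  move=> e0; have [K HK] := C _ e0; exists K => n Kn.
  have Hk k : (K <= phi (K + k))%N by rewrite /phi -addnA leq_addr.
  apply: (@fatou_bound (fun k x => sqn (u n x - v (K + k)%N x))).
  - by move=> k; apply: cmf_sqn; apply: cmfD; [exact/L2_cmf|apply: cmfN].
  - by move=> k x; exact: sqn_ge0.
  - move=> x; have [c1 c2] := vcvg x; rewrite /sqn !cE /f /=.
    have h1 : Re (v (K + k)%N x) @[k --> \oo] --> limn (fun k => Re (v k x)).
      have := c1; rewrite -(cvg_shiftn K).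
      by apply: cvgn_eq => k; rewrite addnC.
    have h2 : Im (v (K + k)%N x) @[k --> \oo] --> limn (fun k => Im (v k x)).
      have := c2; rewrite -(cvg_shiftn K).
      by apply: cvgn_eq => k; rewrite addnC.
    have a1 := cvgnB (cvgn_cst (Re (u n x))) h1.
    have a2 := cvgnB (cvgn_cst (Im (u n x))) h2.
    have := cvgnD (cvgnM a1 a1) (cvgnM a2 a2); rewrite -!expr2.
    by apply: cvgn_eq => k; rewrite !cE !expr2.
  - move=> k; rewrite nsqE; last exact: L2B.
    rewrite lee_fin (@aeq_nsq _ _ (fun x => u n x - u (phi (K + k)%N) x)).
    + by apply: HK.
    + exact/L2_cmf/L2B.
    + exact/L2_cmf/L2B.
    + by apply: aeS (uv (K + k)%N) => x /(_ I) h _; rewrite h.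
have Luf n : L2 (u n) -> (\int[mu]_x (sqn (u n x - f x))%:E < +oo)%E -> L2 (fun x => u n x - f x).
  move=> Un fin; apply/L2P; split; first by apply: cmfD; [exact: L2_cmf|exact: cmfN].
  apply/integrableP; split; first by apply: cmf_sqnE; apply: cmfD; [exact: L2_cmf|exact: cmfN].
  by under eq_integral do rewrite gee0_abs ?lee_fin ?sqn_ge0//.
have Lf : L2 f.
  have [K /(_ K (leqnn K)) HK] := key 1 ltr01.
  have := L2B (U K) (Luf K (U K) (le_lt_trans HK (ltry _))).
  by under eq_fun do rewrite subKr.
exists f; split=> //; apply/cvgrPdist_le => e e0.
have [K HK] := key _ e0; exists K => // n Kn /=.
rewrite sub0r normrN ger0_norm ?nsq_ge0// -lee_fin -nsqE; last exact: L2B.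
exact: HK.
Qed.

End RieszFischer.

Section Orthonormal.
Context {R : realType}.
Implicit Types (f g h : R -> R[i]) (e : nat -> R -> R[i]).

Definition orthonormal e := (forall n, L2 (e n)) /\
  (forall m n, inner (e m) (e n) = (m == n)%:R).

Definition psum e f n : R -> R[i] := fun x => \sum_(k < n) inner f (e k) * e k x.

Lemma psum_L2 e f n : orthonormal e -> L2 (psum e f n).
Proof. by move=> [Le _]; apply: L2_sum => k; exact: L2Z. Qed.

Lemma psumS e f n : psum e f n.+1 = (fun x => psum e f n x + inner f (e n) * e n x).
Proof. by apply/funext => x; rewrite /psum big_ord_recr. Qed.

Lemma inner_psum e f n j : orthonormal e ->
  inner (psum e f n) (e j) = if (j < n)%N then inner f (e j) else 0.
Proof.
move=> [Le oe]; elim: n => [|n IH].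
  by rewrite (_ : psum e f 0 = fun=> 0) ?inner0//; apply/funext => x; rewrite /psum big_ord0.
rewrite psumS innerD ?innerZ ?IH ?oe//; [|exact: psum_L2|exact: L2Z].
have -> : (j < n.+1)%N = (j == n) || (j < n)%N by rewrite ltnS leq_eqVlt.
have [->|] := eqVneq j n; first by rewrite /= ltnn add0r mulr1.
by move=> _ /=; rewrite mulr0 addr0.
Qed.

Lemma nsq_psum_sub e f n : orthonormal e -> L2 f ->
  nsq (fun x => f x - psum e f n x) = nsq f - \sum_(k < n) sqn (inner f (e k)).
Proof.
move=> oe Lf; have [Le oe2] := oe; elim: n => [|n IH].
  by rewrite big_ord0 subr0; congr nsq; apply/funext => x; rewrite /psum big_ord0 subr0.
rewrite psumS big_ord_recr /=.
have -> : (fun x => f x - (psum e f n x + inner f (e n) * e n x)) =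
          (fun x => (f x - psum e f n x) - inner f (e n) * e n x).
  by apply/funext => x; rewrite opprD addrA.
have Lp := psum_L2 f n oe.
have Ld := L2B Lf Lp.
rewrite nsqB ?IH ?innerZr//; last exact: L2Z.
rewrite innerB// inner_psum// ltnn subr0 nsqZ//.
have -> : nsq (e n) = 1.
  by have := oe2 n n; rewrite eqxx inner_self// => -[].
by rewrite /sqn !cE; ring.
Qed.

Lemma nsq_psumB e f m n : orthonormal e -> L2 f -> (n <= m)%N ->
  nsq (fun x => psum e f m x - psum e f n x) =
  \sum_(k < m) sqn (inner f (e k)) - \sum_(k < n) sqn (inner f (e k)).
Proof.
move=> oe Lf; have [Le oe2] := oe; elim: m => [|m IH].
  rewrite leqn0 => /eqP ->; rewrite subrr.
  rewrite (_ : (fun x => _) = fun=> 0); last by apply/funext => x; rewrite subrr.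
  exact: nsq0.
rewrite leq_eqVlt => /predU1P[->|].
  rewrite subrr (_ : (fun x => _) = fun=> 0); last by apply/funext => x; rewrite subrr.
  exact: nsq0.
rewrite ltnS => nm; rewrite psumS big_ord_recr /=.
have -> : (fun x => psum e f m x + inner f (e m) * e m x - psum e f n x) =
          (fun x => (psum e f m x - psum e f n x) + inner f (e m) * e m x).
  by apply/funext => x; ring.
have Lm := psum_L2 f m oe; have Ln := psum_L2 f n oe.
have Ld := L2B Lm Ln.
rewrite nsqD ?IH ?innerZr//; last exact: L2Z.
rewrite innerB// !inner_psum// ltnn ltnNge nm subr0 mulr0 nsqZ//=.
have -> : nsq (e m) = 1.
  by have := oe2 m m; rewrite eqxx inner_self// => -[].
ring.
Qed.

Lemma bessel e f n : orthonormal e -> L2 f ->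
  \sum_(k < n) sqn (inner f (e k)) <= nsq f.
Proof. by move=> oe Lf; rewrite -subr_ge0 -nsq_psum_sub// nsq_ge0. Qed.

Lemma bessel_cvg e f : orthonormal e -> L2 f ->
  cvgn (fun n => \sum_(k < n) sqn (inner f (e k))).
Proof.
move=> oe Lf; apply: nondecreasing_is_cvgn.
- apply/nondecreasing_seqP => n; rewrite big_ord_recr /= lerDl; exact: sqn_ge0.
- by exists (nsq f) => _ [n _ <-]; exact: bessel.
Qed.

Lemma orthonormal_coef_cvg0 e f : orthonormal e -> L2 f ->
  sqn (inner f (e n)) @[n --> \oo] --> 0.
Proof.
move=> oe Lf; have C := bessel_cvg oe Lf.
have C1 : (\sum_(k < n.+1) sqn (inner f (e k))) @[n --> \oo] -->
    limn (fun n => \sum_(k < n) sqn (inner f (e k))).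
  by have := C; rewrite -(cvg_shiftS).
have := cvgnB C1 C; rewrite subrr; apply: cvgn_eq => n.
by rewrite big_ord_recr /= addrAC subrr add0r.
Qed.

Lemma parseval e f : orthonormal_basis e -> L2 f ->
  \sum_(k < n) sqn (inner f (e k)) @[n --> \oo] --> nsq f.
Proof.
move=> [Le oe cv] Lf; have oe' : orthonormal e by [].
have /cvgL2P := cv f Lf; move=> /(_ (fun n => psum_L2 f n oe') Lf) H.
have := cvgnB (cvgn_cst (nsq f)) H; rewrite subr0; apply: cvgn_eq => n.
by rewrite nsqC nsq_psum_sub// subKr.
Qed.

(** Bessel's inequality makes the partial sums Cauchy, so they converge to some [g] by completeness;
    [g] has the same coefficients as [f], and totality kills the difference. *)
Lemma total_orthonormal_basis e : orthonormal e ->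
  (forall f, L2 f -> (forall n, inner f (e n) = 0) -> nsq f = 0) ->
  orthonormal_basis e.
Proof.
move=> oe tot; have [Le oe2] := oe; split=> // f Lf.
have Lp n := psum_L2 f n oe.
apply/(cvgL2P Lp Lf).
have [g [Lg cg]] : exists g, L2 g /\ nsq (fun x => psum e f n x - g x) @[n --> \oo] --> 0.
  apply: riesz_fischer => // eps e0.
  have [N HN] := cvgn_cauchy (bessel_cvg oe Lf) e0.
  exists N => m n Nm Nn; apply: le_trans (HN m n Nm Nn).
  have [nm|/ltnW mn] := leqP n m.
    by rewrite nsq_psumB// ler_norm.
  by rewrite nsqC distrC nsq_psumB// ler_norm.
have gk k : inner g (e k) = inner f (e k).
  apply/eqP; rewrite eq_sym -subr_eq0; apply/eqP/sqn_eq0.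
  have Lpg n : L2 (fun x => psum e f n x - g x) by exact: L2B.
  have H := inner_cvg0 Lpg (Le k) cg.
  have H2 : sqn (inner (fun x => psum e f n x - g x) (e k)) @[n --> \oo] --> sqn (inner f (e k) - inner g (e k)).
    apply: (@cvgn_eventually _ k.+1 _ _ _ _ (cvgn_cst _)) => n kn.
    by rewrite innerB// inner_psum// kn.
  exact: (cvg_unique (@Rhausdorff R) H2 H).
have fg0 : nsq (fun x => f x - g x) = 0.
  by apply: tot; [exact: L2B|move=> k; rewrite innerB// gk subrr].
apply: (@cvgn_squeeze0 _ _ (fun n => 2 * nsq (fun x => psum e f n x - g x))).
  move=> n; rewrite ger0_norm ?nsq_ge0//.
  have := nsq_sub_le (Lp n) Lg Lf.
  by rewrite [X in _ + _ * X]nsqC fg0 mulr0 addr0.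
by rewrite -(mulr0 2); exact: cvgnZ.
Qed.

End Orthonormal.

(** * The Fourier integral *)

Section MultiplicationFormula.
Context {R : realType}.
Implicit Types (a b f g h : R -> R[i]).

Lemma integrable_swap (f : R * R -> R) :
  (mu \x mu)%E.-integrable setT (EFin \o f) ->
  (mu \x mu)%E.-integrable setT (EFin \o (fun z => f (z.2, z.1))).
Proof.
move=> If; have mf : measurable_fun setT (EFin \o f) by exact: (measurable_int _ If).
have /integrable21ltyP := If => /(_ mf) H.
apply/integrable12ltyP => //.
exact: (measurableT_comp mf (@measurable_swap _ _ R R)).
Qed.

Lemma Rintegral_fubini (f : R * R -> R) :
  (mu \x mu)%E.-integrable setT (EFin \o f) ->
  \int[mu]_x \int[mu]_y f (x, y) = \int[mu]_y \int[mu]_x f (x, y).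
Proof.
move=> If; rewrite /Rintegral.
(* The inner integral is finite only almost everywhere; elsewhere [fine] alters it, but on a null
   set. *)
have fin (g : R * R -> R) : (mu \x mu)%E.-integrable setT (EFin \o g) ->
    (\int[mu]_x (fine (\int[mu]_y (g (x, y))%:E))%:E = \int[mu]_x \int[mu]_y (EFin \o g) (x, y))%E.
  move=> Ig; have H1 := integrable_fubini_F Ig.
  apply: ae_eq_integral => //.
  - apply: measurable_funE; apply: measurableT_comp; first by [].
    exact: (measurable_int mu H1).
  - exact: (measurable_int mu H1).
  - have := integrable_ae measurableT H1; apply: aeS => x /(_ I) h _ /=.
    by rewrite fineK.
by congr fine; rewrite (fin _ If) (fin _ (integrable_swap If)) (Fubini If).
Qed.

Lemma normc_ge0 (z : R[i]) : 0 <= normc z.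
Proof. by rewrite normc_sqrt sqrtr_ge0. Qed.

Lemma Re_le_normc (z : R[i]) : `|Re z| <= normc z.
Proof. by rewrite normc_sqrt -sqrtr_sqr ler_sqrt ?sqn_ge0// Re_sqr_le. Qed.

Lemma Im_le_normc (z : R[i]) : `|Im z| <= normc z.
Proof. by rewrite normc_sqrt -sqrtr_sqr ler_sqrt ?sqn_ge0// Im_sqr_le. Qed.

Lemma normc_le (z : R[i]) : normc z <= `|Re z| + `|Im z|.
Proof.
rewrite -[leRHS]ger0_norm ?addr_ge0// -sqrtr_sqr normc_sqrt ler_sqrt ?sqr_ge0//.
rewrite /sqn sqrrD !real_normK ?num_real//.
by rewrite lerD2r lerDl mulrn_wge0// mulr_ge0.
Qed.

Lemma cmf_normc f : cmf f -> measurable_fun setT (fun x => normc (f x)).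
Proof.
move=> mf; under eq_fun do rewrite normc_sqrt.
apply: (measurableT_comp (f := @Num.sqrt R)); last exact: cmf_sqn.
by apply: continuous_measurable_fun; exact: sqrt_continuous.
Qed.

Lemma cint_normc f : cint f -> intR (fun x => normc (f x)).
Proof.
move=> If; apply: (@intR_le _ _ (fun x => `|Re (f x)| + `|Im (f x)|)).
- exact: (cmf_normc (cint_cmf If)).
- by move=> x; rewrite ger0_norm ?normc_ge0// normc_le.
- by case: If => a b; apply: intRD; [exact: (integrable_norm a)|exact: (integrable_norm b)].
Qed.

Lemma sqn_expi (t : R) : sqn (expi t) = 1.
Proof. by rewrite /sqn /expi /= cos2Dsin2. Qed.

Lemma normc_expi (t : R) : normc (expi t) = 1.
Proof. by rewrite normc_sqrt sqn_expi sqrtr1. Qed.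

Lemma expiD (s t : R) : expi (s + t) = expi s * expi t.
Proof. by apply: complexP; rewrite /expi !cE /= ?cosD ?sinD; ring. Qed.

Lemma expi_conj (t : R) : (expi t)^*%R = expi (- t).
Proof. by apply: complexP; rewrite /expi !cE /= ?cosN ?sinN. Qed.

Lemma cmf_expi (c : R) : cmf (fun x => expi (c * x)).
Proof.
split => /=.
- apply: (measurableT_comp (f := @cos R)); last exact: measurable_funM.
  by apply: continuous_measurable_fun; exact: continuous_cos.
- apply: (measurableT_comp (f := @sin R)); last exact: measurable_funM.
  by apply: continuous_measurable_fun; exact: continuous_sin.
Qed.

Lemma cint_expiM (c : R) f : cint f -> cint (fun x => expi (c * x) * f x).
Proof.
move=> If; apply: (@cint_le _ _ (fun x => normc (f x))).
- by apply: cmfM; [exact: cmf_expi|exact: cint_cmf].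
- by move=> x; rewrite (le_trans (Re_le_normc _))// Normc.normcM normc_expi mul1r.
- by move=> x; rewrite (le_trans (Im_le_normc _))// Normc.normcM normc_expi mul1r.
- exact: cint_normc.
Qed.

Let kern (a b : R -> R[i]) (z : R * R) : R[i] :=
  a z.1 * (expi (- (2 * pi * z.2 * z.1)) * b z.2).

Let kern_mf a b : cmf a -> cmf b ->
  measurable_fun setT (fun z => Re (kern a b z)) /\
  measurable_fun setT (fun z => Im (kern a b z)).
Proof.
move=> [a1 a2] [b1 b2].
have ma1 : measurable_fun [set: R * R] (fun z => Re (a z.1)).
  by apply: (measurableT_comp a1); exact: measurable_fst.
have ma2 : measurable_fun [set: R * R] (fun z => Im (a z.1)).
  by apply: (measurableT_comp a2); exact: measurable_fst.
have mb1 : measurable_fun [set: R * R] (fun z => Re (b z.2)).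
  by apply: (measurableT_comp b1); exact: measurable_snd.
have mb2 : measurable_fun [set: R * R] (fun z => Im (b z.2)).
  by apply: (measurableT_comp b2); exact: measurable_snd.
have mph : measurable_fun [set: R * R] (fun z => - (2 * pi * z.2 * z.1)).
  apply: measurableT_comp => //; apply: measurable_funM; last exact: measurable_fst.
  by apply: measurable_funM => //; exact: measurable_snd.
have mc : measurable_fun [set: R * R] (fun z => cos (- (2 * pi * z.2 * z.1)) : R).
  apply: (measurableT_comp (f := @cos R)) mph.
  by apply: continuous_measurable_fun; exact: continuous_cos.
have ms : measurable_fun [set: R * R] (fun z => sin (- (2 * pi * z.2 * z.1)) : R).
  apply: (measurableT_comp (f := @sin R)) mph.
  by apply: continuous_measurable_fun; exact: continuous_sin.
rewrite /kern; split.
- under eq_fun do rewrite !cE /expi /=.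
  apply: measurable_funB; apply: measurable_funM => //.
  + by apply: measurable_funB; exact: measurable_funM.
  + by apply: measurable_funD; exact: measurable_funM.
- under eq_fun do rewrite !cE /expi /=.
  apply: measurable_funD; apply: measurable_funM => //.
  + by apply: measurable_funD; exact: measurable_funM.
  + by apply: measurable_funB; exact: measurable_funM.
Qed.

(** The exponential has modulus one, so the kernel is dominated by the product of the moduli of [a]
    and [b], whose double integral is finite. *)
Let kern_int a b (p : R * R -> R) : cint a -> cint b -> measurable_fun setT p ->
  (forall z, `|p z| <= normc (kern a b z)) ->
  (mu \x mu)%E.-integrable setT (EFin \o p).
Proof.
move=> Ia Ib mp pk; apply/integrable12ltyP; first exact/measurable_EFinP.
have na := cint_normc Ia; have nb := cint_normc Ib.
have E x : (\int[mu]_y (normc (a x) * normc (b y))%:E =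
    (normc (a x) * \int[mu]_y normc (b y))%:E)%E.
  under eq_integral do rewrite EFinM.
  rewrite integralZl// EFinM; congr (_ * _)%E.
  by rewrite /Rintegral fineK//; exact: integrable_fin_num.
apply: (@le_lt_trans _ _ (\int[mu]_x (normc (a x) * \int[mu]_y normc (b y))%:E)%E).
  have mk : measurable_fun [set: R * R] (fun z => (`|p z|)%:E).
    by apply/measurable_EFinP; exact: measurableT_comp.
  apply: ge0_le_integral => //=.
  - by move=> x _; apply: integral_ge0.
  - by apply: (measurable_fun_fubini_tonelli_F (m2 := mu) _ mk) => z; rewrite lee_fin.
  - apply: measurable_funE; apply: measurable_funM; last exact: measurable_cst.
    exact: (intR_meas na).
  - move=> x _; rewrite -E; apply: ge0_le_integral => //=.
    + by apply: (measurableT_comp mk); exact: measurable_pair1.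
    + apply: measurable_funE; apply: measurable_funM; first exact: measurable_cst.
      exact: (intR_meas nb).
    + move=> y _; rewrite lee_fin (le_trans (pk _))// /kern /= !Normc.normcM normc_expi.
      by rewrite mul1r.
under eq_integral do rewrite mulrC.
exact: (integrable_lty measurableT (intRZ _ na)).
Qed.

Theorem multiplication_formula a b : cint a -> cint b ->
  cintegral (fun s => a s * fourierL1 b s) = cintegral (fun x => fourierL1 a x * b x).
Proof.
move=> Ia Ib.
have [m1 m2] := kern_mf (cint_cmf Ia) (cint_cmf Ib).
have i1 := kern_int Ia Ib m1 (fun z => Re_le_normc _).
have i2 := kern_int Ia Ib m2 (fun z => Im_le_normc _).
have Eb s : a s * fourierL1 b s = cintegral (fun x => kern a b (s, x)).
  rewrite /fourierL1 -cintegralZ//.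
  have := cint_expiM (- (2 * pi * s)) Ib.
  by congr (cint _); apply/funext => x; congr (expi _ * _); ring.
have Ea x : fourierL1 a x * b x = cintegral (fun s => kern a b (s, x)).
  rewrite /fourierL1 mulrC -cintegralZ; last first.
    have := cint_expiM (- (2 * pi * x)) Ia.
    by congr (cint _); apply/funext => s; congr (expi _ * _); ring.
  apply: eq_cintegral => s; rewrite /kern /=.
  rewrite (_ : 2 * pi * s * x = 2 * pi * x * s); last by ring.
  ring.
rewrite (eq_cintegral Eb) (eq_cintegral Ea).
by apply: complexP; [exact: (Rintegral_fubini i1)|exact: (Rintegral_fubini i2)].
Qed.

End MultiplicationFormula.

(** * Derivative rules and the fundamental theorem of calculus *)

Section DerivativeRules.
Context {R : realType}.
Implicit Types (f g : R -> R) (x a b c : R).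

(* Unlike [is_derive], not a type class, so that rewriting with a lemma having
   such a premise does not trigger instance resolution. *)
Definition hasd f x l := is_derive x 1 f l.

Lemma d_eq f x (l l' : R) : hasd f x l' -> l' = l -> hasd f x l.
Proof. by move=> H <-. Qed.

Lemma d_cst c x : hasd (fun _ : R => c) x 0.
Proof. exact: is_derive_cst. Qed.

Lemma d_id x : hasd (fun y : R => y) x 1.
Proof. exact: is_derive_id. Qed.

Lemma d_add f g x a b : hasd f x a -> hasd g x b ->
  hasd (fun y => f y + g y) x (a + b).
Proof. by move=> F G; exact: (is_deriveD F G). Qed.

Lemma d_opp f x a : hasd f x a -> hasd (fun y => - f y) x (- a).
Proof. by move=> F; exact: (is_deriveN F). Qed.

Lemma d_mul f g x a b : hasd f x a -> hasd g x b ->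
  hasd (fun y => f y * g y) x (f x * b + g x * a).
Proof. by move=> F G; exact: (is_deriveM F G). Qed.

Lemma d_inv f x a : f x != 0 -> hasd f x a ->
  hasd (fun y => (f y)^-1) x (- (f x) ^- 2 * a).
Proof. by move=> f0 F; exact: (is_deriveV f0 F). Qed.

Lemma d_exp f n x a : hasd f x a ->
  hasd (fun y => f y ^+ n) x (n%:R * f x ^+ n.-1 * a).
Proof.
move=> F; rewrite (_ : (fun y => f y ^+ n) = f ^+ n); first exact: (is_deriveX n F).
by apply/funext => y; rewrite exprfctE.
Qed.

Lemma d_comp h f x a b : hasd h (f x) a -> hasd f x b ->
  hasd (fun y => h (f y)) x (a * b).
Proof. by move=> H F; exact: (is_derive1_comp H F). Qed.

Lemma d_sin f x a : hasd f x a ->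
  hasd (fun y => sin (f y)) x (cos (f x) * a).
Proof. by move=> F; apply: d_comp F; exact: is_derive_sin. Qed.

Lemma d_cos f x a : hasd f x a ->
  hasd (fun y => cos (f y)) x (- sin (f x) * a).
Proof. by move=> F; apply: d_comp F; exact: is_derive_cos. Qed.

Lemma d_expR f x a : hasd f x a ->
  hasd (fun y => expR (f y)) x (expR (f x) * a).
Proof. by move=> F; apply: d_comp F; exact: is_derive_expR. Qed.

Lemma d_ln f x a : 0 < f x -> hasd f x a ->
  hasd (fun y => ln (f y)) x ((f x)^-1 * a).
Proof. by move=> f0 F; apply: d_comp F; exact: is_derive1_ln. Qed.

Lemma d_atan f x a : hasd f x a ->
  hasd (fun y => atan (f y)) x ((1 + f x ^+ 2)^-1 * a).
Proof. by move=> F; apply: d_comp F; exact: is_derive1_atan. Qed.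

Lemma d_continuous f x a : hasd f x a -> {for x, continuous f}.
Proof.
move=> F; apply: differentiable_continuous; apply/derivable1_diffP.
exact: (@ex_derive _ _ _ _ _ _ _ F).
Qed.

End DerivativeRules.

(** The first six cases eta-expand a function given in contracted form, so that the rules stated for
    explicit abstractions apply to it. *)
Ltac der1 :=
  lazymatch goal with
  | |- @hasd ?R (@GRing.mul ?S ?c) ?x ?l =>
      change (@hasd R (fun y => @GRing.mul S c y) x l); eapply d_mul
  | |- @hasd ?R (@GRing.opp ?S) ?x ?l =>
      change (@hasd R (fun y => @GRing.opp S y) x l); eapply d_opp
  | |- @hasd ?R (@GRing.add ?S ?c) ?x ?l =>
      change (@hasd R (fun y => @GRing.add S c y) x l); eapply d_add
  | |- @hasd ?R (@sin ?S) ?x ?l => change (@hasd R (fun y => @sin S y) x l); eapply d_sin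
  | |- @hasd ?R (@cos ?S) ?x ?l => change (@hasd R (fun y => @cos S y) x l); eapply d_cos
  | |- @hasd ?R (@GRing.inv ?S) ?x ?l => change (@hasd R (fun y => @GRing.inv S y) x l); eapply d_inv
  | |- @hasd _ (fun _ => ?c) _ _ => eapply d_cst
  | |- @hasd _ (fun y => y) _ _ => eapply d_id
  | |- @hasd _ (fun y => @GRing.add _ _ _) _ _ => eapply d_add
  | |- @hasd _ (fun y => @GRing.opp _ _) _ _ => eapply d_opp
  | |- @hasd _ (fun y => @GRing.mul _ _ _) _ _ => eapply d_mul
  | |- @hasd _ (fun y => @GRing.exp _ _ _) _ _ => eapply d_exp
  | |- @hasd _ (fun y => @GRing.inv _ _) _ _ => eapply d_inv
  | |- @hasd _ (fun y => sin _) _ _ => eapply d_sin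
  | |- @hasd _ (fun y => cos _) _ _ => eapply d_cos
  | |- @hasd _ (fun y => expR _) _ _ => eapply d_expR
  | |- @hasd _ (fun y => atan _) _ _ => eapply d_atan
  | |- @hasd _ (fun y => ln _) _ _ => eapply d_ln
  end.
Ltac der := eapply d_eq; [repeat der1|cbv beta].
Ltac cont := eapply d_continuous; repeat der1.

Section IntegralTools.
Context {R : realType}.
Implicit Types (f F : R -> R) (a b : R).

Lemma within_continuousW f (A : set R) :
  (forall x, A x -> {for x, continuous f}) -> {within A, continuous f}.
Proof. by move=> H; apply: continuous_in_subspaceT => x /set_mem; exact: H. Qed.

Lemma ftc2 f F a b : a <= b ->
  (forall x, a <= x <= b -> hasd F x (f x)) ->
  (forall x, a <= x <= b -> {for x, continuous f}) ->
  (\int[mu]_(x in `[a, b]) (f x)%:E = (F b - F a)%:E)%E.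
Proof.
rewrite le_eqVlt => /predU1P[-> _ _|ab dF cf].
  by rewrite set_itv1 integral_set1 subrr.
rewrite (@continuous_FTC2 _ f F) ?EFinB//.
- by apply: within_continuousW => x /=; rewrite in_itv /=; exact: cf.
- split.
  + move=> x; rewrite in_itv /= => /andP[ax xb].
    by apply: (@ex_derive _ _ _ _ _ _ _ (dF x _)); rewrite !ltW.
  + by apply: cvg_at_right_filter; apply: (d_continuous (dF a _)); rewrite lexx ltW.
  + by apply: cvg_at_left_filter; apply: (d_continuous (dF b _)); rewrite lexx ltW.
- move=> x; rewrite in_itv /= => /andP[ax xb].
  by rewrite derive1E; apply: (@derive_val _ _ _ _ _ _ _ (dF x _)); rewrite !ltW.
Qed.

Lemma Rftc2 f F a b : a <= b ->
  (forall x, a <= x <= b -> hasd F x (f x)) ->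
  (forall x, a <= x <= b -> {for x, continuous f}) ->
  \int[mu]_(x in `[a, b]) f x = F b - F a.
Proof. by move=> ab dF cf; rewrite /Rintegral (ftc2 ab dF cf). Qed.

Lemma Rintegral_dominated (p_ : nat -> R -> R) (p q : R -> R) :
  (forall n, measurable_fun setT (p_ n)) -> measurable_fun setT p ->
  (\forall x \ae mu, p_ n x @[n --> \oo] --> p x) ->
  intR q -> (forall n x, `|p_ n x| <= q x) ->
  (\int[mu]_x p_ n x) @[n --> \oo] --> \int[mu]_x p x.
Proof.
move=> mp_ mp pp iq pq.
have [] := @dominated_convergence _ _ _ mu setT measurableT
  (fun n => EFin \o p_ n) (EFin \o p) (EFin \o q).
- by move=> n; exact: (measurable_funE (mp_ n)).
- exact: (measurable_funE mp).
- apply: aeS pp => x h _ /=; apply: cvg_EFin => //; exact: nearW.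
- by [].
- by apply: aeW => x n _ /=; rewrite lee_fin.
move=> ip _ H; apply: (@fine_cvg _ _ _ _ _ (\int[mu]_x p x)).
by rewrite [X in _ --> X]fineK; [exact: H|exact: integrable_fin_num].
Qed.

Lemma prod_integrable_le (p : R * R -> R) (A B : R -> R) :
  measurable_fun setT p -> intR A -> intR B -> (forall x, 0 <= A x) ->
  (forall z, `|p z| <= A z.1 * B z.2) ->
  (mu \x mu)%E.-integrable setT (EFin \o p).
Proof.
move=> mp na nb A0 pk; apply/integrable12ltyP; first exact/measurable_EFinP.
have E x : (\int[mu]_y (A x * B y)%:E = (A x * \int[mu]_y B y)%:E)%E.
  under eq_integral do rewrite EFinM.
  rewrite integralZl// EFinM; congr (_ * _)%E.
  by rewrite /Rintegral fineK//; exact: integrable_fin_num.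
apply: (@le_lt_trans _ _ (\int[mu]_x (A x * \int[mu]_y B y)%:E)%E).
  have mk : measurable_fun [set: R * R] (fun z => (`|p z|)%:E).
    by apply/measurable_EFinP; exact: measurableT_comp.
  apply: ge0_le_integral => //=.
  - by move=> x _; apply: integral_ge0.
  - by apply: (measurable_fun_fubini_tonelli_F (m2 := mu) _ mk) => z; rewrite lee_fin.
  - apply: measurable_funE; apply: measurable_funM; last exact: measurable_cst.
    exact: (intR_meas na).
  - move=> x _; rewrite -E; apply: ge0_le_integral => //=.
    + by apply: (measurableT_comp mk); exact: measurable_pair1.
    + apply: measurable_funE; apply: measurable_funM; first exact: measurable_cst.
      exact: (intR_meas nb).
    + by move=> y _; rewrite lee_fin pk.
under eq_integral do rewrite mulrC.
exact: (integrable_lty measurableT (intRZ _ na)).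
Qed.

Lemma ge0_integralT_fold f : continuous f -> (forall x, 0 <= f x) ->
  (\int[mu]_x (f x)%:E = \int[mu]_(x in `[0%R, +oo[) (f x + f (- x))%:E)%E.
Proof.
move=> cf f0.
have mf : measurable_fun setT f by exact: continuous_measurable_fun.
have mNf : measurable_fun setT (fun x : R => f (- x)) by exact: measurableT_comp.
under [RHS]eq_integral do rewrite EFinD.
rewrite ge0_integralD//; last 4 first.
- by move=> x _; rewrite lee_fin.
- by apply: measurable_funTS; exact: measurable_funE.
- by move=> x _; rewrite lee_fin.
- by apply: measurable_funTS; exact: measurable_funE.
have -> : (\int[mu]_(x in `[0%R, +oo[) (f (- x))%:E = \int[mu]_(x in `]-oo, 0%R]) (f x)%:E)%E.
  have := @ge0_integration_by_substitutionNy R f 0; rewrite oppr0 => ->//.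
  exact: continuous_subspaceT.
rewrite -(setUv `[0%R, +oo[%classic) ge0_integral_setU//=; last 4 first.
- exact: measurableC.
- by rewrite setUv; exact: measurable_funE.
- by move=> x _; rewrite lee_fin.
- exact/disj_setPCl.
congr (_ + _)%E; rewrite setCitvr integral_itv_bndo_bndc//.
by apply: measurable_funTS; exact: measurable_funE.
Qed.

End IntegralTools.

(** * The Abel factor and the Poisson kernel *)

Section PoissonKernel.
Context {R : realType}.
Implicit Types (f F : R -> R) (e om s t : R).

(** The Abel summation factor and, in [poisson], its Fourier transform, an approximate identity as
    [e] tends to 0. *)
Definition abel e s : R := expR (- (e * `|s|)).
Definition poisson e t : R := 2 * e / (e ^+ 2 + (2 * pi * t) ^+ 2).

Lemma abel_gt0 e s : 0 < abel e s.
Proof. exact: expR_gt0. Qed.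

Lemma abel_ge0 e s : 0 <= abel e s.
Proof. exact: expR_ge0. Qed.

Lemma abelN e s : abel e (- s) = abel e s.
Proof. by rewrite /abel normrN. Qed.

Lemma continuous_abel e : continuous (abel e).
Proof.
move=> s; apply: (@continuous_comp _ _ _ (fun s => - (e * `|s|)) expR); last exact: continuous_expR.
apply: (@continuousN R R^o); apply: (@continuousM R); first exact: cst_continuous.
exact: norm_continuous.
Qed.

Lemma expR_decay e : 0 < e -> expR (- (e * s)) @[s --> +oo] --> 0.
Proof.
move=> e0; have H : e * s @[s --> +oo] --> +oo by exact: gt0_cvgMry cvg_id.
exact: (cvg_comp _ _ H (@cvgr_expR R)).
Qed.

Lemma expR_decayM e (B : R -> R) (C : R) : 0 < e -> (forall s, `|B s| <= C) ->
  expR (- (e * s)) * B s @[s --> +oo] --> 0.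
Proof.
move=> e0 BC; apply: norm_cvg0.
apply: (@squeeze_cvgr _ _ _ _ (fun=> 0) (fun s => expR (- (e * s)) * C)).
- apply: nearW => s; rewrite normr_ge0 normrM ger0_norm ?expR_ge0//=.
  by rewrite ler_wpM2l// expR_ge0.
- exact: cvg_cst.
- by rewrite -(mul0r C); apply: cvgM; [exact: expR_decay|exact: cvg_cst].
Qed.

Lemma ftc2y f F (l : R) : (forall x, 0 <= x -> 0 <= f x) ->
  continuous f -> (forall x, hasd F x (f x)) ->
  F x @[x --> +oo] --> l ->
  (\int[mu]_(x in `[0%R, +oo[) (f x)%:E = (l - F 0)%:E)%E.
Proof.
move=> f0 cf dF Fl; rewrite (@ge0_continuous_FTC2y _ f F 0 l) ?EFinB//.
- exact: continuous_subspaceT.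
- by move=> x _; apply: (@ex_derive _ _ _ _ _ _ _ (dF x)).
- by apply: cvg_at_right_filter; exact: (d_continuous (dF 0)).
- by move=> x _; rewrite derive1E; apply: (@derive_val _ _ _ _ _ _ _ (dF x)).
Qed.

Lemma int_expR_half e : 0 < e ->
  (\int[mu]_(x in `[0%R, +oo[) (expR (- (e * x)))%:E = (e^-1)%:E)%E.
Proof.
move=> e0.
rewrite (@ftc2y _ (fun x => expR (- (e * x)) * (- e^-1)) 0).
- by rewrite mulr0 oppr0 expR0 mul1r sub0r opprK.
- by move=> x _; exact: expR_ge0.
- move=> x; apply: (d_continuous (a := expR (- (e * x)) * (- e))).
  by der; ring.
- by move=> x; der; field; rewrite gt_eqF.
- by apply: (@expR_decayM _ _ `|- e^-1|).
Qed.

(** The summand 1 keeps the integrand nonnegative, as the fundamental theorem on a half-line in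
    [ftc2y] requires. It is subtracted again in [cintegral_abel_expi]. *)
Lemma int_expR_cos_half e om : 0 < e ->
  (\int[mu]_(x in `[0%R, +oo[) (expR (- (e * x)) * (1 + cos (om * x)))%:E =
  (e^-1 + e / (e ^+ 2 + om ^+ 2))%:E)%E.
Proof.
move=> e0; have D0 : e ^+ 2 + om ^+ 2 != 0.
  by rewrite gt_eqF// ltr_pwDl ?exprn_gt0 ?sqr_ge0.
have e1 : e != 0 by rewrite gt_eqF.
rewrite (@ftc2y _ (fun x => expR (- (e * x)) *
  (- e^-1 + (om * sin (om * x) - e * cos (om * x)) * (e ^+ 2 + om ^+ 2)^-1)) 0).
- rewrite !mulr0 oppr0 expR0 sin0 cos0; congr (_%:E); field.
  by rewrite e1 D0.
- by move=> x _; rewrite mulr_ge0 ?expR_ge0//; have := cos_geN1 (om * x); lra.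
- by move=> x; cont.
- by move=> x; der; field; rewrite e1 D0.
- apply: (@expR_decayM _ _ (e^-1 + (`|om| + e) * `|(e ^+ 2 + om ^+ 2)^-1|)) => // s.
  rewrite (le_trans (ler_normD _ _))// normrN gtr0_norm ?invr_gt0// lerD2l normrM.
  rewrite ler_wpM2r// (le_trans (ler_normB _ _))// !normrM (gtr0_norm e0) lerD//.
  + by rewrite -[leRHS]mulr1 ler_wpM2l// sin_max.
  + by rewrite -[leRHS]mulr1 ler_wpM2l ?cos_max// ltW.
Qed.

Lemma int_abel e : 0 < e -> (\int[mu]_x (abel e x)%:E = (2 / e)%:E)%E.
Proof.
move=> e0; rewrite ge0_integralT_fold; last 2 first.
- exact: continuous_abel.
- by move=> x; exact: abel_ge0.
transitivity (\int[mu]_(x in `[0%R, +oo[) (2%:E * (expR (- (e * x)))%:E))%E.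
  apply: eq_integral => x; rewrite inE /= in_itv /= andbT => x0.
  by rewrite abelN /abel ger0_norm// -EFinM; congr EFin; ring.
rewrite ge0_integralZl//; last first.
  apply: measurable_funTS; apply: measurable_funE; apply: continuous_measurable_fun => x.
  by cont.
by rewrite int_expR_half// -EFinM.
Qed.

Lemma int_abel_cos e om : 0 < e ->
  (\int[mu]_x (abel e x * (1 + cos (om * x)))%:E = (2 * (e^-1 + e / (e ^+ 2 + om ^+ 2)))%:E)%E.
Proof.
move=> e0; rewrite (ge0_integralT_fold (f := fun x => abel e x * (1 + cos (om * x)))); last 2 first.
- move=> x; apply: continuousM; first exact: continuous_abel.
  by cont.
- by move=> x; rewrite mulr_ge0 ?abel_ge0//; have := cos_geN1 (om * x); lra.
transitivity (\int[mu]_(x in `[0%R, +oo[) (2%:E * (expR (- (e * x)) * (1 + cos (om * x)))%:E))%E.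
  apply: eq_integral => x; rewrite inE /= in_itv /= andbT => x0.
  by rewrite abelN mulrN cosN /abel ger0_norm// -EFinM; congr EFin; ring.
have c0 (x : R) : (0 <= (expR (- (e * x)) * (1 + cos (om * x)))%:E)%E.
  by rewrite lee_fin mulr_ge0 ?expR_ge0//; have := cos_geN1 (om * x); lra.
rewrite ge0_integralZl//; last first.
  apply: measurable_funTS; apply: measurable_funE; apply: continuous_measurable_fun => x.
  by cont.
by rewrite int_expR_cos_half// -EFinM.
Qed.

(** Folding the line onto the half-line cancels the odd part, leaving the integral of the Abel
    factor alone. *)
Lemma int_abel_sin e om : 0 < e ->
  (\int[mu]_x (abel e x * (1 + sin (om * x)))%:E = (2 / e)%:E)%E.
Proof.
move=> e0; rewrite (ge0_integralT_fold (f := fun x => abel e x * (1 + sin (om * x)))); last 2 first.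
- move=> x; apply: continuousM; first exact: continuous_abel.
  by cont.
- by move=> x; rewrite mulr_ge0 ?abel_ge0//; have := sin_geN1 (om * x); lra.
rewrite -(int_abel e0) ge0_integralT_fold; last 2 first.
- exact: continuous_abel.
- by move=> x; exact: abel_ge0.
apply: eq_integral => x _; rewrite !abelN mulrN sinN; congr EFin; ring.
Qed.

Lemma measurable_abel e : measurable_fun setT (abel e).
Proof. by apply: continuous_measurable_fun; exact: continuous_abel. Qed.

Lemma intR_abel e : 0 < e -> intR (abel e).
Proof.
move=> e0; apply/integrableP; split; first exact: (measurable_funE (measurable_abel e)).
under eq_integral do rewrite gee0_abs ?lee_fin ?abel_ge0//.
by rewrite int_abel// ltry.
Qed.

Lemma intR_abelM e (B : R -> R) (C : R) : 0 < e -> measurable_fun setT B ->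
  (forall s, `|B s| <= C) -> intR (fun s => abel e s * B s).
Proof.
move=> e0 mB BC; apply: (@intR_le _ _ (fun s => C * abel e s)).
- by apply: measurable_funM => //; exact: measurable_abel.
- by move=> s; rewrite normrM gtr0_norm ?abel_gt0// mulrC ler_wpM2r// ltW// abel_gt0.
- exact/intRZ/intR_abel.
Qed.

Lemma cint_abelM e (B : R -> R[i]) (C : R) : 0 < e -> cmf B ->
  (forall s, normc (B s) <= C) -> cint (fun s => (abel e s)%:C * B s).
Proof.
move=> e0 [m1 m2] BC; split.
- rewrite (_ : (fun _ => _) = fun s => abel e s * Re (B s)).
    by apply: (intR_abelM (C := C)) => // s; rewrite (le_trans (Re_le_normc _)).
  by apply/funext => s; rewrite !cE /= mul0r subr0.
- rewrite (_ : (fun _ => _) = fun s => abel e s * Im (B s)).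
    by apply: (intR_abelM (C := C)) => // s; rewrite (le_trans (Im_le_normc _)).
  by apply/funext => s; rewrite !cE /= mul0r addr0.
Qed.

Lemma cintegral_abel_expi e t : 0 < e ->
  cintegral (fun s => (abel e s)%:C * expi (2 * pi * t * s)) = (poisson e t)%:C.
Proof.
move=> e0; set om := 2 * pi * t; have e1 : e != 0 by rewrite gt_eqF.
have D0 : e ^+ 2 + om ^+ 2 != 0.
  by rewrite gt_eqF// ltr_pwDl ?exprn_gt0 ?sqr_ge0.
have mc : measurable_fun setT (fun s : R => cos (om * s)).
  by apply: continuous_measurable_fun => x; cont.
have ms : measurable_fun setT (fun s : R => sin (om * s)).
  by apply: continuous_measurable_fun => x; cont.
have ic : intR (fun s => abel e s * cos (om * s)).
  by apply: (intR_abelM (C := 1)) => // s; exact: cos_max.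
have is' : intR (fun s => abel e s * sin (om * s)).
  by apply: (intR_abelM (C := 1)) => // s; exact: sin_max.
have ia := intR_abel e0.
have E0 : \int[mu]_x abel e x = 2 / e by rewrite /Rintegral int_abel.
apply: complexP; rewrite /cintegral /=.
- transitivity (\int[mu]_x (abel e x * cos (om * x))).
    by apply: eq_Rintegral => x _; rewrite mul0r subr0.
  have : \int[mu]_x (abel e x * (1 + cos (om * x))) = 2 * (e^-1 + e / (e ^+ 2 + om ^+ 2)).
    by rewrite /Rintegral int_abel_cos.
  under eq_Rintegral do rewrite mulrDr mulr1.
  rewrite RintegralD// E0 => H.
  have -> : \int[mu]_x (abel e x * cos (om * x)) = 2 * (e^-1 + e / (e ^+ 2 + om ^+ 2)) - 2 / e.
    by rewrite -H; ring.
  by rewrite /poisson -/om; field; rewrite e1 D0.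
- transitivity (\int[mu]_x (abel e x * sin (om * x))).
    by apply: eq_Rintegral => x _; rewrite mul0r addr0.
  have : \int[mu]_x (abel e x * (1 + sin (om * x))) = 2 / e.
    by rewrite /Rintegral int_abel_sin.
  under eq_Rintegral do rewrite mulrDr mulr1.
  by rewrite RintegralD// E0 => /eqP; rewrite -subr_eq0 addrAC subrr add0r => /eqP.
Qed.

Lemma poisson_ge0 e t : 0 < e -> 0 <= poisson e t.
Proof. by move=> e0; rewrite divr_ge0 ?addr_ge0 ?sqr_ge0 ?mulr_ge0 ?ltW. Qed.

Lemma poissonN e t : poisson e (- t) = poisson e t.
Proof. by rewrite /poisson mulrN sqrrN. Qed.

Lemma poisson_le e t : 0 < e -> poisson e t <= 2 / e.
Proof.
move=> e0; rewrite /poisson; have D0 : 0 < e ^+ 2 + (2 * pi * t) ^+ 2.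
  by rewrite ltr_pwDl ?exprn_gt0 ?sqr_ge0.
rewrite ler_pdivrMr// -subr_ge0.
have -> : 2 / e * (e ^+ 2 + (2 * pi * t) ^+ 2) - 2 * e = 2 / e * (2 * pi * t) ^+ 2.
  by field; rewrite gt_eqF.
by rewrite mulr_ge0 ?sqr_ge0// divr_ge0// ltW.
Qed.

Lemma continuous_poisson e : 0 < e -> continuous (poisson e).
Proof.
move=> e0 t; apply: (@d_continuous _ (fun t : R => 2 * e / (e ^+ 2 + (2 * pi * t) ^+ 2))).
repeat der1.
by rewrite gt_eqF// ltr_pwDl ?exprn_gt0 ?sqr_ge0.
Qed.

Lemma int_poisson e x a b : 0 < e -> a <= b ->
  \int[mu]_(y in `[a, b]) poisson e (x - y) =
  pi^-1 * (atan (2 * pi * (x - a) / e) - atan (2 * pi * (x - b) / e)).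
Proof.
move=> e0 ab; have e1 : e != 0 by rewrite gt_eqF.
have p1 : pi != 0 :> R by rewrite gt_eqF ?pi_gt0.
rewrite (@Rftc2 _ _ (fun y => - pi^-1 * atan (2 * pi * (x - y) * e^-1)))//.
- by rewrite mulrBr; ring.
- move=> y _; der; rewrite /poisson; move: (pi : R) p1 => p p1.
  have D0 : e ^+ 2 + (2 * p * (x - y)) ^+ 2 != 0.
    by rewrite gt_eqF// ltr_pwDl ?exprn_gt0 ?sqr_ge0.
  have D1 : 1 + (2 * p * (x - y) / e) ^+ 2 != 0.
    by rewrite gt_eqF// ltr_pwDl ?sqr_ge0.
  by field; rewrite e1 p1 D0.
- move=> y _; apply: (@continuous_comp _ _ _ (fun y => x - y)); last exact: continuous_poisson.
  by cont.
Qed.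

Lemma int_poisson_le1 e x a b : 0 < e -> a <= b ->
  \int[mu]_(y in `[a, b]) poisson e (x - y) <= 1.
Proof.
move=> e0 ab; rewrite int_poisson// ler_pdivrMl ?pi_gt0// mulr1.
have := atan_ltpi2 (2 * pi * (x - a) / e).
have := atan_gtNpi2 (2 * pi * (x - b) / e).
lra.
Qed.

End PoissonKernel.

(** * Abel summation of the Fourier integral *)

Section AbelFourier.
Context {R : realType}.
Implicit Types (f g h k : R -> R[i]) (e s t x y : R).

Definition bsupp h := exists n : nat, forall x, n%:R < `|x| -> h x = 0.

Definition pconv e k x : R[i] := cintegral (fun y => (poisson e (x - y))%:C * k y).

Lemma intR_indic (a b : R) : intR (\1_(`[a, b]%classic)).
Proof.
apply/integrableP; split.
  by apply: measurable_funE; exact: measurable_indic.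
under eq_integral do rewrite gee0_abs ?lee_fin//.
rewrite integral_indic// setIT.
apply: (@le_lt_trans _ _ (lebesgue_measure `[a, b]%classic)); first by [].
rewrite lebesgue_measure_itv /=.
by case: ifP => // _; rewrite -EFinB ltry.
Qed.

(** On the bounded support each component satisfies |z| <= z^2 + 1. *)
Lemma L2_bsupp_cint h : L2 h -> bsupp h -> cint h.
Proof.
move=> Lh [n hn]; have Is := intRD (L2_sqn Lh) (intR_indic (- n%:R) n%:R).
have key z x : (n%:R < `|x| -> z = 0) -> z ^+ 2 <= sqn (h x) ->
    `|z| <= sqn (h x) + \1_(`[- n%:R, n%:R]%classic) x.
  move=> z0 zh; have [xn|xn] := ltP n%:R `|x|.
    by rewrite z0// normr0 addr_ge0 ?sqn_ge0// indicE.
  rewrite indicE mem_set /=; last by rewrite in_itv /= -ler_norml.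
  rewrite (le_trans _ (lerD zh (lexx 1)))//.
  have <- : `|z| ^+ 2 = z ^+ 2 by rewrite real_normK ?num_real.
  by move: `|z| => w; have := sqr_ge0 (w - 1); have := sqr_ge0 w; nra.
split.
- apply: (intR_le _ _ Is) => [|x]; first by case: (L2_cmf Lh).
  by apply: key => [/hn ->//|]; exact: Re_sqr_le.
- apply: (intR_le _ _ Is) => [|x]; first by case: (L2_cmf Lh).
  by apply: key => [/hn ->//|]; exact: Im_sqr_le.
Qed.

Lemma cint_phase k s : cint k -> cint (fun x => expi (- (2 * pi * x * s)) * k x).
Proof.
move=> Ik; have := cint_expiM (- (2 * pi * s)) Ik.
by congr (cint _); apply/funext => x; congr (expi _ * _); ring.
Qed.

Lemma fourierL1D f g : cint f -> cint g ->
  fourierL1 (fun x => f x + g x) = (fun s => fourierL1 f s + fourierL1 g s).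
Proof.
move=> If Ig; apply/funext => s; rewrite /fourierL1 -cintegralD; [|exact: cint_phase..].
by apply: eq_cintegral => x; rewrite mulrDr.
Qed.

Lemma fourierL1Z (a : R[i]) f : cint f ->
  fourierL1 (fun x => a * f x) = (fun s => a * fourierL1 f s).
Proof.
move=> If; apply/funext => s; rewrite /fourierL1 -cintegralZ; last exact: cint_phase.
by apply: eq_cintegral => x; rewrite mulrCA.
Qed.

Lemma fourierL1B f g : cint f -> cint g ->
  fourierL1 (fun x => f x - g x) = (fun s => fourierL1 f s - fourierL1 g s).
Proof.
move=> If Ig; rewrite (_ : (fun x => f x - g x) = (fun x => f x + (-1) * g x)).
  rewrite fourierL1D ?fourierL1Z//; last exact: cintZ.
  by apply/funext => s; rewrite mulN1r.
by apply/funext => x; rewrite mulN1r.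
Qed.

Lemma fourierL1_bounded k : cint k ->
  exists C, forall s, normc (fourierL1 k s) <= C.
Proof.
move=> Ik; exists (\int[mu]_x normc (k x) + \int[mu]_x normc (k x)) => s.
have [i1 i2] := cint_phase s Ik; have nk := cint_normc Ik.
apply: (le_trans (normc_le _)); apply: lerD.
- apply: (le_trans (le_normr_Rintegral _ i1)) => //.
  apply: le_Rintegral => //; first exact: (integrable_norm i1).
  by move=> x _; rewrite (le_trans (Re_le_normc _))// Normc.normcM normc_expi mul1r.
- apply: (le_trans (le_normr_Rintegral _ i2)) => //.
  apply: le_Rintegral => //; first exact: (integrable_norm i2).
  by move=> x _; rewrite (le_trans (Im_le_normc _))// Normc.normcM normc_expi mul1r.
Qed.

Lemma intR_fubini (p : R * R -> R) : (mu \x mu)%E.-integrable setT (EFin \o p) ->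
  intR (fun x => \int[mu]_y p (x, y)).
Proof.
move=> Ip; have H := integrable_fubini_F Ip.
have mH := measurable_int mu H.
apply/integrableP; split.
  by apply: measurable_funE; apply: measurableT_comp; first by [].
move/integrableP: (H) => [_]; apply: le_lt_trans.
apply: ge0_le_integral => //.
- apply: measurableT_comp => //; apply: measurable_funE.
  by apply: measurableT_comp; first by [].
- exact: measurableT_comp.
- move=> x _ /=; rewrite /Rintegral /fubini_F /=.
  by case: (\int[mu]_y _)%E => [r| |] /=; rewrite ?normr0 ?leey.
Qed.

Let phase (z : R * R) : R := - (2 * pi * z.2 * z.1).

Let mphase : measurable_fun [set: R * R] phase.
Proof.
apply: measurableT_comp => //; apply: measurable_funM; last exact: measurable_fst.
by apply: measurable_funM => //; exact: measurable_snd.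
Qed.

(** Fubini gives measurability of a partial integral of a function integrable on the plane, but the
    Fourier kernel is not integrable in the frequency. It becomes so after multiplication by
    [abel 1], a positive factor that is divided out afterwards. *)
Lemma fourierL1_cmf k : cint k -> cmf (fourierL1 k).
Proof.
move=> Ik; have [k1 k2] := cint_cmf Ik.
have mb1 : measurable_fun [set: R * R] (fun z => Re (k z.2)).
  by apply: (measurableT_comp k1); exact: measurable_snd.
have mb2 : measurable_fun [set: R * R] (fun z => Im (k z.2)).
  by apply: (measurableT_comp k2); exact: measurable_snd.
have mc : measurable_fun [set: R * R] (fun z => cos (phase z)).
  apply: (measurableT_comp (f := @cos R)) mphase.
  by apply: continuous_measurable_fun; exact: continuous_cos.
have ms : measurable_fun [set: R * R] (fun z => sin (phase z)).
  apply: (measurableT_comp (f := @sin R)) mphase.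
  by apply: continuous_measurable_fun; exact: continuous_sin.
have ma : measurable_fun [set: R * R] (fun z : R * R => abel 1 z.1).
  by apply: (measurableT_comp (measurable_abel 1)); exact: measurable_fst.
have aux (p : R * R -> R) : measurable_fun setT p ->
    (forall s, intR (fun x => p (s, x))) ->
    (forall z, `|p z| <= normc (k z.2)) ->
    measurable_fun setT (fun s => \int[mu]_x p (s, x)).
  move=> mp ip pk.
  have I1 : (mu \x mu)%E.-integrable setT (EFin \o (fun z => abel 1 z.1 * p z)).
    apply: (@prod_integrable_le _ _ (abel 1) (fun x => normc (k x))).
    - exact: measurable_funM.
    - exact: intR_abel.
    - exact: cint_normc.
    - by move=> x; exact: abel_ge0.
    - by move=> z; rewrite normrM gtr0_norm ?abel_gt0// ler_wpM2l ?abel_ge0.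
  have := intR_meas (intR_fubini I1).
  have -> : (fun s => \int[mu]_x p (s, x)) =
      (fun s => expR (1 * `|s|) * \int[mu]_y (abel 1 s * p (s, y))).
    apply/funext => s; rewrite RintegralZl// mulrA /abel -expRD subrr expR0 mul1r//.
  move=> H; apply: measurable_funM => //.
  apply: (measurableT_comp (f := @expR R)); first exact: measurable_expR.
  by apply: measurable_funM => //; exact: measurable_normr.
split.
- apply: (aux (fun z => Re (expi (phase z) * k z.2))).
  + under eq_fun do rewrite !cE /expi /=.
    by apply: measurable_funB; exact: measurable_funM.
  + by move=> s; case: (cint_phase s Ik).
  + by move=> z; rewrite (le_trans (Re_le_normc _))// Normc.normcM normc_expi mul1r.
- apply: (aux (fun z => Im (expi (phase z) * k z.2))).
  + under eq_fun do rewrite !cE /expi /=.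
    by apply: measurable_funD; exact: measurable_funM.
  + by move=> s; case: (cint_phase s Ik).
  + by move=> z; rewrite (le_trans (Im_le_normc _))// Normc.normcM normc_expi mul1r.
Qed.

Lemma cint_abel_fourier e k : 0 < e -> cint k ->
  cint (fun s => (abel e s)%:C * (fourierL1 k s)^*%R).
Proof.
move=> e0 Ik; have [C HC] := fourierL1_bounded Ik.
apply: (@cint_abelM _ _ _ C) => //; first by apply: cmf_conj; exact: fourierL1_cmf.
by move=> s; rewrite normc_sqrt sqn_conj -normc_sqrt.
Qed.

(** The multiplication formula for [k] and a modulated Abel factor, whose transform at [y] is
    [poisson e (x - y)]: a regularised form of Fourier inversion. *)
Lemma fourierL1_abel_fourier e k x : 0 < e -> cint k ->
  fourierL1 (fun s => (abel e s)%:C * (fourierL1 k s)^*%R) x = (pconv e k x)^*%R.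
Proof.
move=> e0 Ik.
have Ia : cint (fun s => (abel e s)%:C * expi (2 * pi * x * s)).
  apply: (@cint_abelM _ _ _ 1) => //; first exact: cmf_expi.
  by move=> s; rewrite normc_expi.
have H := multiplication_formula Ia Ik.
have -> : pconv e k x = cintegral (fun s => ((abel e s)%:C * expi (2 * pi * x * s)) * fourierL1 k s).
  rewrite H; apply: eq_cintegral => y; congr (_ * _).
  rewrite -cintegral_abel_expi//; apply: eq_cintegral => s.
  rewrite mulrCA; congr (_ * _); rewrite -expiD; congr expi; ring.
rewrite -cintegral_conj; last first.
  have [C HC] := fourierL1_bounded Ik.
  have := @cint_abelM _ e (fun s => expi (2 * pi * x * s) * fourierL1 k s) C e0.
  rewrite (_ : (fun s => (abel e s)%:C * (expi (2 * pi * x * s) * fourierL1 k s)) =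
    (fun s => (abel e s)%:C * expi (2 * pi * x * s) * fourierL1 k s)).
    apply.
    - by apply: cmfM; [exact: cmf_expi|exact: fourierL1_cmf].
    - by move=> s; rewrite Normc.normcM normc_expi mul1r.
  by apply/funext => s; rewrite mulrA.
apply: eq_cintegral => s; rewrite !conjCM expi_conj mulrCA mulrA; congr (_ * _ * _).
- by apply: complexP; rewrite !cE /= ?oppr0.
- congr expi; ring.
Qed.

(** Parseval's identity with the frequency integral damped by the Abel factor; the damping reappears
    as Poisson smoothing of [k]. *)
Lemma abel_formula e h k : 0 < e -> cint h -> cint k ->
  cintegral (fun s => (abel e s)%:C * (fourierL1 h s * (fourierL1 k s)^*%R)) =
  cintegral (fun x => h x * (pconv e k x)^*%R).
Proof.
move=> e0 Ih Ik; have H := multiplication_formula (cint_abel_fourier e0 Ik) Ih.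
transitivity (cintegral (fun s => ((abel e s)%:C * (fourierL1 k s)^*%R) * fourierL1 h s)).
  by apply: eq_cintegral => s; rewrite -mulrA; congr (_ * _); rewrite mulrC.
by rewrite H; apply: eq_cintegral => x; rewrite fourierL1_abel_fourier// mulrC.
Qed.

(** [pconv e k] is the conjugate of the Fourier integral of an integrable function. Measurability
    here, and boundedness in the next lemma, come from that. *)
Lemma pconv_cmf e k : 0 < e -> cint k -> cmf (pconv e k).
Proof.
move=> e0 Ik; have := cmf_conj (fourierL1_cmf (cint_abel_fourier e0 Ik)).
by congr cmf; apply/funext => x; rewrite fourierL1_abel_fourier// conjCC.
Qed.

Lemma pconv_bounded e k : 0 < e -> cint k -> exists C, forall x, normc (pconv e k x) <= C.
Proof.
move=> e0 Ik; have [C HC] := fourierL1_bounded (cint_abel_fourier e0 Ik); exists C => x.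
by rewrite -[pconv e k x]conjCC -fourierL1_abel_fourier// normc_sqrt sqn_conj -normc_sqrt.
Qed.

Lemma intR_poisson_le e k x : 0 < e -> cint k ->
  cint (fun y => (poisson e (x - y))%:C * k y).
Proof.
move=> e0 Ik; have Pc : cmf (fun y => (poisson e (x - y))%:C).
  apply: cmf_real; apply: continuous_measurable_fun => y.
  apply: (@continuous_comp _ _ _ (fun y => x - y)); last exact: continuous_poisson.
  by cont.
have nP y : normc (poisson e (x - y))%:C <= 2 / e.
  by rewrite /= expr0n addr0 sqrtr_sqr ger0_norm ?poisson_ge0// poisson_le.
apply: (@cint_le _ _ (fun y => 2 / e * normc (k y))).
- by apply: cmfM => //; exact: cint_cmf.
- move=> y; rewrite (le_trans (Re_le_normc _))// Normc.normcM.
  by rewrite ler_wpM2r// normc_ge0.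
- move=> y; rewrite (le_trans (Im_le_normc _))// Normc.normcM.
  by rewrite ler_wpM2r// normc_ge0.
- exact/intRZ/cint_normc.
Qed.

End AbelFourier.

(** * The energy bound and duality with step functions *)

Section FourierBound.
Context {R : realType}.
Implicit Types (f g h k : R -> R[i]) (e s t x y : R).

Lemma cintM_bounded h k (C : R) : cint h -> cmf k -> (forall x, normc (k x) <= C) ->
  cint (fun x => h x * k x).
Proof.
move=> Ih mk kC; apply: (@cint_le _ _ (fun x => C * normc (h x))).
- by apply: cmfM => //; exact: cint_cmf.
- move=> x; rewrite (le_trans (Re_le_normc _))// Normc.normcM mulrC.
  by rewrite ler_wpM2r ?normc_ge0.
- move=> x; rewrite (le_trans (Im_le_normc _))// Normc.normcM mulrC.
  by rewrite ler_wpM2r ?normc_ge0.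
- exact/intRZ/cint_normc.
Qed.

Lemma normc_conj (z : R[i]) : normc (z^*%R) = normc z.
Proof. by rewrite !normc_sqrt sqn_conj. Qed.

Lemma cint_pairing e h k : 0 < e -> cint h -> cint k ->
  cint (fun x => h x * (pconv e k x)^*%R).
Proof.
move=> e0 Ih Ik; have [C HC] := pconv_bounded e0 Ik.
apply: (cintM_bounded (C := C)) => //; first by apply: cmf_conj; exact: pconv_cmf.
by move=> x; rewrite normc_conj.
Qed.

Lemma Rintegral_itv_indic (a b : R) (p : R -> R) :
  \int[mu]_(y in `[a, b]) p y = \int[mu]_y (\1_(`[a, b]%classic) y * p y).
Proof.
rewrite Rintegral_mkcond; apply: eq_Rintegral => y _.
by rewrite patchE indicE; case: (y \in _); rewrite ?mul1r ?mul0r.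
Qed.

Lemma measurable_poisson e : 0 < e -> measurable_fun setT (poisson e).
Proof. by move=> e0; apply: continuous_measurable_fun; exact: continuous_poisson. Qed.

Lemma Re_real_pairing (p : R) (z w : R[i]) :
  Re (z * (p%:C * w)^*%R) =
  p * (Re z * Re w + Im z * Im w).
Proof. by rewrite !cE /=; ring. Qed.

(* Young's inequality for the Poisson kernel, whose total mass is one. *)
Lemma pconv_pairing_le e h : 0 < e -> L2 h -> bsupp h ->
  \int[mu]_x Re (h x * (pconv e h x)^*%R) <= nsq h.
Proof.
move=> e0 Lh bh; have Ih := L2_bsupp_cint Lh bh; have Sh := L2_sqn Lh.
have [n hn] := bh.
(* The cutoff is 1 on the support of [h]. It makes the kernel [G] integrable on the plane and
   reduces the mass of the Poisson kernel to a bounded interval, where [int_poisson_le1] applies. *)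
pose chi : R -> R := \1_(`[- n%:R, n%:R]%classic).
have nn : - n%:R <= n%:R :> R by rewrite lerNl (le_trans (_ : - n%:R <= 0))// oppr_le0.
have chi_out x : n%:R < `|x| -> chi x = 0.
  by move=> nx; rewrite /chi indicE memNset //= in_itv /= -ler_norml leNgt nx.
have chi_in x : `|x| <= n%:R -> chi x = 1.
  by move=> nx; rewrite /chi indicE mem_set //= in_itv /= -ler_norml.
have chi0 x : 0 <= chi x by rewrite /chi indicE.
have P0 t : 0 <= poisson e t by exact: poisson_ge0.
have P1 t : poisson e t <= 2 / e by exact: poisson_le.
have Ps0 t y : 0 <= poisson e t * sqn (h y) by apply: mulr_ge0 => //; exact: sqn_ge0.
have Ps1 t y : poisson e t * sqn (h y) <= 2 / e * sqn (h y).
  by apply: ler_wpM2r => //; exact: sqn_ge0.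
have mchi : measurable_fun setT chi by exact: measurable_indic.
have Ichi : intR chi by exact: intR_indic.
pose G (z : R * R) := chi z.1 * (poisson e (z.1 - z.2) * sqn (h z.2)).
have mS : measurable_fun [set: R * R] (fun z => sqn (h z.2)).
  by apply: (measurableT_comp (cmf_sqn (L2_cmf Lh))); exact: measurable_snd.
have mP : measurable_fun [set: R * R] (fun z => poisson e (z.1 - z.2)).
  apply: (measurableT_comp (measurable_poisson e0)).
  by apply: measurable_funB; [exact: measurable_fst|exact: measurable_snd].
have IG : (mu \x mu)%E.-integrable setT (EFin \o G).
  apply: (@prod_integrable_le _ _ chi (fun y => 2 / e * sqn (h y))) => //.
  - apply: measurable_funM; last exact: measurable_funM.
    by apply: (measurableT_comp mchi); exact: measurable_fst.
  - exact: intRZ.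
  - move=> z; rewrite (ger0_norm (mulr_ge0 (chi0 _) (Ps0 _ _))).
    exact: ler_wpM2l.
have q1 x : \int[mu]_y (chi y * poisson e (x - y)) <= 1.
  by rewrite -Rintegral_itv_indic int_poisson_le1.
have iq x : intR (fun y => chi y * poisson e (x - y)).
  apply: (@intR_le _ _ (fun y => 2 / e * chi y)); last exact: intRZ.
  - apply: measurable_funM => //; apply: (measurableT_comp (measurable_poisson e0)).
    exact: measurable_funB.
  - move=> y; rewrite (ger0_norm (mulr_ge0 (chi0 _) (P0 _))) mulrC.
    exact: ler_wpM2r.
have iPs x : intR (fun y => poisson e (x - y) * sqn (h y)).
  apply: (@intR_le _ _ (fun y => 2 / e * sqn (h y))); last exact: intRZ.
  - apply: measurable_funM; last exact: (cmf_sqn (L2_cmf Lh)).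
    apply: (measurableT_comp (measurable_poisson e0)).
    exact: measurable_funB.
  - by move=> y; rewrite (ger0_norm (Ps0 _ _)).
have GE x : \int[mu]_y G (x, y) = chi x * \int[mu]_y (poisson e (x - y) * sqn (h y)).
  by rewrite /G /= RintegralZl.
have G0 x : 0 <= \int[mu]_y G (x, y).
  by apply: Rintegral_ge0 => y _; exact: mulr_ge0 (chi0 _) (Ps0 _ _).
have IGx := intR_fubini IG.
have pt x : Re (h x * (pconv e h x)^*%R) <=
    2^-1 * sqn (h x) + 2^-1 * \int[mu]_y G (x, y).
  have [nx|nx] := ltP n%:R `|x|.
    by rewrite hn// mul0r sqn0 mulr0 add0r; exact: mulr_ge0.
  have Ix := intR_poisson_le x e0 Ih.
  have -> : Re (h x * (pconv e h x)^*%R) =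
      \int[mu]_y Re (h x * (((poisson e (x - y))%:C * h y)^*%R)).
    rewrite /pconv -cintegral_conj// -cintegralZ//.
    exact: cint_conj.
  apply: (@le_trans _ _ (\int[mu]_y (2^-1 * sqn (h x) * (chi y * poisson e (x - y)) +
                                     2^-1 * (poisson e (x - y) * sqn (h y))))).
    apply: le_Rintegral => //.
    - by case: (cintZ (h x) (cint_conj Ix)).
    - by apply: intRD; exact: intRZ.
    - move=> y _; have [ny|ny] := ltP n%:R `|y|.
        by rewrite Re_real_pairing (hn y ny) (chi_out y ny) sqn0 /= !(mulr0, mul0r, addr0).
      rewrite chi_in// mul1r Re_real_pairing.
      rewrite /sqn; have p0 := P0 (x - y).
      move: (poisson e (x - y)) p0 (Re (h x)) (Im (h x)) (Re (h y)) (Im (h y)).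
      move=> p p0 a b c d.
      rewrite -subr_ge0 (_ : _ - _ = p * (2^-1 * ((a - c) ^+ 2 + (b - d) ^+ 2))).
        by rewrite mulr_ge0// mulr_ge0 ?addr_ge0 ?sqr_ge0.
      by field.
  rewrite RintegralD ?RintegralZl//; try exact: intRZ.
  rewrite GE chi_in// mul1r lerD2r -[leRHS]mulr1 ler_wpM2l// mulr_ge0 ?sqn_ge0//.
have IL : intR (fun x => Re (h x * (pconv e h x)^*%R)).
  by case: (cint_pairing e0 Ih Ih).
apply: (@le_trans _ _ (\int[mu]_x (2^-1 * sqn (h x) + 2^-1 * \int[mu]_y G (x, y)))).
  by apply: le_Rintegral => //; apply: intRD; exact: intRZ.
rewrite RintegralD ?RintegralZl//; try exact: intRZ.
rewrite (Rintegral_fubini IG).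
have : \int[mu]_y \int[mu]_x G (x, y) <= nsq h.
  apply: le_Rintegral => //.
    have := intR_fubini (integrable_swap IG).
    by [].
  move=> y _; rewrite /G /=.
  have -> : \int[mu]_x (chi x * (poisson e (x - y) * sqn (h y))) =
            sqn (h y) * \int[mu]_x (chi x * poisson e (y - x)).
    rewrite -RintegralZl//; apply: eq_Rintegral => x _.
    by rewrite -(poissonN e (y - x)) opprB; ring.
  by rewrite -[leRHS]mulr1 ler_wpM2l ?sqn_ge0.
rewrite /nsq; lra.
Qed.

Lemma abel_cvg1 s : abel n.+1%:R^-1 s @[n --> \oo] --> (1 : R).
Proof.
rewrite /abel; have H : - (n.+1%:R^-1 * `|s|) @[n --> \oo] --> (0 : R).
  rewrite -oppr0; apply: cvgN; rewrite -[X in _ --> X](mul0r `|s|).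
  by apply: cvgM; [exact: cvg_harmonic|exact: cvg_cst].
have := cvg_comp _ _ H (@continuous_expR R 0).
by rewrite expR0.
Qed.

(** [abel_formula] with both functions equal to [h] bounds the damped energy by [nsq h], uniformly
    in the damping, and Fatou's lemma removes the damping. This contraction is what later lets the
    isometry pass from step functions to their limits. *)
Lemma fourierL1_L2 h : L2 h -> bsupp h ->
  L2 (fourierL1 h) /\ nsq (fourierL1 h) <= nsq h.
Proof.
move=> Lh bh; have Ih := L2_bsupp_cint Lh bh; have mF := fourierL1_cmf Ih.
have bnd : (\int[mu]_s (sqn (fourierL1 h s))%:E <= (nsq h)%:E)%E.
  apply: (@fatou_bound _ (fun n s => abel n.+1%:R^-1 s * sqn (fourierL1 h s))).
  - by move=> n; apply: measurable_funM; [exact: measurable_abel|exact: cmf_sqn].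
  - by move=> n s; rewrite mulr_ge0 ?abel_ge0 ?sqn_ge0.
  - move=> s; rewrite -[X in _ --> X]mul1r; apply: cvgM; first exact: abel_cvg1.
    exact: cvg_cst.
  - move=> n; have e0 : 0 < n.+1%:R^-1 :> R by rewrite invr_gt0.
    have E s : abel n.+1%:R^-1 s * sqn (fourierL1 h s) =
        Re ((abel n.+1%:R^-1 s)%:C * (fourierL1 h s * (fourierL1 h s)^*%R)).
      by rewrite mulCconj !cE /= mulr0 subr0.
    have [C HC] := fourierL1_bounded Ih.
    have [I1 _] : cint (fun s => (abel n.+1%:R^-1 s)%:C * (fourierL1 h s * (fourierL1 h s)^*%R)).
      apply: (@cint_abelM _ _ _ (C * C)) => //.
      + by apply: cmfM => //; exact: cmf_conj.
      + by move=> s; rewrite Normc.normcM normc_conj ler_pM ?normc_ge0.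
    under eq_integral do rewrite E.
    have -> : (\int[mu]_s (Re ((abel n.+1%:R^-1 s)%:C * (fourierL1 h s * (fourierL1 h s)^*%R)))%:E =
       (\int[mu]_s Re ((abel n.+1%:R^-1 s)%:C * (fourierL1 h s * (fourierL1 h s)^*%R)))%:E)%E.
      by rewrite /Rintegral fineK//; exact: integrable_fin_num.
    rewrite lee_fin; have := congr1 (@complex.Re R) (abel_formula e0 Ih Ih).
    rewrite /cintegral /= => ->; exact: pconv_pairing_le.
have LF : L2 (fourierL1 h).
  apply/L2P; split=> //; apply/integrableP; split; first exact: cmf_sqnE.
  under eq_integral do rewrite gee0_abs ?lee_fin ?sqn_ge0//.
  by apply: le_lt_trans bnd _; exact: ltry.
by split=> //; rewrite -lee_fin -nsqE.
Qed.

Lemma cintegral_dominated (f_ : nat -> R -> R[i]) f (q : R -> R) :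
  (forall n, cmf (f_ n)) -> cmf f ->
  (\forall x \ae mu, Re (f_ n x) @[n --> \oo] --> Re (f x) /\
     Im (f_ n x) @[n --> \oo] --> Im (f x)) ->
  intR q -> (forall n x, normc (f_ n x) <= q x) ->
  Re (cintegral (f_ n)) @[n --> \oo] --> Re (cintegral f) /\
  Im (cintegral (f_ n)) @[n --> \oo] --> Im (cintegral f).
Proof.
move=> mf_ [m1 m2] cv iq fq; split; apply: (Rintegral_dominated (q := q)) => //.
- by move=> n; case: (mf_ n).
- by apply: aeS cv => x [].
- by move=> n x; rewrite (le_trans (Re_le_normc _)).
- by move=> n; case: (mf_ n).
- by apply: aeS cv => x [].
- by move=> n x; rewrite (le_trans (Im_le_normc _)).
Qed.

(** Half-open, so that adjacent steps add up at every point, not just almost everywhere. *)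
Definition step (a b : R) : R -> R[i] := fun x => (\1_(`[a, b[%classic) x)%:C.

Lemma step_sqn a b x : sqn (step a b x) = \1_(`[a, b[%classic) x.
Proof. by rewrite /sqn /step /= indicE; case: (x \in _); rewrite ?expr1n expr0n addr0. Qed.

Lemma step_cmf a b : cmf (step a b).
Proof. by apply: cmf_real; exact: measurable_indic. Qed.

Lemma step_L2 a b : L2 (step a b).
Proof.
apply/L2P; split; first exact: step_cmf.
under eq_fun do rewrite step_sqn.
apply: (@intR_le _ _ _ _ _ (intR_indic a b)); first exact: measurable_indic.
move=> x; rewrite !indicE ger0_norm//.
have [xab|_] := boolP (x \in `[a, b[%classic) => //.
rewrite mem_set//; move: xab; rewrite inE /= !in_itv /= => /andP[-> /ltW ->] //.
Qed.

Lemma step_bsupp a b : bsupp (step a b).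
Proof.
exists (Num.bound (Num.max `|a| `|b|)) => x H.
rewrite /step indicE memNset//= in_itv /= => /andP[ax xb].
move: H; apply/negP; rewrite -leNgt; apply: le_trans (ltW (archi_boundP _)); last first.
  by rewrite le_max normr_ge0.
rewrite le_max; have [x0|x0] := leP 0 x.
  by apply/orP; right; rewrite (ger0_norm x0) (le_trans (ltW xb))// ler_norm.
by apply/orP; left; rewrite (ltr0_norm x0) -normrN (le_trans _ (ler_norm _))// lerN2.
Qed.

Lemma ae_neq (a : R) : \forall x \ae mu, x != a.
Proof.
exists [set a]; split => //; first exact: lebesgue_measure_set1.
by move=> x /= /negP; rewrite negbK => /eqP.
Qed.

Lemma pconv_step e a b x : 0 < e -> a <= b -> pconv e (step a b) x =
  (pi^-1 * (atan (2 * pi * (x - a) / e) - atan (2 * pi * (x - b) / e)))%:C.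
Proof.
move=> e0 ab; rewrite -int_poisson// /pconv; apply: complexP; rewrite /cintegral /=.
- transitivity (\int[mu]_(y in `[a, b[) poisson e (x - y)).
    rewrite Rintegral_mkcond; apply: eq_Rintegral => y _; rewrite patchE indicE.
    by case: (y \in _); rewrite ?mulr1 ?mulr0 subr0.
  apply: Rintegral_itv_bndo_bndc.
  have cP : continuous (fun y => poisson e (x - y)).
    move=> y; apply: (@continuous_comp _ _ _ (fun y => x - y)); last exact: continuous_poisson.
    by cont.
  have : mu.-integrable `[a, b] (EFin \o (fun y => poisson e (x - y))).
    apply: continuous_compact_integrable; first exact: segment_compact.
    exact: continuous_subspaceT.
  by apply: integrableS => // y /=; rewrite !in_itv /= => /andP[-> /ltW ->].
- under eq_Rintegral do rewrite mulr0 mul0r addr0.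
  by rewrite Rintegral_cst//= mul0r.
Qed.

Lemma atan_scaled_cvg (t : R) : t != 0 ->
  atan (2 * pi * t / n.+1%:R^-1) @[n --> \oo] --> (if 0 < t then pi / 2 else - (pi / 2) : R).
Proof.
have H (c : R) : 0 < c -> atan (2 * pi * c / n.+1%:R^-1) @[n --> \oo] --> (pi / 2 : R).
  move=> c0; have p0 : 0 < 2 * pi * c by rewrite !mulr_gt0// pi_gt0.
  have L : 2 * pi * c / n.+1%:R^-1 @[n --> \oo] --> (+oo : set_system R).
    apply/cvgryPge => A; near=> n; rewrite invrK mulrC -ler_pdivrMr//.
    rewrite (@le_trans _ _ n%:R)// ?ler_nat//.
    by near: n; apply: nbhs_infty_ger.
  exact: (cvg_comp _ _ L (@cvgy_atan R)).
rewrite neq_lt => /orP[t0|t0].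
- rewrite ltNge (ltW t0) /=.
  have := H (- t); rewrite oppr_gt0 => /(_ t0) L.
  have L2 := cvgnB (cvgn_cst 0) L; rewrite sub0r in L2.
  by apply: cvgn_eq L2 => n; rewrite sub0r mulrN mulNr atanN opprK.
- by rewrite t0; exact: H.
Unshelve. all: by end_near. Qed.

(** Each arctangent tends to plus or minus pi / 2 according to the side of the endpoint on which [x]
    lies. The endpoints are excluded because for a < b the limit there is one half. *)
Lemma step_pconv_cvg (a b x : R) : a <= b -> x != a -> x != b ->
  (pi^-1 * (atan (2 * pi * (x - a) / n.+1%:R^-1) - atan (2 * pi * (x - b) / n.+1%:R^-1)))
    @[n --> \oo] --> (\1_(`[a, b[%classic) x : R).
Proof.
move=> ab xa xb; have p0 := @pi_gt0 R.
have La := atan_scaled_cvg (t := x - a); have Lb := atan_scaled_cvg (t := x - b).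
have H := cvgnZ pi^-1 (cvgnB (La _) (Lb _)).
rewrite (_ : \1__ x = pi^-1 * ((if 0 < x - a then pi / 2 else - (pi / 2)) -
  (if 0 < x - b then pi / 2 else - (pi / 2)))); first by apply: H; rewrite subr_eq0.
rewrite !subr_gt0 indicE; have -> : (x \in `[a, b[%classic) = (a <= x) && (x < b).
  by apply/idP/idP; rewrite inE /= in_itv.
have [ax|ax|ax] := ltgtP a x; last by rewrite ax eqxx in xa.
- have [bx|bx|bx] := ltgtP b x => /=; last by rewrite bx eqxx in xb.
  + by rewrite subrr mulr0.
  + by move: (pi : R) p0 => p p0; field; rewrite gt_eqF.
- by rewrite (ltNge b) (le_trans (ltW ax) ab) /= subrr mulr0.
Qed.

(** The limit of [abel_formula] as the damping vanishes. The left side is dominated by a product of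
    two transforms, integrable by the energy bound; the right side by the modulus of [h], since the
    smoothed step lies between 0 and 1. *)
Lemma step_duality h a b : L2 h -> bsupp h -> a <= b ->
  inner (fourierL1 h) (fourierL1 (step a b)) = inner h (step a b).
Proof.
move=> Lh bh ab; have Ih := L2_bsupp_cint Lh bh.
have Ik := L2_bsupp_cint (step_L2 a b) (step_bsupp a b).
have [LF _] := fourierL1_L2 Lh bh.
have [LK _] := fourierL1_L2 (step_L2 a b) (step_bsupp a b).
have IFK := L2_cint_inner LF LK.
have e0 n : 0 < n.+1%:R^-1 :> R by rewrite invr_gt0.
pose K s := fourierL1 h s * (fourierL1 (step a b) s)^*%R.
pose A n s := (abel n.+1%:R^-1 s)%:C * K s.
pose L x := h x * (step a b x)^*%R.
pose B n x := h x * (pconv n.+1%:R^-1 (step a b) x)^*%R.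
have AB n : cintegral (A n) = cintegral (B n) by exact: abel_formula.
have [c1 c2] : Re (cintegral (A n)) @[n --> \oo] --> Re (cintegral K) /\
    Im (cintegral (A n)) @[n --> \oo] --> Im (cintegral K).
  apply: (cintegral_dominated (q := fun s => normc (K s))).
  - move=> n; apply: cmfM; last exact: cint_cmf.
    by apply: cmf_real; exact: measurable_abel.
  - exact: cint_cmf.
  - apply: aeW => s; split.
    + have := cvgnM (abel_cvg1 s) (cvgn_cst (Re (K s))).
      by rewrite mul1r; apply: cvgn_eq => n; rewrite /A cReM /= mul0r subr0.
    + have := cvgnM (abel_cvg1 s) (cvgn_cst (Im (K s))).
      by rewrite mul1r; apply: cvgn_eq => n; rewrite /A cImM /= mul0r addr0.
  - exact: cint_normc.
  - move=> n s; rewrite /A Normc.normcM -[leRHS]mul1r ler_wpM2r ?normc_ge0//=.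
    rewrite expr0n addr0 sqrtr_sqr gtr0_norm ?abel_gt0// /abel -[leRHS]expR0 ler_expR.
    by rewrite oppr_le0 mulr_ge0// ltW.
have [d1 d2] : Re (cintegral (B n)) @[n --> \oo] --> Re (cintegral L) /\
    Im (cintegral (B n)) @[n --> \oo] --> Im (cintegral L).
  apply: (cintegral_dominated (q := fun x => normc (h x))).
  - move=> n; apply: cmfM; first exact: cint_cmf.
    by apply: cmf_conj; exact: pconv_cmf.
  - by apply: cmfM; [exact: cint_cmf|apply: cmf_conj; exact: step_cmf].
  - apply: aeS2 (ae_neq a) (ae_neq b) => x xa xb.
    have H := step_pconv_cvg ab xa xb; split.
    + have := cvgnM (cvgn_cst (Re (h x))) H.
      rewrite /L cReM cReC cImC /= oppr0 mulr0 subr0; apply: cvgn_eq => n.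
      by rewrite /B pconv_step// cReM cReC cImC /= oppr0 mulr0 subr0.
    + have := cvgnM (cvgn_cst (Im (h x))) H.
      rewrite /L cImM cReC cImC /= oppr0 mulr0 add0r; apply: cvgn_eq => n.
      by rewrite /B pconv_step// cImM cReC cImC /= oppr0 mulr0 add0r.
  - exact: cint_normc.
  - move=> n x; rewrite /B Normc.normcM normc_conj -[leRHS]mulr1.
    rewrite ler_wpM2l ?normc_ge0// pconv_step// -int_poisson//=.
    rewrite expr0n addr0 sqrtr_sqr ger0_norm ?int_poisson_le1//.
    by apply: Rintegral_ge0 => y _; exact: poisson_ge0.
rewrite /inner -/K -/L; apply: complexP.
- apply: (cvg_unique (@Rhausdorff R) c1).
  by apply: cvgn_eq d1 => n; rewrite AB.
- apply: (cvg_unique (@Rhausdorff R) c2).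
  by apply: cvgn_eq d2 => n; rewrite AB.
Qed.

End FourierBound.

(** * The Haar basis *)

Section Haar.
Context {R : realType}.
Implicit Types (f g h : R -> R[i]) (a b c d : R) (i j m : nat) (k l : int).

Lemma cintegral0 : cintegral (fun=> 0 : R[i]) = 0.
Proof. by apply: complexP; rewrite /= Rintegral_cst//= mul0r. Qed.

Lemma stepE a b x : step a b x = (((a <= x) && (x < b))%:R)%:C.
Proof.
rewrite /step indicE.
have -> : (x \in `[a, b[%classic) = (a <= x < b); last by [].
by apply/idP/idP; rewrite inE /= in_itv.
Qed.

Lemma step_split a b c x : a <= b -> b <= c -> step a c x = step a b x + step b c x.
Proof.
move=> ab bc; rewrite !stepE -rmorphD /=; congr (_%:C).
have [xb|bx] := ltP x b.
  by rewrite (lt_le_trans xb bc) addr0.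
by rewrite (le_trans ab bx) andbF add0r.
Qed.

Lemma inner_step_disj a b c d : b <= c \/ d <= a -> inner (step a b) (step c d) = 0.
Proof.
move=> H; rewrite /inner -cintegral0; apply: eq_cintegral => x; rewrite !stepE.
have [/andP[ax xb]|_] := boolP ((a <= x) && (x < b)); last by rewrite mul0r.
rewrite (_ : (c <= x) && (x < d) = false) ?rmorph0 ?mulr0//.
case: H => [bc|da].
- by rewrite leNgt (lt_le_trans xb bc).
- by rewrite (ltNge x) (le_trans da ax) andbF.
Qed.

Lemma nsq_step a b : a <= b -> nsq (step a b) = b - a.
Proof.
move=> ab; rewrite /nsq; under eq_Rintegral do rewrite step_sqn.
rewrite /Rintegral integral_indic// setIT.
suff E : lebesgue_measure `[a, b[%classic = (b - a)%:E by apply: (congr1 fine E).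
rewrite [LHS]lebesgue_measure_itv /= lte_fin; case: ltP => // ba.
by have -> : b = a; [apply: le_anti; rewrite ab ba|rewrite subrr].
Qed.

Definition dy j k : R -> R[i] := step (k%:~R / 2 ^+ j) ((k + 1)%:~R / 2 ^+ j).

Lemma dy_L2 j k : L2 (dy j k). Proof. exact: step_L2. Qed.

Lemma pow2_gt0 j : 0 < 2 ^+ j :> R. Proof. by rewrite exprn_gt0. Qed.

Lemma dy_le j k l : k <= l -> k%:~R / 2 ^+ j <= l%:~R / 2 ^+ j :> R.
Proof. by move=> kl; rewrite ler_pM2r ?invr_gt0 ?pow2_gt0// ler_int. Qed.

Lemma dy_split j k x : dy j k x = dy j.+1 (2 * k) x + dy j.+1 (2 * k + 1) x.
Proof.
rewrite /dy.
have -> : k%:~R / 2 ^+ j = (2 * k)%:~R / 2 ^+ j.+1 :> R.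
  by rewrite intrM exprS; field; rewrite gt_eqF// pow2_gt0.
have -> : (k + 1)%:~R / 2 ^+ j = (2 * k + 1 + 1)%:~R / 2 ^+ j.+1 :> R.
  by rewrite !(intrD, intrM) exprS; field; rewrite gt_eqF// pow2_gt0.
by apply: step_split; apply: dy_le; rewrite lerDl.
Qed.

Lemma dy_splitE j k : dy j k = fun x => dy j.+1 (2 * k) x + dy j.+1 (2 * k + 1) x.
Proof. by apply/funext => x; exact: dy_split. Qed.

Lemma inner_dy j k l : inner (dy j k) (dy j l) = (((k == l)%:R * 2^-1 ^+ j)%R)%:C.
Proof.
have [->|kl] := eqVneq k l.
  rewrite mul1r inner_self; last exact: dy_L2.
  rewrite /dy nsq_step; last by apply: dy_le; rewrite lerDl.
  by congr (_%:C); rewrite intrD exprVn; field; rewrite gt_eqF// pow2_gt0.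
rewrite mul0r; apply: inner_step_disj.
by move: kl; rewrite neq_lt => /orP[kl|kl]; [left|right]; apply: dy_le; rewrite lezD1.
Qed.

(** The Haar wavelet of level [j], not normalised: its squared norm is 2^-j. *)
Definition dydiff j k : R -> R[i] := fun x => dy j.+1 (2 * k) x - dy j.+1 (2 * k + 1) x.

Lemma dydiff_L2 j k : L2 (dydiff j k). Proof. by apply: L2B; exact: dy_L2. Qed.

Lemma two_mul_inj k l : (2 * k == 2 * l) = (k == l).
Proof. by apply/eqP/eqP => [|->//]; lia. Qed.

(** A wavelet has mean zero, and a dyadic step of the same or a coarser level is constant on its
    support. The induction halves the step until the levels agree. *)
Lemma inner_dy_dydiff i m k l : inner (dy i l) (dydiff (i + m) k) = 0.
Proof.
elim: m i l => [|m IH] i l.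
  rewrite addn0; rewrite [dy i l]dy_splitE.
  rewrite innerD ?innerBr ?inner_dy; try exact: dy_L2; try exact: dydiff_L2.
  rewrite !two_mul_inj (_ : (2 * l == 2 * k + 1) = false); last by apply/eqP; lia.
  rewrite (_ : (2 * l + 1 == 2 * k) = false); last by apply/eqP; lia.
  rewrite (_ : (2 * l + 1 == 2 * k + 1) = (l == k)); last first.
    by apply/eqP/eqP => [|->//]; lia.
  by apply: complexP; rewrite !cE /=; ring.
rewrite [dy i l]dy_splitE.
rewrite innerD; try exact: dy_L2; try exact: dydiff_L2.
by rewrite -addSnnS !IH addr0.
Qed.

Lemma inner_dydiff_lt i j k l : (i < j)%N -> inner (dydiff i l) (dydiff j k) = 0.
Proof.
move=> ij; rewrite innerB; try exact: dy_L2; try exact: dydiff_L2.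
by rewrite -(subnKC ij) !inner_dy_dydiff subrr.
Qed.

Lemma inner_dydiff j k l : inner (dydiff j k) (dydiff j l) = (((k == l)%:R * 2^-1 ^+ j)%R)%:C.
Proof.
rewrite innerB ?innerBr ?inner_dy; try exact: dy_L2; try exact: dydiff_L2.
rewrite !two_mul_inj (_ : (2 * k == 2 * l + 1) = false); last by apply/eqP; lia.
rewrite (_ : (2 * k + 1 == 2 * l) = false); last by apply/eqP; lia.
rewrite (_ : (2 * k + 1 == 2 * l + 1) = (k == l)); last first.
  by apply/eqP/eqP => [|->//]; lia.
by apply: complexP; rewrite !cE /= ?exprS; field.
Qed.

(** Level 0 consists of the unit steps, which carry the integer-scale averages; level [j.+1]
    consists of the normalised wavelets of scale [j]. *)
Definition haar (t : nat * int) : R -> R[i] :=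
  if t.1 is j.+1 then fun x => (Num.sqrt (2 ^+ j))%:C * dydiff j t.2 x
  else dy 0 t.2.

Lemma haar_L2 t : L2 (haar t).
Proof. by case: t => -[|j] k; [exact: dy_L2|apply: L2Z; exact: dydiff_L2]. Qed.

Lemma inner_haar (t u : nat * int) : inner (haar t) (haar u) = (t == u)%:R.
Proof.
have FM k j l : inner (haar (0%N, k)) (haar (j.+1, l)) = 0.
  by rewrite /haar /= innerZr ?(inner_dy_dydiff 0)// ?mulr0//; [exact: dydiff_L2|exact: dy_L2].
have MM i j k l : (i < j)%N -> inner (haar (i.+1, k)) (haar (j.+1, l)) = 0.
  move=> ij; rewrite /haar /= innerZ ?innerZr ?inner_dydiff_lt ?mulr0//;
    try exact: dydiff_L2; exact: L2Z (dydiff_L2 _ _).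
case: t u => -[|i] k [[|j] l].
- by rewrite /haar /= inner_dy expr0 mulr1 xpair_eqE eqxx; case: (k == l).
- by rewrite FM.
- by rewrite (inner_conj (haar_L2 _) (haar_L2 _)) FM (rmorph0 Num.conj).
- have [ij|ij|->] := ltngtP i j.
  + by rewrite MM// xpair_eqE eqSS ltn_eqF.
  + by rewrite (inner_conj (haar_L2 _) (haar_L2 _)) MM// (rmorph0 Num.conj) xpair_eqE eqSS gtn_eqF.
  + rewrite /haar /= innerZ ?innerZr ?inner_dydiff//; try exact: dydiff_L2; try exact: L2Z (dydiff_L2 _ _).
    rewrite xpair_eqE eqxx /=; case: (k == l); last first.
      by apply: complexP; rewrite !cE /=; ring.
    have E : Num.sqrt (2 ^+ j) * Num.sqrt (2 ^+ j) = 2 ^+ j :> R.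
      by rewrite -expr2 sqr_sqrtr// ltW ?pow2_gt0.
    apply: complexP; rewrite !cE /=; last by ring.
    rewrite mul1r !mul0r !mulr0 !subr0 mulrA E exprVn divff// gt_eqF// pow2_gt0.
Qed.

(** For the two halves of a dyadic interval, the difference of the coefficients vanishes by the
    wavelet and their sum by the coarser level; hence both vanish. *)
Lemma haar_dy f : L2 f -> (forall t, inner f (haar t) = 0) ->
  forall j k, inner f (dy j k) = 0.
Proof.
move=> Lf H; elim => [|j IH] k; first exact: (H (0%N, k)).
have d0 q : inner f (dy j.+1 (2 * q)) - inner f (dy j.+1 (2 * q + 1)) = 0.
  have := H (j.+1, q); rewrite /haar /= innerZr//; last exact: dydiff_L2.
  rewrite innerBr//; try exact: dy_L2.
  move=> /eqP; rewrite mulf_eq0 => /orP[|/eqP//].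
  rewrite -[_^*%R]conjCC /= => /eqP/(congr1 (@complex.Re R)); rewrite !cE /= => /eqP.
  by rewrite sqrtr_eq0 leNgt pow2_gt0.
have s0 q : inner f (dy j.+1 (2 * q)) + inner f (dy j.+1 (2 * q + 1)) = 0.
  rewrite -innerDr//; try exact: dy_L2.
  by have := IH q; rewrite [dy j q]dy_splitE.
have e0 q : inner f (dy j.+1 (2 * q)) = 0 /\ inner f (dy j.+1 (2 * q + 1)) = 0.
  have E : inner f (dy j.+1 (2 * q)) = inner f (dy j.+1 (2 * q + 1)).
    by apply/eqP; rewrite -subr_eq0 d0.
  by have := s0 q; rewrite E -mulr2n => /eqP; rewrite mulrn_eq0 /= => /eqP.
have kq := divz_eq k 2.
have r2 : (k %% 2)%Z = 0 \/ (k %% 2)%Z = 1.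
  have := modz_ge0 k (isT : 2%:Z != 0); have := ltz_pmod k (isT : 0 < 2%:Z).
  by case: (k %% 2)%Z => [[|[|n]]|n]//; [left|right].
rewrite kq mulrC; case: r2 => ->; rewrite ?addr0; [exact: (e0 _).1|exact: (e0 _).2].
Qed.

Lemma inner_step_integral f a b : L2 f ->
  inner f (step a b) = (\int[mu]_(x in `[a, b[) Re (f x)) +i*
    (\int[mu]_(x in `[a, b[) Im (f x)).
Proof.
move=> Lf; apply: complexP; rewrite /inner /cintegral /= [RHS]Rintegral_mkcond;
  apply: eq_Rintegral => x _; rewrite patchE !cE /step /= indicE;
  by case: (x \in _); rewrite /= ?oppr0 ?mulr1 ?mulr0 ?subr0 ?add0r ?addr0.
Qed.

(** The dyadic interval of level [n] that contains [x]. *)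
Definition dyset (x : R) (n : nat) : set R :=
  `[(Num.floor (x * 2 ^+ n))%:~R / 2 ^+ n, (Num.floor (x * 2 ^+ n) + 1)%:~R / 2 ^+ n[%classic.

Lemma dyset_mu x n : mu (dyset x n) = (2^-1 ^+ n)%:E.
Proof.
rewrite [LHS]lebesgue_measure_itv /= lte_fin ltr_pM2r ?invr_gt0 ?pow2_gt0// ltr_int ltrDl ltr01.
by rewrite -EFinB; congr (_%:E); rewrite intrD exprVn; field; rewrite gt_eqF// pow2_gt0.
Qed.

Lemma dyset_shrinking x : nicely_shrinking x (dyset x).
Proof.
split; first by move=> n; exact: measurable_itv.
have p n : 0 < 2^-1 ^+ n :> R by rewrite exprn_gt0// invr_gt0.
(* The dyadic interval of length 2^-n lies in the ball of radius 2^-n about [x], and that ball has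
   twice its measure. *)
exists (2, fun n => PosNum (p n)); split => //=.
- by apply: cvg_expr; rewrite ger0_norm ?invf_lt1 ?ltr1n.
- move=> n y; rewrite /dyset /= in_itv /= => /andP[]; rewrite ball_itv /= in_itv /=.
  have /andP[] := floor_itv (x * 2 ^+ n).
  rewrite -ler_pdivrMr ?pow2_gt0// -ltr_pdivlMr ?pow2_gt0//.
  rewrite intrD mulrDl mul1r exprVn; lra.
- move=> n; rewrite dyset_mu.
  have -> : mu (ball x (2^-1 ^+ n)) = (2^-1 ^+ n *+ 2)%:E.
    by apply: lebesgue_measure_ball; rewrite ltW.
  by rewrite -EFinM mulr_natl.
Qed.

Lemma L2_locally_integrable (p : R -> R) : measurable_fun setT p ->
  intR (fun x => p x ^+ 2) -> locally_integrable setT p.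
Proof.
move=> mp ip; split=> //; first exact: openT.
move=> K _ cK; have mK : measurable K by apply: closed_measurable; exact: compact_closed.
apply: (@le_lt_trans _ _ (\int[mu]_(x in K) (1 + p x ^+ 2)%:E)%E).
  apply: ge0_le_integral => //=.
  - by apply: measurable_funTS; apply: measurable_funE; exact: measurableT_comp.
  - apply: measurable_funTS; apply: measurable_funE; apply: measurable_funD => //.
    exact: measurable_funX.
  - move=> x _; rewrite lee_fin; have := sqr_ge0 (`|p x| - 1).
    have <- : `|p x| ^+ 2 = p x ^+ 2 by rewrite real_normK ?num_real.
    move: `|p x| => w; have := sqr_ge0 w; nra.
under eq_integral do rewrite EFinD.
rewrite ge0_integralD//=; last 2 first.
- by move=> x _; rewrite lee_fin sqr_ge0.
- by apply: measurable_funTS; apply: measurable_funE; exact: measurable_funX.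
rewrite lte_add_pinfty//.
- rewrite integral_cst//= mul1e; exact: compact_finite_measure.
- have /integrableP[mi] := ip; apply: le_lt_trans.
  under [leRHS]eq_integral do rewrite /= ger0_norm ?sqr_ge0//.
  apply: (@ge0_subset_integral _ _ _ mu K setT) => //.
  by move=> x _; rewrite lee_fin sqr_ge0.
Qed.

(** By Lebesgue differentiation along shrinking dyadic intervals, almost every value is a limit of
    dyadic averages, all of which vanish. *)
Lemma dyadic_zero_ae (p : R -> R) : measurable_fun setT p ->
  intR (fun x => p x ^+ 2) ->
  (forall j k, \int[mu]_(x in `[k%:~R / 2 ^+ j, (k + 1)%:~R / 2 ^+ j[) p x = 0) ->
  \forall x \ae mu, p x = 0.
Proof.
move=> mp ip p0; have lp := L2_locally_integrable mp ip.
apply: aeS (lebesgue_differentiation lp) => x lx.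
have H := nice_lebesgue_differentiation dyset_shrinking lp lx.
have Z n : ((mu (dyset x n))^-1 * \int[mu]_(y in dyset x n) (p y)%:E = 0)%E.
  have : fine (\int[mu]_(y in dyset x n) (p y)%:E) = 0 by exact: p0.
  (* The hypothesis says that [fine] of the integral is 0, which is also the value of [fine] at
     infinity; integrability over the closed interval excludes the infinite case. *)
  have I : mu.-integrable (dyset x n) (EFin \o p).
    apply/integrableP; split; first by apply: measurable_funTS; exact: measurable_funE.
    have [_ _ /(_ `[(Num.floor (x * 2 ^+ n))%:~R / 2 ^+ n, (Num.floor (x * 2 ^+ n) + 1)%:~R / 2 ^+ n]%classic)] := lp.
    move=> /(_ (@subsetT _ _) (@segment_compact R _ _)); apply: le_lt_trans.
    apply: (@ge0_subset_integral _ _ _ mu) => //.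
    - exact: measurable_itv.
    - apply: measurable_funTS; apply: measurable_funE; exact: measurableT_comp.
    - by move=> y; rewrite /dyset /= !in_itv /= => /andP[-> /ltW ->].
  move=> F; rewrite -[X in (_ * X)%E]fineK; last first.
    by apply: integrable_fin_num I; exact: measurable_itv.
  by rewrite F mule0.
have : (fun _ : nat => 0%E : \bar R) n @[n --> \oo] --> (p x)%:E.
  by move: H; under eq_fun do rewrite Z.
move=> C; have := cvg_unique (@ereal_hausdorff R) C (cvg_cst _).
by move=> /(_ _ _)[].
Qed.

Lemma haar_total f : L2 f -> (forall t, inner f (haar t) = 0) -> nsq f = 0.
Proof.
move=> Lf H; have D := haar_dy Lf H; have [m1 m2] := L2_cmf Lf.
have i1 : intR (fun x => Re (f x) ^+ 2).
  apply: (intR_le _ _ (L2_sqn Lf)); first exact: measurable_funX.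
  by move=> x; rewrite ger0_norm ?sqr_ge0// Re_sqr_le.
have i2 : intR (fun x => Im (f x) ^+ 2).
  apply: (intR_le _ _ (L2_sqn Lf)); first exact: measurable_funX.
  by move=> x; rewrite ger0_norm ?sqr_ge0// Im_sqr_le.
have z1 := dyadic_zero_ae m1 i1; have z2 := dyadic_zero_ae m2 i2.
rewrite (@aeq_nsq _ _ (fun=> 0)).
- exact: nsq0.
- exact: L2_cmf.
- exact: cmf_cst.
- apply: aeS2 (z1 _) (z2 _).
  + by move=> x re im _; apply: complexP; rewrite ?re ?im.
  + move=> j k; have := D j k; rewrite inner_step_integral// => /(congr1 (@complex.Re R)) /=.
    by [].
  + move=> j k; have := D j k; rewrite inner_step_integral// => /(congr1 (@complex.Im R)) /=.
    by [].
Qed.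

Lemma haar_enum : exists g : nat -> nat * int, injective g /\ forall t, exists n, g n = t.
Proof.
have C : ([set: nat * int] #= [set: nat])%card.
  rewrite card_eq_le; apply/andP; split; first exact: countableP.
  apply/infiniteP => fin; have := @infinite_nat; apply.
  have : finite_set ((fun t : nat * int => t.1) @` [set: nat * int]) by exact: finite_image.
  by apply: sub_finite_set => n _; exists (n, 0).
have /card_set_bijP[f [_ fi fs]] := C.
have /choice[g Hg] : forall n : nat, exists t : nat * int, f t = n.
  by move=> n; have [t _ <-] := fs n I; exists t.
exists g; split.
- by move=> m n E; rewrite -(Hg m) -(Hg n) E.
- by move=> t; exists (f t); apply: fi; rewrite ?inE// Hg.
Qed.

Theorem exists_haar_basis : exists e : nat -> R -> R[i],
  orthonormal_basis e /\ forall n, exists t, e n = haar t.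
Proof.
have [g [gi gs]] := haar_enum; exists (fun n => haar (g n)); split; last first.
  by move=> n; exists (g n).
apply: total_orthonormal_basis.
- split=> [n|m n]; first exact: haar_L2.
  by rewrite inner_haar (inj_eq gi).
- move=> f Lf H; apply: haar_total => // t.
  by have [n <-] := gs t.
Qed.

End Haar.

(** * Plancherel and inversion *)

Section Plancherel.
Context {R : realType}.
Implicit Types (f g h k u v : R -> R[i]) (a b c x : R) (n : nat).

Definition L2b h := L2 h /\ bsupp h.

Lemma L2bD f g : L2b f -> L2b g -> L2b (fun x => f x + g x).
Proof.
move=> [Lf [m Hm]] [Lg [n Hn]]; split; first exact: L2D.
exists (maxn m n) => x Hx; rewrite Hm ?Hn ?addr0//; apply: le_lt_trans Hx;
  by rewrite ler_nat ?leq_maxl ?leq_maxr.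
Qed.

Lemma L2bZ (a : R[i]) f : L2b f -> L2b (fun x => a * f x).
Proof.
by move=> [Lf [m Hm]]; split; [exact: L2Z|exists m => x Hx; rewrite Hm ?mulr0].
Qed.

Lemma L2bN f : L2b f -> L2b (fun x => - f x).
Proof.
by move=> [Lf [m Hm]]; split; [exact: L2N|exists m => x Hx; rewrite Hm ?oppr0].
Qed.

Lemma L2bB f g : L2b f -> L2b g -> L2b (fun x => f x - g x).
Proof. by move=> Lf Lg; apply: L2bD => //; exact: L2bN. Qed.

Lemma L2b_conj f : L2b f -> L2b (fun x => (f x)^*%R).
Proof.
move=> [Lf [m Hm]]; split; [exact: L2_conj|exists m => x Hx].
by rewrite Hm ?(rmorph0 Num.conj).
Qed.

Lemma L2b_cint f : L2b f -> cint f.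
Proof. by move=> [Lf bf]; exact: L2_bsupp_cint. Qed.

Lemma L2b_fourierL1 f : L2b f -> L2 (fourierL1 f).
Proof. by move=> [Lf bf]; have [] := fourierL1_L2 Lf bf. Qed.

(** Fixing one argument and quantifying over the other makes the property stable under linear
    combinations, which brings it from steps to Haar partial sums. *)
Definition parseval_at k := L2b k /\
  forall h, L2b h -> inner (fourierL1 h) (fourierL1 k) = inner h k.

Lemma parseval_at_step a b : a <= b -> parseval_at (step a b).
Proof.
move=> ab; split; first by split; [exact: step_L2|exact: step_bsupp].
by move=> h [Lh bh]; exact: step_duality.
Qed.

Lemma parseval_atD f g : parseval_at f -> parseval_at g -> parseval_at (fun x => f x + g x).
Proof.
move=> [bf Hf] [bg Hg]; split; first exact: L2bD.
move=> h bh; have [Lf Lg Lh] := And3 bf.1 bg.1 bh.1.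
have [Ff Fg Fh] := And3 (L2b_fourierL1 bf) (L2b_fourierL1 bg) (L2b_fourierL1 bh).
by rewrite (fourierL1D (L2b_cint bf) (L2b_cint bg)) (innerDr Ff Fg Fh) (innerDr Lf Lg Lh) Hf ?Hg.
Qed.

Lemma parseval_atZ (a : R[i]) f : parseval_at f -> parseval_at (fun x => a * f x).
Proof.
move=> [bf Hf]; split; first exact: L2bZ.
move=> h bh; have [Lf Lh] := conj bf.1 bh.1.
by rewrite fourierL1Z ?innerZr ?Hf//; try exact: L2b_cint; exact: L2b_fourierL1.
Qed.

Lemma parseval_at_haar t : parseval_at (haar t).
Proof.
have D j (k : int) : parseval_at (dy j k) by apply: parseval_at_step; apply: dy_le; rewrite lerDl.
case: t => -[|j] k; first exact: D.
rewrite /haar /=; apply: parseval_atZ; rewrite /dydiff.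
have -> : (fun x => dy j.+1 (2 * k) x - dy j.+1 (2 * k + 1) x) =
    (fun x => dy j.+1 (2 * k) x + (-1) * dy j.+1 (2 * k + 1) x) :> (R -> R[i]).
  by apply/funext => x; rewrite mulN1r.
by apply: parseval_atD => //; exact: parseval_atZ.
Qed.

Lemma parseval_at_psum e f n : (forall n, parseval_at (e n)) -> parseval_at (psum e f n).
Proof.
move=> De; elim: n => [|n IH].
  have -> : psum e f 0 = (fun x => 0 * e 0%N x).
    by apply/funext => x; rewrite /psum big_ord0 mul0r.
  exact: parseval_atZ.
by rewrite psumS; apply: parseval_atD => //; exact: parseval_atZ.
Qed.

(** The Haar partial sums of [h] are step functions, on which the transform preserves the norm. They
    converge to [h], and by the contraction of [fourierL1_L2] their transforms converge to that of
    [h]. *)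
Theorem plancherel_bsupp h : L2b h -> nsq (fourierL1 h) = nsq h.
Proof.
move=> bh; have [e [B He]] := @exists_haar_basis R.
have De n : parseval_at (e n) by have [t ->] := He n; exact: parseval_at_haar.
have Du n : parseval_at (psum e h n) by exact: parseval_at_psum.
have Lh := bh.1; have Lu n : L2 (psum e h n) by case: (Du n) => -[].
have LF := L2b_fourierL1 bh.
have LFu n : L2 (fourierL1 (psum e h n)) by apply: L2b_fourierL1; case: (Du n).
have cu : nsq (fun x => psum e h n x - h x) @[n --> \oo] --> 0.
  by apply/(cvgL2P Lu Lh); case: B => _ _; apply.
have cF : nsq (fun x => fourierL1 (psum e h n) x - fourierL1 h x) @[n --> \oo] --> 0.
  apply: cvgn_squeeze0 cu => n; rewrite ger0_norm ?nsq_ge0//.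
  have bu : L2b (psum e h n) by case: (Du n).
  rewrite -(fourierL1B (L2b_cint bu) (L2b_cint bh)).
  by have [L b] := L2bB bu bh; case: (fourierL1_L2 L b).
apply: cvg_unique (nsq_cvg LFu LF cF) _ => //; apply: cvgn_eq (nsq_cvg Lu Lh cu) => n.
have [bu /(_ _ bu)] := Du n; rewrite (inner_self (LFu n)) (inner_self (Lu n)).
by move=> /(congr1 (@complex.Re R)) /= ->.
Qed.

Lemma nsq_fourierL1B f g : L2b f -> L2b g ->
  nsq (fun x => fourierL1 f x - fourierL1 g x) = nsq (fun x => f x - g x).
Proof.
move=> bf bg; rewrite -(fourierL1B (L2b_cint bf) (L2b_cint bg)).
by rewrite plancherel_bsupp//; exact: L2bB.
Qed.

Definition trunc n f : R -> R[i] := restr `[- n%:R, n%:R]%classic f.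

Lemma truncE n f x : trunc n f x = if `|x| <= n%:R then f x else 0.
Proof.
rewrite /trunc restrE.
have -> // : (x \in `[- n%:R, n%:R]%classic) = (`|x| <= n%:R).
by rewrite ler_norml; apply/idP/idP; rewrite inE /= in_itv.
Qed.

Lemma trunc_L2b n f : L2 f -> L2b (trunc n f).
Proof.
move=> Lf; split; first by apply: restr_L2 => //; exact: measurable_itv.
by exists n => x nx; rewrite truncE leNgt nx.
Qed.

Lemma trunc_cvg f : L2 f -> nsq (fun x => trunc n f x - f x) @[n --> \oo] --> 0.
Proof.
move=> Lf; have <- : \int[mu]_x (0 : R) = 0 by rewrite Rintegral_cst//= mul0r.
have LB n : L2 (fun x => trunc n f x - f x) by apply: L2B => //; case: (trunc_L2b n Lf).
apply: (Rintegral_dominated (q := fun x => sqn (f x))) => //.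
- by move=> n; apply: cmf_sqn; exact: L2_cmf.
- apply: aeW => x; have [N HN] : exists N : nat, `|x| <= N%:R.
    exists (Num.bound `|x|); apply: ltW; apply: archi_boundP; exact: normr_ge0.
  apply: (cvgn_eventually (N := N) (u := fun=> 0)); last exact: cvgn_cst.
  by move=> n Nn; rewrite truncE (le_trans HN) ?ler_nat// subrr sqn0.
- exact: L2_sqn.
- move=> n x; rewrite ger0_norm ?sqn_ge0// truncE; case: ifP => _.
    by rewrite subrr sqn0 sqn_ge0.
  by rewrite sub0r sqnN.
Qed.

Lemma is_fourierP f g : L2 f -> is_fourier f g <->
  L2 g /\ nsq (fun x => fourierL1 (trunc n f) x - g x) @[n --> \oo] --> 0.
Proof.
move=> Lf; have LF n : L2 (fourierL1 (trunc n f)).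
  by apply: L2b_fourierL1; exact: trunc_L2b.
by rewrite /is_fourier; split => -[Lg] /(cvgL2P LF Lg).
Qed.

Lemma plancherel f g : L2 f -> is_fourier f g -> nsq g = nsq f.
Proof.
move=> Lf /(is_fourierP g Lf)[Lg cg]; have Lt n := trunc_L2b n Lf.
have c1 := nsq_cvg (fun n => L2b_fourierL1 (Lt n)) Lg cg.
have c2 := nsq_cvg (fun n => (Lt n).1) Lf (trunc_cvg Lf).
apply: cvg_unique c1 _ => //; apply: cvgn_eq c2 => n.
by rewrite plancherel_bsupp.
Qed.

Lemma is_fourier_exists f : L2 f -> exists g, is_fourier f g.
Proof.
move=> Lf; have Lt n := trunc_L2b n Lf.
have LF n := L2b_fourierL1 (Lt n).
have [//|g [Lg cg]] := riesz_fischer LF; last first.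
  by exists g; apply/(is_fourierP g Lf).
(* A quarter, because [nsq_sub_le] doubles each of the two distances to [f]. *)
move=> e e0; have e4 : 0 < e / 4 by rewrite divr_gt0.
have /cvgrPdist_le/(_ _ e4)[N _ HN] := trunc_cvg Lf.
exists N => m n Nm Nn.
rewrite (nsq_fourierL1B (Lt m) (Lt n)).
apply: le_trans (nsq_sub_le (Lt m).1 Lf (Lt n).1) _.
rewrite (nsqC f).
have := HN m Nm; have := HN n Nn.
rewrite !sub0r !normrN !ger0_norm ?nsq_ge0//; lra.
Qed.

Lemma is_fourier_uniq f g g' : L2 f -> is_fourier f g -> is_fourier f g' ->
  g = g' %[ae mu].
Proof.
move=> Lf /(is_fourierP g Lf)[Lg cg] /(is_fourierP g' Lf)[Lg' cg'].
have LF n := L2b_fourierL1 (trunc_L2b n Lf).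
have E : nsq (fun x => g x - g' x) = 0.
  apply: cvg_unique (cvgn_cst (nsq (fun x => g x - g' x))) _ => //.
  apply: (@cvgn_squeeze0 _ _ (fun n => 2 * nsq (fun x => fourierL1 (trunc n f) x - g x) +
     2 * nsq (fun x => fourierL1 (trunc n f) x - g' x))).
    move=> n; rewrite ger0_norm ?nsq_ge0// -(nsqC g).
    exact: nsq_sub_le.
  by have := cvgnD (cvgnZ 2 cg) (cvgnZ 2 cg'); rewrite !mulr0 addr0.
by apply: aeS (nsq_eq0 (L2B Lg Lg') E) => x /(_ I)/eqP; rewrite subr_eq0 => /eqP.
Qed.

Lemma is_fourierB f f' g g' : L2 f -> L2 f' -> is_fourier f g -> is_fourier f' g' ->
  is_fourier (fun x => f x - f' x) (fun x => g x - g' x).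
Proof.
move=> Lf Lf' /(is_fourierP g Lf)[Lg cg] /(is_fourierP g' Lf')[Lg' cg'].
apply/(is_fourierP _ (L2B Lf Lf')); split; first exact: L2B.
have Lt n := trunc_L2b n Lf; have Lt' n := trunc_L2b n Lf'.
have E n : trunc n (fun x => f x - f' x) = (fun x => trunc n f x - trunc n f' x).
  by apply/funext => x; rewrite !truncE; case: ifP => // _; rewrite subrr.
apply: (@cvgn_squeeze0 _ _ (fun n => 2 * nsq (fun x => fourierL1 (trunc n f) x - g x) +
     2 * nsq (fun x => fourierL1 (trunc n f') x - g' x))); last first.
  by have := cvgnD (cvgnZ 2 cg) (cvgnZ 2 cg'); rewrite !mulr0 addr0.
move=> n; rewrite ger0_norm ?nsq_ge0// E (fourierL1B (L2b_cint (Lt n)) (L2b_cint (Lt' n))).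
have -> : (fun x => fourierL1 (trunc n f) x - fourierL1 (trunc n f') x - (g x - g' x)) =
   (fun x => (fourierL1 (trunc n f) x - g x) + - (fourierL1 (trunc n f') x - g' x)).
  by apply/funext => x; ring.
have L1 := L2B (L2b_fourierL1 (Lt n)) Lg; have L2' := L2B (L2b_fourierL1 (Lt' n)) Lg'.
by rewrite (le_trans (nsqD_le L1 (L2N L2')))// nsqN.
Qed.

Lemma is_fourier_bsupp f : L2b f -> is_fourier f (fourierL1 f).
Proof.
move=> bf; have [Lf [N HN]] := bf; apply/(is_fourierP _ Lf).
split; first exact: L2b_fourierL1.
apply: (cvgn_eventually (N := N) (u := fun=> 0)); last exact: cvgn_cst.
move=> n Nn; have -> : trunc n f = f.
  apply/funext => x; rewrite truncE; case: leP => // xn; rewrite HN//.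
  by apply: le_lt_trans xn; rewrite ler_nat.
rewrite (_ : (fun x => _) = fun=> 0); last by apply/funext => x; rewrite subrr.
exact/esym/nsq0.
Qed.

Lemma is_fourier_fourier f : L2 f -> is_fourier f (fourier f).
Proof. by move=> Lf; rewrite /fourier; apply: xgetPex; exact: is_fourier_exists. Qed.

Lemma fourier_ae f g : L2 f -> is_fourier f g -> fourier f = g %[ae mu].
Proof. by move=> Lf; apply: is_fourier_uniq => //; exact: is_fourier_fourier. Qed.

(** The inverse Fourier integral written as a conjugate of the direct one, so that the bounds and
    isometry for [fourierL1] carry over. *)
Definition fourierL1_inv g : R -> R[i] :=
  fun x => (fourierL1 (fun y => (g y)^*%R) x)^*%R.

Lemma fourierL1_inv_L2 g : L2b g -> L2 (fourierL1_inv g).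
Proof. by move=> bg; apply: L2_conj; apply: L2b_fourierL1; exact: L2b_conj. Qed.

Lemma nsq_conj f : nsq (fun x => (f x)^*%R) = nsq f.
Proof. by rewrite /nsq; apply: eq_Rintegral => x _; rewrite sqn_conj. Qed.

Lemma inner_fourierL1 f g : cint f -> cint g ->
  inner (fourierL1 f) g = inner f (fourierL1_inv g).
Proof.
move=> If Ig; have := multiplication_formula (cint_conj Ig) If.
rewrite /inner => E.
rewrite -[LHS](@eq_cintegral _ (fun s => (g s)^*%R * fourierL1 f s)); last first.
  by move=> s; rewrite mulrC.
by rewrite E; apply: eq_cintegral => x; rewrite /fourierL1_inv conjCC mulrC.
Qed.

(** The inverse integral [u] of [g] need not have bounded support, so its transform [v] is known
    only as an L^2 limit. Plancherel gives v and g the same norm, and the adjoint relation on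
    truncations gives Re <v, g> = |u|^2 = |g|^2; hence |v - g|^2 = 0. *)
Theorem is_fourier_inv g : L2b g -> is_fourier (fourierL1_inv g) g.
Proof.
move=> bg; have Lu := fourierL1_inv_L2 bg; have Lg := bg.1.
have nu : nsq (fourierL1_inv g) = nsq g.
  by rewrite /fourierL1_inv nsq_conj plancherel_bsupp ?nsq_conj//; exact: L2b_conj.
have [v Hv] := is_fourier_exists Lu; have nv := plancherel Lu Hv.
have [Lv cv] := (is_fourierP v Lu).1 Hv.
have Lt n := trunc_L2b n Lu; have LF n := L2b_fourierL1 (Lt n).
have c1 := inner_cvg LF Lv Lg cv.
have c2 := inner_cvg (fun n => (Lt n).1) Lu Lu (trunc_cvg Lu).
have ip : Re (inner v g) = nsq g.
  rewrite -nu -[RHS]/(Re (nsq (fourierL1_inv g))%:C) -inner_self//.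
  apply: cvg_unique c1 _ => //; apply: cvgn_eq c2 => n.
  by rewrite inner_fourierL1//; exact: L2b_cint.
have E : nsq (fun x => v x - g x) = 0 by rewrite nsqB// ip nv nu; ring.
have vg : v = g %[ae mu].
  by apply: aeS (nsq_eq0 (L2B Lv Lg) E) => x /(_ I)/eqP; rewrite subr_eq0 => /eqP.
apply/(is_fourierP _ Lu); split=> //; apply: cvgn_eq cv => n.
apply: aeq_nsq; try by apply: L2_cmf; exact: L2B.
by apply: aeS vg => x /(_ I) -> _.
Qed.

(** [fourier_inv] picks some L^2 preimage of [g']; Plancherel applied to its difference with the
    explicit preimage identifies the two almost everywhere. The target is [g'] rather than [g]
    because [fourier] itself returns an arbitrary representative. *)
Theorem fourier_inv_ae g g' : L2b g -> g' = g %[ae mu] ->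
  L2 (fourier_inv g') /\ fourier_inv g' = fourierL1_inv g %[ae mu].
Proof.
move=> bg gg'; have Lu := fourierL1_inv_L2 bg.
have uE := fourier_ae Lu (is_fourier_inv bg).
have uE' : fourier (fourierL1_inv g) = g' %[ae mu].
  by apply: aeS2 uE gg' => x /(_ I) -> /(_ I) ->.
have [L0 E0] : L2 (fourier_inv g') /\ fourier (fourier_inv g') = g' %[ae mu].
  rewrite /fourier_inv; apply: (@xgetPex _ (fun=> 0) [set f | L2 f /\ fourier f = g' %[ae mu]]).
  by exists (fourierL1_inv g).
split=> //; set f0 := fourier_inv g' in L0 E0 *.
have H := is_fourierB L0 Lu (is_fourier_fourier L0) (is_fourier_fourier Lu).
have [L1 [L2' _]] : L2 (fourier f0) /\ is_fourier (fourierL1_inv g) (fourier (fourierL1_inv g)).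
  by split; [case: (is_fourier_fourier L0)|exact: is_fourier_fourier].
have E : nsq (fun x => f0 x - fourierL1_inv g x) = 0.
  rewrite -(plancherel (L2B L0 Lu) H).
  rewrite (@aeq_nsq _ _ (fun=> 0)).
  - exact: nsq0.
  - by apply: L2_cmf; exact: L2B.
  - exact: cmf_cst.
  - by apply: aeS2 E0 uE' => x /(_ I) -> /(_ I) -> _; exact: subrr.
by apply: aeS (nsq_eq0 (L2B L0 Lu) E) => x /(_ I)/eqP; rewrite subr_eq0 => /eqP.
Qed.

End Plancherel.

(** * The trace of the square *)

Section Trace.
Context {R : realType}.
Implicit Types (f g h k u v : R -> R[i]) (x y t : R) (n : nat) (A B : set R)
  (e : nat -> R -> R[i]).

Definition bset A := measurable A /\ exists n : nat, forall x, A x -> `|x| <= n%:R.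

Lemma restr_L2b A f : bset A -> L2 f -> L2b (restr A f).
Proof.
move=> [mA [n Hn]] Lf; split; first exact: restr_L2.
exists n => x nx; rewrite restrE; case: ifPn => //; rewrite inE => /Hn.
by rewrite leNgt nx.
Qed.

Lemma restr_ae A f g : f = g %[ae mu] -> restr A f = restr A g %[ae mu].
Proof. by apply: aeS => x /(_ I) + _; rewrite !restrE => ->. Qed.

Lemma inner_restr A f g : inner (restr A f) g = inner f (restr A g).
Proof.
apply: eq_cintegral => x; rewrite !restrE; case: ifP => // _.
by rewrite mul0r (rmorph0 Num.conj) mulr0.
Qed.

Lemma restrK A f : restr A (restr A f) = restr A f.
Proof. by apply/funext => x; rewrite !restrE; case: (x \in A). Qed.

Lemma restr_expi_L2b A x : bset A -> L2b (restr A (fun s => expi (2 * pi * x * s))).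
Proof.
move=> [mA [n Hn]]; split; last first.
  exists n => s ns; rewrite restrE; case: ifPn => //; rewrite inE => /Hn.
  by rewrite leNgt ns.
have mp : cmf (restr A (fun s => expi (2 * pi * x * s))).
  by apply: restr_cmf => //; exact: cmf_expi.
apply: (@L2_le _ _ (step (- n%:R) (n.+1%:R))) => //; last exact: step_L2.
move=> s; rewrite step_sqn restrE indicE.
case: ifPn => [|_]; last by rewrite sqn0.
rewrite inE => /Hn; rewrite ler_norml => /andP[n1 n2]; rewrite sqn_expi mem_set//=.
by rewrite in_itv /= n1 (le_lt_trans n2)// ltr_nat.
Qed.

Variables (A B : set R) (bA : bset A) (bB : bset B).

Definition bandlimit f : R -> R[i] := restr B (fourierL1 (restr A f)).

(** An explicit representative of [opS A B f], with a definite value at each point. *)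
Definition concop f : R -> R[i] := restr A (fourierL1_inv (bandlimit f)).

Lemma bandlimit_L2b f : L2 f -> L2b (bandlimit f).
Proof. by move=> Lf; apply: restr_L2b => //; apply: L2b_fourierL1; exact: restr_L2b. Qed.

Lemma concop_L2 f : L2 f -> L2 (concop f).
Proof.
by move=> Lf; apply: restr_L2; [case: bA|apply: fourierL1_inv_L2; exact: bandlimit_L2b].
Qed.

Lemma opS_ae f : L2 f -> L2 (opS A B f) /\ opS A B f = concop f %[ae mu].
Proof.
move=> Lf; have bf := restr_L2b bA Lf.
have E : restr B (fourier (restr A f)) = bandlimit f %[ae mu].
  by apply: restr_ae; apply: fourier_ae bf.1 _; exact: is_fourier_bsupp.
have [L0 E0] := fourier_inv_ae (bandlimit_L2b Lf) E.
by split; [apply: restr_L2 => //; case: bA|exact: restr_ae].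
Qed.

(** The operator factors as T^* T with T = [bandlimit], which exhibits its self-adjointness. *)
Lemma inner_concop f g : L2 f -> L2 g ->
  inner (concop f) g = inner (bandlimit f) (bandlimit g).
Proof.
move=> Lf Lg; rewrite /concop inner_restr.
have bg := restr_L2b bA Lg; have bf := bandlimit_L2b Lf.
have LF := L2b_fourierL1 bg; have Lu := fourierL1_inv_L2 bf.
rewrite (inner_conj bg.1 Lu) -inner_fourierL1; [|exact: L2b_cint..].
rewrite -(inner_conj LF bf.1) /bandlimit -{1}restrK.
by rewrite inner_restr.
Qed.

Lemma inner_opS2 f : L2 f -> inner (opS A B (opS A B f)) f = (nsq (concop f))%:C.
Proof.
move=> Lf; have [L1 E1] := opS_ae Lf; have [L2' E2] := opS_ae L1.
have Lc := concop_L2 Lf; have Lc1 := concop_L2 L1.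
rewrite (@aeq_inner _ _ (concop (opS A B f)) _ f); try exact: L2_cmf; try exact: E2; try by [].
- rewrite inner_concop// (inner_conj (bandlimit_L2b Lf).1 (bandlimit_L2b L1).1).
  rewrite -inner_concop// (@aeq_inner _ (concop f) (concop f) _ (concop f)); try exact: L2_cmf.
  + by rewrite -inner_conj// inner_self.
  + exact: aeW.
  + exact: E1.
- exact: aeW.
Qed.

Definition phase x : R -> R[i] := restr B (fun s => expi (2 * pi * x * s)).

Definition dirichlet t : R[i] := cintegral (phase t).

Definition kernel x : R -> R[i] := restr A (fun y => (dirichlet (x - y))^*%R).

Lemma phase_L2b x : L2b (phase x).
Proof. exact: restr_expi_L2b. Qed.

Lemma fourierL1_phase x y : fourierL1 (phase x) y = dirichlet (x - y).
Proof.
apply: eq_cintegral => s; rewrite /phase !restrE; case: ifP => _; last by rewrite mulr0.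
by rewrite -expiD; congr expi; ring.
Qed.

Lemma kernel_L2 x : L2 (kernel x).
Proof.
apply: restr_L2; first by case: bA.
under eq_fun do rewrite -fourierL1_phase.
by apply: L2_conj; apply: L2b_fourierL1; exact: phase_L2b.
Qed.

(** The kernel is a restriction of the conjugated transform of [phase x], whose squared norm is the
    measure of B for every [x]. This uniform constant will dominate the diagonal sums. *)
Lemma nsq_kernel_le x : nsq (kernel x) <= nsq (phase 0).
Proof.
have -> : nsq (phase 0) = nsq (phase x).
  apply: eq_Rintegral => s _; rewrite /phase !restrE; case: ifP => // _.
  by rewrite !sqn_expi.
rewrite -(plancherel_bsupp (phase_L2b x)).
have LF := L2b_fourierL1 (phase_L2b x); have LK := kernel_L2 x.
apply: le_Rintegral => //; [exact: L2_sqn|exact: L2_sqn|].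
move=> y _; apply: le_trans (restr_sqn_le _ _ _) _.
by rewrite sqn_conj -fourierL1_phase.
Qed.

(** The multiplication formula moves the transform from [restr A f] onto the modulated indicator of
    B. *)
Lemma concopE f x : L2 f -> A x -> concop f x = inner f (kernel x).
Proof.
move=> Lf Ax; have bf := restr_L2b bA Lf; have bg := bandlimit_L2b Lf.
rewrite /concop restrE mem_set// /fourierL1_inv /fourierL1.
rewrite -cintegral_conj; last first.
  by apply: cint_phase; apply: cint_conj; exact: L2b_cint.
rewrite (@eq_cintegral _ _ (fun s => phase x s * fourierL1 (restr A f) s)); last first.
  move=> s; rewrite conjCM conjCC expi_conj opprK /bandlimit /phase !restrE.
  by case: ifP => _; rewrite ?mulr0 ?mul0r// -mulrA [s * x]mulrC mulrA.
rewrite multiplication_formula; [|exact: L2b_cint (phase_L2b x)|exact: L2b_cint].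
apply: eq_cintegral => y; rewrite fourierL1_phase /kernel !restrE.
case: ifP => _; first by rewrite conjCC mulrC.
by rewrite (rmorph0 Num.conj) !mulr0.
Qed.

Definition trace_sq := \int[mu]_(x in A) nsq (kernel x).

(** At each point of A the diagonal sum is the Parseval sum of the kernel at that point. Bessel's
    inequality bounds it by a constant, so dominated convergence over the bounded set A exchanges
    limit and integral. *)
Lemma trace_sq_cvg e : orthonormal_basis e ->
  \sum_(k < n) nsq (concop (e k)) @[n --> \oo] --> trace_sq.
Proof.
move=> Be; have [Le oe _] := Be; have ortho : orthonormal e by [].
have LC (k : nat) : L2 (concop (e k)) by exact: concop_L2.
pose p n x := \sum_(k < n) sqn (concop (e k) x).
have ip n : intR (p n).
  elim: n => [|n IH].
    have -> : p 0%N = fun=> 0 by apply/funext => x; rewrite /p big_ord0.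
    by apply: (intR_le _ _ (L2_sqn (LC 0%N))) => // x; rewrite normr0 sqn_ge0.
  have -> : p n.+1 = fun x => p n x + sqn (concop (e n) x).
    by apply/funext => x; rewrite /p big_ord_recr.
  by apply: intRD => //; exact: L2_sqn.
have E n : \sum_(k < n) nsq (concop (e k)) = \int[mu]_x p n x.
  elim: n => [|n IH].
    rewrite big_ord0; under eq_Rintegral do rewrite /p big_ord0.
    by rewrite Rintegral_cst//= mul0r.
  rewrite big_ord_recr /= IH; under [RHS]eq_Rintegral do rewrite /p big_ord_recr /=.
  by rewrite -[RHS]/(\int[mu]_x (p n x + sqn (concop (e n) x))) RintegralD//; exact: L2_sqn.
have pE n x : p n x = \1_A x * \sum_(k < n) sqn (inner (kernel x) (e k)).
  rewrite indicE; have [xA|xA] := boolP (x \in A).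
    rewrite mul1r; apply: eq_bigr => k _; rewrite concopE; [|exact: Le|by rewrite inE in xA].
    by rewrite (inner_conj (kernel_L2 x) (Le k)) sqn_conj.
  rewrite mul0r /p big1// => k _; rewrite /concop restrE (negbTE xA) sqn0//.
have mp n := intR_meas (ip n).
have cp x : p n x @[n --> \oo] --> \1_A x * nsq (kernel x).
  apply: (cvgn_eq (fun n => esym (pE n x))); apply: cvgnZ.
  exact: parseval (kernel_L2 x).
rewrite /trace_sq Rintegral_mkcond.
rewrite [X in _ --> X](_ : _ = \int[mu]_x (\1_A x * nsq (kernel x))); last first.
  apply: eq_Rintegral => x _; rewrite patchE indicE; case: (x \in A); by rewrite ?mul1r ?mul0r.
apply: (cvgn_eq (fun n => esym (E n))).
(* The dominating function is a constant times the indicator of A; the indicator is written as the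
   squared modulus of a cut exponential, already known to be in L^2. *)
apply: (Rintegral_dominated (q := fun x => nsq (phase 0) * sqn (restr A (fun s => expi (2 * pi * 0 * s)) x))) => //.
- by apply: (measurable_fun_cvg (h := p)) => // x _; exact: cp.
- exact: aeW.
- by apply: intRZ; apply: L2_sqn; case: (restr_expi_L2b 0 bA).
- move=> n x; rewrite pE indicE restrE; case: (x \in A); last first.
    by rewrite mul0r normr0 mulr_ge0 ?nsq_ge0 ?sqn_ge0.
  rewrite sqn_expi mul1r mulr1 ger0_norm; last by apply: sumr_ge0 => k _; exact: sqn_ge0.
  exact: le_trans (bessel n ortho (kernel_L2 x)) (nsq_kernel_le x).
Qed.

Lemma normc_real (r : R) : normc (r%:C) = `|r|.
Proof. by rewrite /= expr0n addr0 sqrtr_sqr. Qed.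

Lemma is_trace_sq : is_trace (opS A B \o opS A B) (trace_sq)%:C.
Proof.
move=> e Be; have [Le _ _] := Be; have := trace_sq_cvg Be => H.
have E n : \sum_(k < n) inner ((opS A B \o opS A B) (e k)) (e k) - trace_sq%:C =
    (\sum_(k < n) nsq (concop (e k)) - trace_sq)%:C.
  rewrite rmorphB /= rmorph_sum /=; congr (_ - _); apply: eq_bigr => k _.
  exact: inner_opS2.
have := cvgnB H (cvgn_cst trace_sq); rewrite subrr => /(cvg_norm) /=.
rewrite normr0; apply: cvgn_eq => n /=.
by rewrite E normc_real.
Qed.

(** [is_trace] quantifies over all orthonormal bases, so it determines its number only if there is a
    basis; the Haar basis supplies one, and limits along it are unique. *)
Theorem trace_opS2 : trace (opS A B \o opS A B) = trace_sq%:C.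
Proof.
rewrite /trace; case: xgetP => [l _ Hl|/(_ _ is_trace_sq)//].
have [e [Be _]] := @exists_haar_basis R.
have c1 := Hl e Be; have c2 := is_trace_sq Be.
have E : normc (l - trace_sq%:C) = 0.
  apply: cvg_unique (cvgn_cst (normc (l - trace_sq%:C))) _ => //.
  apply: (@cvgn_squeeze0 _ _ (fun n =>
      normc (\sum_(k < n) inner ((opS A B \o opS A B) (e k)) (e k) - l) +
      normc (\sum_(k < n) inner ((opS A B \o opS A B) (e k)) (e k) - trace_sq%:C))).
    move=> n; rewrite ger0_norm ?normc_ge0//; set s := \sum_(k < n) _.
    have -> : l - trace_sq%:C = (- (s - l)) + (s - trace_sq%:C) by ring.
    by apply: le_trans (@le_normcD R _ _) _; rewrite (@normcN R).
  by have := cvgnD c1 c2; rewrite addr0.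
by apply/eqP; rewrite -subr_eq0; apply/eqP; exact: Normc.eq0_normc.
Qed.

End Trace.

(** * Sine and cosine integrals *)

Section Primitives.
Context {R : realType}.
Implicit Types (f g F : R -> R) (a b c l x t : R).

Lemma hasd0_const f a b : a <= b -> (forall x, a < x < b -> hasd f x 0) ->
  (forall x, a <= x <= b -> {for x, continuous f}) -> f a = f b.
Proof.
move=> ab df cf.
have [| |c _ /eqP] := @MVT_segment _ f (fun=> 0) _ _ ab.
- by move=> x; rewrite in_itv; exact: df.
- by apply: within_continuousW => x /=; rewrite in_itv /=; exact: cf.
- by rewrite mul0r subr_eq0 => /eqP.
Qed.

Lemma continuous_itv_integrable f a b : (forall x, a <= x <= b -> {for x, continuous f}) ->
  mu.-integrable `[a, b] (EFin \o f).
Proof.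
move=> cf; apply: continuous_compact_integrable; first exact: segment_compact.
by apply: within_continuousW => x /=; rewrite in_itv /=; exact: cf.
Qed.

(** The branch for negative [x] makes the primitive differentiable on both sides of 0, so that
    derivative rules hold on the whole line. *)
Definition primitive f x : R :=
  if 0 <= x then \int[mu]_(t in `[0, x]) f t else - \int[mu]_(t in `[x, 0]) f t.

Lemma primitiveE f x : 0 <= x -> primitive f x = \int[mu]_(t in `[0, x]) f t.
Proof. by rewrite /primitive => ->. Qed.

Lemma primitive0 f : primitive f 0 = 0.
Proof. by rewrite primitiveE// set_itv1 Rintegral_set1. Qed.

Lemma primitive_d f x : continuous f -> hasd (primitive f) x (f x).
Proof.
move=> cf; pose M := `|x| + 1.
have iM u v : mu.-integrable `[u, v] (EFin \o f).
  by apply: continuous_itv_integrable => z _; exact: cf.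
(* The base point [- M] lies to the left of both [x] and 0, so near [x] the primitive is [G y - G 0]
   whatever the sign of [y]. *)
pose G y := \int[mu]_(t in `[- M, y]) f t.
have /andP[Mx xM] : - M < x < M by rewrite -ltr_norml ltrDl.
have M0 : 0 < M by rewrite (le_lt_trans (normr_ge0 x))// ltrDl.
have [dG GE] := @continuous_FTC1_closed _ f (- M) x M xM (iM _ _) Mx (cf x).
have HG : hasd (fun y => G y - G 0) x (f x).
  rewrite -[f x]subr0; apply: d_add; last by apply: d_opp; exact: d_cst.
  by rewrite -GE derive1E; exact: DeriveDef.
apply: near_eq_is_derive HG; near=> y.
have : - M < y < M by apply/andP; split; near: y; [exact: lt_nbhsr|exact: lt_nbhsl].
move=> /andP[My yM]; rewrite /G /primitive; case: ifPn => [y0|]; last rewrite -ltNge => y0.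
- rewrite (@Rintegral_itvB _ f (BLeft (- M)) (BRight y) 0); [|exact: iM|by rewrite bnd_simp oppr_le0 ltW|by rewrite bnd_simp].
  apply: Rintegral_itv_obnd_cbnd; apply: integrableS (iM 0 y) => //; exact: subset_itv_oc_cc.
- rewrite -opprB; congr (- _).
  rewrite (@Rintegral_itvB _ f (BLeft (- M)) (BRight 0) y); [|exact: iM|by rewrite bnd_simp ltW|by rewrite bnd_simp ltW].
  apply: Rintegral_itv_obnd_cbnd; apply: integrableS (iM y 0) => //; exact: subset_itv_oc_cc.
Unshelve. all: by end_near.
Qed.

(** The quotient g(x) / x with its singularity at 0 filled by [l]; continuity at 0 is
    differentiability of [g] there. *)
Definition slope0 g l x : R := if x == 0 then l else g x / x.

Lemma slope0_near g l x : x != 0 -> \near x, g x / x = slope0 g l x.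
Proof.
move=> x0; near=> y; rewrite /slope0; have /negPf -> // : y != 0.
by near: y; apply: (cvgr_neq0 (f := id) x); [exact: cvg_id|exact: x0].
Unshelve. all: by end_near.
Qed.

Lemma slope0_continuous g l : g 0 = 0 -> hasd g 0 l -> continuous g ->
  continuous (slope0 g l).
Proof.
move=> g0 dg cg x; have [->|x0] := eqVneq x 0.
  apply/continuous_withinNx; rewrite {2}/slope0 eqxx.
  have := @ex_derive _ _ _ _ _ _ _ dg; rewrite /derivable => C.
  have <- := @derive_val _ _ _ _ _ _ _ dg.
  apply: cvg_trans C; apply: near_eq_cvg; near=> h.
  rewrite /= /slope0 g0 subr0 addr0 /GRing.scale /= mulr1 mulrC.
  have /negPf -> // : h != 0.
  by near: h; exact: nbhs_dnbhs_neq.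
have C : g y / y @[y --> x] --> g x / x.
  by apply: cvgM; [exact: cg|apply: cvgV].
rewrite /continuous_at {2}/slope0 (negPf x0).
by apply: cvg_trans C; apply: near_eq_cvg; exact: slope0_near.
Unshelve. all: by end_near.
Qed.

Definition sinc := slope0 (@sin R) 1.
Definition cinc := slope0 (fun u : R => 1 - cos u) 0.

Lemma sinc_neq0 x : x != 0 -> sinc x = sin x / x.
Proof. by rewrite /sinc /slope0 => /negPf ->. Qed.

Lemma sinc0 : sinc 0 = 1. Proof. by rewrite /sinc /slope0 eqxx. Qed.

Lemma cinc_neq0 x : x != 0 -> cinc x = (1 - cos x) / x.
Proof. by rewrite /cinc /slope0 => /negPf ->. Qed.

Lemma cinc0 : cinc 0 = 0. Proof. by rewrite /cinc /slope0 eqxx. Qed.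

Lemma sincN x : sinc (- x) = sinc x.
Proof.
have [->|x0] := eqVneq x 0; first by rewrite oppr0.
by rewrite !sinc_neq0 ?oppr_eq0// sinN invrN mulrNN.
Qed.

Lemma cincN x : cinc (- x) = - cinc x.
Proof.
have [->|x0] := eqVneq x 0; first by rewrite oppr0 cinc0 oppr0.
by rewrite !cinc_neq0 ?oppr_eq0// cosN invrN mulrN.
Qed.

Lemma continuous_sinc : continuous sinc.
Proof.
apply: slope0_continuous; [exact: sin0| |exact: continuous_sin].
by der; rewrite ?cos0 ?mulr1.
Qed.

Lemma continuous_cinc : continuous cinc.
Proof.
apply: slope0_continuous; first by rewrite cos0 subrr.
  by der; rewrite ?sin0; ring.
by move=> x; cont.
Qed.

Lemma sinc_d x : x != 0 -> hasd sinc x (cos x / x - sin x / x ^+ 2).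
Proof.
move=> x0.
have D : hasd (fun y => sin y / y) x (cos x / x - sin x / x ^+ 2) by der => //; field.
apply: near_eq_is_derive (slope0_near _ _ x0) _.
exact: D.
Qed.

Lemma cos_double x : cos (2 * pi * x) = 1 - 2 * sin (pi * x) ^+ 2 :> R.
Proof.
have -> : 2 * pi * x = pi * x + pi * x by ring.
rewrite cosD; have := cos2Dsin2 (pi * x).
by move: (sin _) (cos _) => s k E; lra.
Qed.

Definition sinc2 x : R := sinc (pi * x) ^+ 2.

Lemma continuous_sinc2 : continuous sinc2.
Proof.
move=> x; apply: (continuous_comp (f := fun x => sinc (pi * x)) (g := fun y => y ^+ 2)).
  apply: (continuous_comp (f := fun x => pi * x) (g := sinc)); last exact: continuous_sinc.
  by cont.
by cont.
Qed.

Definition SI := primitive sinc.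
Definition CIN := primitive cinc.
Definition PSI := primitive sinc2.

Lemma SI_d x : hasd SI x (sinc x).
Proof. exact/primitive_d/continuous_sinc. Qed.
Lemma CIN_d x : hasd CIN x (cinc x).
Proof. exact/primitive_d/continuous_cinc. Qed.
Lemma PSI_d x : hasd PSI x (sinc2 x).
Proof. exact/primitive_d/continuous_sinc2. Qed.

Lemma SiE t : 0 <= t -> Si t = SI t.
Proof.
move=> t0; rewrite /SI primitiveE// /Si.
(* The integrand of [Si] and [sinc] differ at 0, whence the detour through the half-open
   interval. *)
have I : mu.-integrable `]0, t] (EFin \o sinc).
  apply: integrableS (continuous_itv_integrable (a := 0) (b := t) _) => //.
    exact: subset_itv_oc_cc.
  by move=> x _; exact: continuous_sinc.
have E : {in `]0, t], sinc =1 (fun x => sin x / x)}.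
  by move=> x; rewrite in_itv /= => /andP[x0 _]; rewrite sinc_neq0// gt_eqF.
rewrite -!Rintegral_itv_obnd_cbnd//.
  by apply: eq_Rintegral => x; rewrite inE => /= xt; rewrite E.
apply: eq_integrable I => // x; rewrite inE => /= xt.
by rewrite /= E.
Qed.

Lemma PSIN x : 0 <= x -> PSI (- x) = - PSI x.
Proof.
move=> x0; have := @hasd0_const (fun x => PSI x + PSI (- x)) 0 x x0.
rewrite oppr0 /PSI primitive0 addr0 -/PSI => /(_ _ _)/esym E.
apply/eqP; rewrite -addr_eq0 addrC E//.
- move=> y _; apply: d_eq.
    apply: d_add; first exact: PSI_d.
    by apply: (d_comp (h := PSI)); [exact: PSI_d|repeat der1].
  by rewrite (_ : sinc2 (- y) = sinc2 y); [ring|rewrite /sinc2 mulrN sincN].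
- move=> y _; eapply d_continuous; apply: d_add; first exact: PSI_d.
  by apply: (d_comp (h := PSI)); [exact: PSI_d|repeat der1].
Qed.

Lemma CINN x : 0 <= x -> CIN (- x) = CIN x.
Proof.
move=> x0; have := @hasd0_const (fun x => CIN x - CIN (- x)) 0 x x0.
rewrite oppr0 /CIN primitive0 subr0 -/CIN => /(_ _ _)/esym E.
apply/esym/eqP; rewrite -subr_eq0 E//.
- move=> y _; apply: d_eq.
    apply: d_add; first exact: CIN_d.
    by apply: d_opp; apply: (d_comp (h := CIN)); [exact: CIN_d|repeat der1].
  by rewrite cincN; ring.
- move=> y _; eapply d_continuous; apply: d_add; first exact: CIN_d.
  by apply: d_opp; apply: (d_comp (h := CIN)); [exact: CIN_d|repeat der1].
Qed.

(** Integration by parts of sin^2 (pi t) / (pi t)^2, checked by differentiation. The boundary term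
    is written with [sinc] so as to be continuous at 0, where only continuity is then required. *)
Lemma PSI_closed c : 0 <= c ->
  PSI c = SI (2 * pi * c) / pi - sin (pi * c) * sinc (pi * c) / pi.
Proof.
move=> c0; have p0 := @pi_gt0 R.
have D x : hasd (fun x => SI (2 * pi * x)) x (sinc (2 * pi * x) * (2 * pi)).
  by apply: d_eq; [apply: (d_comp (h := SI)); [exact: SI_d|repeat der1]|move: (pi : R) => p; ring].
pose f x := PSI x - SI (2 * pi * x) / pi + sin (pi * x) * sinc (pi * x) / pi.
have f0 : f 0 = 0 by rewrite /f !mulr0 /PSI /SI !primitive0 sin0; ring.
have cs x : {for x, continuous (fun x => sinc (pi * x))}.
  apply: (continuous_comp (f := fun x => pi * x) (g := sinc)); last exact: continuous_sinc.
  by cont.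
suff : f 0 = f c by rewrite f0 /f => E; apply/eqP; rewrite -subr_eq0 [X in _ == X]E; apply/eqP; ring.
apply: hasd0_const => // x.
  move=> /andP[x0 _]; have x1 : x != 0 by rewrite gt_eqF.
  have px : pi * x != 0 by rewrite mulf_neq0 ?gt_eqF.
  apply: d_eq.
    rewrite /f; apply: d_add.
      apply: d_add; first exact: PSI_d.
      by apply: d_opp; apply: d_mul; [exact: D|exact: d_cst].
    apply: d_mul; last exact: d_cst.
    apply: d_mul; first by repeat der1.
    by apply: (d_comp (h := sinc)); [exact: sinc_d|repeat der1].
  rewrite /sinc2 !sinc_neq0//; last by rewrite -mulrA mulf_neq0// gt_eqF.
  have -> : sin (2 * pi * x) = 2 * sin (pi * x) * cos (pi * x).
    by rewrite (_ : 2 * pi * x = pi * x + pi * x) ?sinD; ring.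
  move: (SI _) (sin _) (cos _) => S s k.
  have p1 : pi != 0 :> R by rewrite gt_eqF.
  by move: (pi : R) p1 => p p1; field; rewrite x1 p1.
move=> _; apply: cvgD; first apply: cvgB.
- exact: d_continuous (PSI_d x).
- by apply: cvgM; [exact: d_continuous (D x)|exact: cvg_cst].
- apply: cvgM; last exact: cvg_cst.
  by apply: cvgM; [eapply (@d_continuous _ (fun x => sin (pi * x))); repeat der1|exact: cs].
Qed.

(* A primitive of [PSI], found by parts: [x * sinc2 x = cinc (2 pi x) / pi]. *)
Definition PSI_prim x : R := x * PSI x - CIN (2 * pi * x) / (2 * pi ^+ 2).

Lemma PSI_prim_d x : hasd PSI_prim x (PSI x).
Proof.
have p0 := @pi_gt0 R; have p1 : pi != 0 :> R by rewrite gt_eqF.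
apply: d_eq.
  apply: d_add; first by apply: d_mul; [exact: d_id|exact: PSI_d].
  apply: d_opp; apply: d_mul; last exact: d_cst.
  by apply: (d_comp (h := CIN)); [exact: CIN_d|repeat der1].
have [->|x0] := eqVneq x 0.
  by rewrite !mulr0 cinc0; ring.
rewrite /sinc2 sinc_neq0 ?mulf_neq0// cinc_neq0 ?mulf_neq0//.
rewrite cos_double.
move: (CIN _) (PSI x) (sin _) => C P s; move: (pi : R) p1 => p p1.
by field; rewrite x0 p1.
Qed.

Lemma sqn_dirichlet t : sqn (dirichlet `[0, 1] t) = sinc2 t.
Proof.
have p0 := @pi_gt0 R; have p1 : pi != 0 :> R by rewrite gt_eqF.
have RE : Re (dirichlet `[0, 1] t) = \int[mu]_(s in `[0, 1]) cos (2 * pi * t * s).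
  rewrite /dirichlet /cintegral /= [RHS]Rintegral_mkcond; apply: eq_Rintegral => s _.
  by rewrite patchE indicE; case: (s \in _); rewrite /= ?mul1r !mul0r ?subr0 ?addr0.
have IE : Im (dirichlet `[0, 1] t) = \int[mu]_(s in `[0, 1]) sin (2 * pi * t * s).
  rewrite /dirichlet /cintegral /= [RHS]Rintegral_mkcond; apply: eq_Rintegral => s _.
  by rewrite patchE indicE; case: (s \in _); rewrite /= ?mul1r !mul0r ?subr0 ?addr0.
rewrite /sqn RE IE /sinc2; have [->|t0] := eqVneq t 0.
  rewrite (@Rftc2 _ _ (fun s => s)) ?(@Rftc2 _ _ (fun s => 0))//.
  - by rewrite mulr0 sinc0; ring.
  - by move=> x _; apply: d_eq; [repeat der1|rewrite mulr0 mul0r sin0].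
  - by move=> x _; cont.
  - by move=> x _; apply: d_eq; [repeat der1|rewrite mulr0 mul0r cos0].
  - by move=> x _; cont.
have k0 : 2 * pi * t != 0 by rewrite !mulf_neq0.
rewrite (@Rftc2 _ _ (fun s => sin (2 * pi * t * s) / (2 * pi * t)))//; last 2 first.
- by move=> x _; apply: d_eq; [repeat der1|move: (pi : R) p1 => p p1; field; rewrite t0 p1].
- by move=> x _; cont.
rewrite (@Rftc2 _ _ (fun s => - cos (2 * pi * t * s) / (2 * pi * t)))//; last 2 first.
- by move=> x _; apply: d_eq; [repeat der1|move: (pi : R) p1 => p p1; field; rewrite t0 p1].
- by move=> x _; cont.
rewrite sinc_neq0 ?mulf_neq0// !mulr0 !mulr1 sin0 cos0.
have E2 : sin (2 * pi * t) ^+ 2 = 1 - (1 - 2 * sin (pi * t) ^+ 2) ^+ 2.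
  rewrite -cos_double; have := cos2Dsin2 (2 * pi * t).
  by move: (sin _) (cos _) => s k E; lra.
rewrite !mul0r !subr0 expr_div_n E2 cos_double.
move: (sin _) => s; move: (pi : R) p1 => p p1.
by field; rewrite t0 p1.
Qed.

(** With |D|^2 = [sinc2], the inner integral is PSI x - PSI (x - c), and the outer one is PSI_prim c
    + PSI_prim (-c). As PSI is odd and CIN even, this is twice PSI_prim c, and [PSI_closed]
    finishes. *)
Lemma trace_sqE c : 0 < c -> trace_sq `[0, c] `[0, 1] =
  2 / pi * c * SI (2 * pi * c) + (cos (2 * pi * c) - 1) / pi ^+ 2
   - CIN (2 * pi * c) / pi ^+ 2.
Proof.
move=> c0; have p0 := @pi_gt0 R; have p1 : pi != 0 :> R by rewrite gt_eqF.
have cl : 0 <= c := ltW c0.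
have KE x : nsq (kernel `[0, c] `[0, 1] x) = PSI x - PSI (x - c).
  transitivity (\int[mu]_(y in `[0, c]) sinc2 (x - y)).
    rewrite [RHS]Rintegral_mkcond; apply: eq_Rintegral => y _.
    rewrite patchE /kernel restrE; case: (y \in _); last exact: sqn0.
    by rewrite sqn_conj sqn_dirichlet.
  rewrite (@Rftc2 _ _ (fun y => - PSI (x - y)))//.
  - by rewrite subr0; ring.
  - move=> y _; apply: d_eq.
      by apply: d_opp; apply: (d_comp (h := PSI)); [exact: PSI_d|repeat der1].
    by ring.
  - move=> y _; apply: (continuous_comp (f := fun y => x - y) (g := sinc2)).
      by cont.
    exact: continuous_sinc2.
rewrite /trace_sq; under eq_Rintegral do rewrite KE.
rewrite (@Rftc2 _ _ (fun x => PSI_prim x - PSI_prim (x - c)))//; last 2 first.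
- move=> x _; apply: d_add; first exact: PSI_prim_d.
  apply: d_opp; apply: d_eq.
    by apply: (d_comp (h := PSI_prim)); [exact: PSI_prim_d|repeat der1].
  by ring.
- move=> x _; apply: cvgB; first exact: d_continuous (PSI_d x).
  apply: (continuous_comp (f := fun y => y - c) (g := PSI)).
    by cont.
  exact: d_continuous (PSI_d _).
rewrite subrr sub0r /PSI_prim mulrN CINN ?PSIN//; last by rewrite !mulr_ge0// ltW.
rewrite !mulr0 /CIN primitive0 -/CIN PSI_closed// sinc_neq0 ?mulf_neq0 ?gt_eqF//.
rewrite cos_double.
move: (CIN _) (SI _) (sin _) => C S s; move: (pi : R) p1 => p p1.
by field; rewrite p1 gt_eqF.
Qed.

End Primitives.

(** * The Dirichlet kernel and its conjugate on [0, pi] *)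

Section DirichletKernel.
Context {R : realType}.
Implicit Types (f g F : R -> R) (a b c t u x : R) (n m k : nat).

Lemma hasd_le f f' a b : a <= b -> (forall x, a < x < b -> hasd f x (f' x)) ->
  (forall x, a < x < b -> 0 <= f' x) ->
  (forall x, a <= x <= b -> {for x, continuous f}) -> f a <= f b.
Proof.
rewrite le_eqVlt => /predU1P[->//|ab] df f0 cf.
have [| |c cab E] := @MVT _ f f' _ _ ab.
- by move=> x; rewrite in_itv; exact: df.
- by apply: within_continuousW => x /=; rewrite in_itv /=; exact: cf.
- by rewrite -subr_ge0 E mulr_ge0// ?f0// ?subr_ge0 ?ltW//; move: cab; rewrite in_itv.
Qed.

(** Here the primitive is differentiable inside and merely continuous at the ends, as for the
    primitive of [rho], which involves [sinc] at 0. *)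
Lemma Rftc2_oo f F a b : a < b -> (forall x, a < x < b -> hasd F x (f x)) ->
  {for a, continuous F} -> {for b, continuous F} ->
  (forall x, a <= x <= b -> {for x, continuous f}) ->
  \int[mu]_(x in `[a, b]) f x = F b - F a.
Proof.
move=> ab dF Fa Fb cf; rewrite /Rintegral (@continuous_FTC2 _ f F) ?EFinB//.
- by apply: within_continuousW => x /=; rewrite in_itv /=; exact: cf.
- split; [|exact: cvg_at_right_filter|exact: cvg_at_left_filter].
  by move=> x; rewrite in_itv /= => xab; apply: (@ex_derive _ _ _ _ _ _ _ (dF x xab)).
- move=> x; rewrite in_itv /= => xab.
  by rewrite derive1E; apply: (@derive_val _ _ _ _ _ _ _ (dF x xab)).
Qed.

(** This and the next two Taylor bounds are obtained each from the preceding one, by monotonicity of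
    the difference of the two sides. *)
Lemma sin_le u : 0 <= u -> sin u <= u.
Proof.
move=> u0; have := @hasd_le (fun x => x - sin x) (fun x => 1 - cos x) 0 u u0.
rewrite sin0 !subr0 subr_ge0; apply.
- by move=> x _; apply: d_eq; [repeat der1|ring].
- by move=> x _; rewrite subr_ge0 cos_le1.
- by move=> x _; cont.
Qed.

Lemma cos_ge u : 0 <= u -> 1 - u ^+ 2 / 2 <= cos u.
Proof.
move=> u0; have := @hasd_le (fun x => cos x + x ^+ 2 / 2) (fun x => x - sin x) 0 u u0.
rewrite cos0 expr0n /= mul0r addr0 -lerBlDr; apply.
- by move=> x _; apply: d_eq; [repeat der1|rewrite /=; field].
- by move=> x /andP[x0 _]; rewrite subr_ge0 sin_le// ltW.
- by move=> x _; cont.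
Qed.

Lemma sin_ge u : 0 <= u -> u - u ^+ 3 / 6 <= sin u.
Proof.
move=> u0; have := @hasd_le (fun x => sin x - x + x ^+ 3 / 6) (fun x => cos x - (1 - x ^+ 2 / 2)) 0 u u0.
rewrite sin0 expr0n /= mul0r addr0 subr0 => H.
suff : 0 <= sin u - u + u ^+ 3 / 6 by lra.
apply: H.
- by move=> x _; apply: d_eq; [repeat der1|rewrite /=; field].
- by move=> x /andP[x0 _]; rewrite subr_ge0 cos_ge// ltW.
- by move=> x _; cont.
Qed.

(* The bounded difference of the kernels 1 / (2 sin (t/2)) and 1 / t near 0. *)
Definition rho t : R := if t <= 0 then 0 else (2 * sin (t / 2))^-1 - t^-1.

(** Its purpose is continuity of [rho] at 0. *)
Lemma rho_bound t : t <= 4 -> `|rho t| <= `|t|.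
Proof.
move=> t4; rewrite /rho; have [t0|t0] := leP t 0; first by rewrite /= normr0.
have [u [tu u0 u2]] : exists u, [/\ t = 2 * u, 0 < u & u <= 2].
  by exists (t / 2); split; [field|rewrite divr_gt0|lra].
have -> : t / 2 = u by rewrite tu; field.
have s1 := sin_le (ltW u0); have s2 := sin_ge (ltW u0).
have u3 : u ^+ 3 <= 4 * u.
  rewrite exprS mulrC ler_pM2r//; have : 0 <= (2 - u) * (2 + u) by rewrite mulr_ge0; lra.
  lra.
(* For u <= 2 the cubic term u^3 / 6 is at most 2 u / 3; a lower bound for the sine linear in [u] is
   needed since it sits in the denominator. *)
have s3 : u / 3 <= sin u by lra.
have sp : 0 < sin u by lra.
rewrite tu [leRHS]gtr0_norm; last by rewrite mulr_gt0.
move: (sin u) s1 s2 s3 sp => s s1 s2 s3 sp.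
have E : (2 * s)^-1 - (2 * u)^-1 = (u - s) / (2 * s * u) by field; rewrite !gt_eqF.
have p : 0 < 2 * s * u by rewrite !mulr_gt0.
rewrite E ger0_norm; last by rewrite divr_ge0 ?subr_ge0// ltW.
rewrite ler_pdivrMr//.
have : u ^+ 2 * (u / 3) <= u ^+ 2 * s by rewrite ler_wpM2l// sqr_ge0.
have : 0 <= u ^+ 3 by rewrite exprn_ge0// ltW.
have -> : 2 * u * (2 * s * u) = 4 * (u ^+ 2 * s) by ring.
have -> : u ^+ 2 * (u / 3) = u ^+ 3 / 3 by ring.
lra.
Qed.

Lemma sin_half_neq0 t : 0 < t -> t <= pi -> sin (t / 2) != 0.
Proof.
move=> t0 tp; rewrite gt_eqF// sin_gt0_pi// divr_gt0//=.
have := @pi_gt0 R; move: (pi : R) tp => p tp p0; lra.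
Qed.

Lemma rho_continuous x : 0 <= x <= pi -> {for x, continuous rho}.
Proof.
move=> /andP[x0 xp]; have [->|xn] := eqVneq x 0.
  have r0 : rho 0 = 0 by rewrite /rho lexx.
  change (rho y @[y --> (0 : R)] --> rho 0); rewrite r0; apply/cvgrPdist_le => e e0.
  exists (Num.min e 4) => /=; first by rewrite lt_min e0 ltr0n.
  move=> y /=; rewrite !sub0r !normrN lt_min => /andP[ye y4].
  by rewrite (le_trans (rho_bound _)) ?ltW// (le_lt_trans (ler_norm _)).
have xp0 : 0 < x by rewrite lt_neqAle eq_sym xn.
have C : {for x, continuous (fun t => (2 * sin (t / 2))^-1 - t^-1)}.
  have s0 := sin_half_neq0 xp0 xp.
  cont => //.
  by rewrite mulf_neq0.
have rx : rho x = (2 * sin (x / 2))^-1 - x^-1 by rewrite /rho leNgt xp0.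
change (rho y @[y --> x] --> rho x); rewrite rx.
apply: cvg_trans C; apply: near_eq_cvg; near=> y; rewrite /rho leNgt.
by have -> : 0 < y by near: y; exact: lt_nbhsr.
Unshelve. all: by end_near.
Qed.

(** Telescoping: 2 sin (t/2) sin (k t) = cos ((k - 1/2) t) - cos ((k + 1/2) t). The cosine sum below
    is analogous. *)
Lemma sin_sum t n : 2 * sin (t / 2) * (\sum_(1 <= k < n.+1) sin (k%:R * t)) =
  cos (t / 2) - cos ((n%:R + 2^-1) * t).
Proof.
elim: n => [|n IH].
  by rewrite big_geq// mulr0 add0r [2^-1 * t]mulrC subrr.
rewrite big_nat_recr//= mulrDr IH (_ : n.+1%:R = n%:R + 1); last by rewrite natr1.
have -> : (n%:R + 2^-1) * t = (n%:R + 1) * t - t / 2 by field.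
have -> : (n%:R + 1 + 2^-1) * t = (n%:R + 1) * t + t / 2 by field.
rewrite cosB cosD.
by move: (cos _) (sin _) (cos _) (sin _) => a b c d; ring.
Qed.

Lemma cos_sum t n : 2 * sin (t / 2) * (2^-1 + \sum_(1 <= k < n.+1) cos (k%:R * t)) =
  sin ((n%:R + 2^-1) * t).
Proof.
elim: n => [|n IH].
  by rewrite big_geq// addr0 add0r [2^-1 * t]mulrC; field.
rewrite big_nat_recr//= addrA mulrDr IH (_ : n.+1%:R = n%:R + 1); last by rewrite natr1.
have -> : (n%:R + 2^-1) * t = (n%:R + 1) * t - t / 2 by field.
have -> : (n%:R + 1 + 2^-1) * t = (n%:R + 1) * t + t / 2 by field.
rewrite sinB sinD.
by move: (cos _) (sin _) (cos _) (sin _) => a b c d; ring.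
Qed.

(* Frequencies with integral spacing 2, so that the waves [expi (nu m * t)] are
   orthogonal on [0, pi]. *)
Definition nu m : R := m.*2%:R + 2^-1.

Lemma nu_gt0 m : 0 < nu m. Proof. by rewrite ltr_pwDr ?invr_gt0. Qed.

Lemma sin_npi n : sin (n%:R * pi) = 0 :> R.
Proof.
by rewrite mulr_natl -[pi *+ n]add0r (alternatingn (@sinDpi R)) sin0 mulr0.
Qed.

Lemma cos_npi n : cos (n%:R * pi) = (-1) ^+ n :> R.
Proof.
by rewrite mulr_natl -[pi *+ n]add0r (alternatingn (@cosDpi R)) cos0 mulr1.
Qed.

(** The Dirichlet kernel sin (nu t) / (2 sin (t/2)), with the denominator split as 1 / t plus [rho].
    The first part integrates to a value of [SI]; the second is left to the Riemann-Lebesgue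
    lemma. *)
Lemma cos_kernel m t : 0 <= t <= pi ->
  2^-1 + \sum_(1 <= k < m.*2.+1) cos (k%:R * t) =
  nu m * sinc (nu m * t) + rho t * sin (nu m * t).
Proof.
move=> /andP[t0 tp]; have [->|tn] := eqVneq t 0.
  rewrite !mulr0 sinc0 sin0 mulr0 addr0 mulr1.
  under eq_bigr do rewrite mulr0 cos0.
  by rewrite sumr_const_nat subn1 /nu addrC.
have tp0 : 0 < t by rewrite lt_neqAle eq_sym tn.
have s0 := sin_half_neq0 tp0 tp; have n0 := nu_gt0 m.
have := cos_sum t m.*2; rewrite -/(nu m) sinc_neq0 ?mulf_neq0 ?gt_eqF//.
rewrite /rho leNgt tp0 /= => <-; move: (sin _) s0 (_ + _) => s s0 S.
by field; rewrite tn s0 gt_eqF.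
Qed.

Lemma cos_quarter_gt0 t : 0 <= t <= pi -> 0 < cos (t / 4).
Proof.
move=> /andP[t0 tp]; apply: cos_gt0_pihalf; have := @pi_gt0 R.
by move: (pi : R) tp => p tp p0; apply/andP; split; lra.
Qed.

(** The conjugate kernel (cos (t/2) - cos (nu t)) / (2 sin (t/2)). Replacing cos (t/2) by 1 costs (1
    - cos (t/2)) / (2 sin (t/2)) = tan (t/4) / 2, and the rest splits as in [cos_kernel]. *)
Lemma sin_kernel m t : 0 <= t <= pi ->
  \sum_(1 <= k < m.*2.+1) sin (k%:R * t) =
  nu m * cinc (nu m * t) - sin (t / 4) / cos (t / 4) / 2 + rho t
    - rho t * cos (nu m * t).
Proof.
move=> tt; have c4 := cos_quarter_gt0 tt; move: tt => /andP[t0 tp]; have [->|tn] := eqVneq t 0.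
  rewrite !mulr0 cinc0 !mul0r sin0 /rho lexx !mul0r.
  under eq_bigr do rewrite mulr0 sin0.
  by rewrite sumr_const_nat mul0rn; ring.
have tp0 : 0 < t by rewrite lt_neqAle eq_sym tn.
have s0 := sin_half_neq0 tp0 tp; have n0 := nu_gt0 m.
have := sin_sum t m.*2; rewrite -/(nu m) cinc_neq0 ?mulf_neq0 ?gt_eqF//.
rewrite /rho leNgt tp0 /=.
have t2 : t / 2 = t / 4 + t / 4 by field.
have := cos2Dsin2 (t / 4).
move: (cos (nu m * t)) (\sum_(_ <= _ < _) _) s0 => C S.
rewrite t2 sinD cosD; move: (sin _) (cos _) c4 => s c c4 + E E2.
move=> s0.
have s1 : s != 0 by apply: contra_neq s0 => ->; rewrite mul0r mulr0 addr0.
have -> : S = (1 - C - 2 * s * s) / (2 * (2 * (s * c))).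
  have -> : 1 - C - 2 * s * s = c * c - s * s - C by lra.
  by rewrite -E2; field; rewrite s1 gt_eqF.
by field; rewrite s1 tn s0 !gt_eqF.
Qed.

End DirichletKernel.

(** * Limit values of the sine and cosine integrals *)

Section LimitValues.
Context {R : realType}.
Local Notation mu := (@lebesgue_measure R).
Implicit Types (f g F : R -> R) (a b c t u x : R) (n m k : nat).

Lemma patch0E f (A : set R) x : (f \_ A) x = if x \in A then f x else 0.
Proof. exact: patchE. Qed.

Lemma int_cos_pi m n : \int[mu]_(t in `[0, pi]) cos ((nu m - nu n) * t) = (m == n)%:R * pi.
Proof.
have p0 := @pi_gt0 R; have [<-|mn] := eqVneq m n.
  rewrite subrr mul1r (@Rftc2 _ _ (fun t => t)) ?subr0// ?ltW//.
  - by move=> t _; apply: d_eq; [repeat der1|rewrite mul0r cos0].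
  - by move=> t _; cont.
have k0 : nu m - nu n != 0 :> R.
  by rewrite /nu opprD addrACA subrr addr0 subr_eq0 eqr_nat (inj_eq double_inj).
have S0 : sin ((nu m - nu n) * pi) = 0 :> R.
  have -> : (nu m - nu n) * pi = m.*2%:R * pi - n.*2%:R * pi :> R by rewrite /nu; ring.
  by rewrite sinB !sin_npi; ring.
move: (nu m - nu n) k0 S0 => d k0 S0.
rewrite mul0r (@Rftc2 _ _ (fun t => sin (d * t) / d)) ?ltW//.
- by rewrite mulr0 sin0 S0; ring.
- by move=> t _; apply: d_eq; [repeat der1|cbv beta; field].
- by move=> t _; cont.
Qed.

Lemma int_sin_pi m n : \int[mu]_(t in `[0, pi]) sin ((nu m - nu n) * t) = 0.
Proof.
have p0 := @pi_gt0 R; have [<-|mn] := eqVneq m n.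
  rewrite subrr (@Rftc2 _ _ (fun t => 0)) ?subr0// ?ltW//.
  - by move=> t _; apply: d_eq; [repeat der1|rewrite mul0r sin0].
  - by move=> t _; cont.
have k0 : nu m - nu n != 0 :> R.
  by rewrite /nu opprD addrACA subrr addr0 subr_eq0 eqr_nat (inj_eq double_inj).
have S0 : cos ((nu m - nu n) * pi) = 1 :> R.
  have -> : (nu m - nu n) * pi = m.*2%:R * pi - n.*2%:R * pi :> R by rewrite /nu; ring.
  by rewrite cosB !sin_npi !cos_npi -signr_odd -[(-1) ^+ n.*2]signr_odd !odd_double expr0; ring.
move: (nu m - nu n) k0 S0 => d k0 S0.
rewrite (@Rftc2 _ _ (fun t => - cos (d * t) / d)) ?ltW//.
- by rewrite mulr0 cos0 S0; ring.
- by move=> t _; apply: d_eq; [repeat der1|cbv beta; field].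
- by move=> t _; cont.
Qed.

Lemma bset_0pi : bset `[0, pi : R]%classic.
Proof.
split; first exact: measurable_itv.
exists 4%N => x; rewrite /= in_itv /= => /andP[x0 xp]; rewrite ger0_norm//.
by rewrite (le_trans xp)//; have := @pihalf_lt2 R; move: (pi : R) => p; lra.
Qed.

(** The frequency is divided by 2 pi to match the normalisation in [restr_expi_L2b]; [waveE]
    restores the plain form. *)
Definition wave m : R -> R[i] := restr `[0, pi]%classic (fun s => expi (2 * pi * (nu m / (2 * pi)) * s)).

Lemma waveE m t : wave m t = (\1_(`[0, pi]%classic) t)%:C * expi (nu m * t).
Proof.
have p0 := @pi_gt0 R; rewrite /wave /restr; congr (_ * expi (_ * _)).
by move: (pi : R) p0 => p p0; field; rewrite gt_eqF.
Qed.

Lemma wave_L2 m : L2 (wave m).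
Proof. by case: (restr_expi_L2b (nu m / (2 * pi)) bset_0pi). Qed.

Lemma inner_wave (G : R -> R) m :
  inner (fun t => ((G \_ `[0, pi]%classic) t)%:C) (wave m) =
  (\int[mu]_(t in `[0, pi]) (G t * cos (nu m * t))) +i*
  (\int[mu]_(t in `[0, pi]) - (G t * sin (nu m * t))).
Proof.
pose I := `[0, pi : R]%classic.
have E t : ((G \_ I) t)%:C * (wave m t)^*%R =
    (((fun t => G t * cos (nu m * t)) \_ I) t) +i* (((fun t => - (G t * sin (nu m * t))) \_ I) t).
  rewrite waveE; apply: complexP; rewrite !cE /= !patch0E indicE;
    by case: (t \in I); rewrite /=; ring.
by rewrite /inner (eq_cintegral E) /cintegral /= -!Rintegral_mkcond.
Qed.

Lemma inner_wave2 m n : inner (wave m) (wave n) = ((m == n)%:R * pi)%:C.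
Proof.
pose I := `[0, pi : R]%classic.
have E t : wave m t * (wave n t)^*%R =
    (((fun t => cos ((nu m - nu n) * t)) \_ I) t) +i* (((fun t => sin ((nu m - nu n) * t)) \_ I) t).
  rewrite !waveE; apply: complexP; rewrite !cE /= !patch0E indicE [(nu m - nu n) * t]mulrBl ?cosB ?sinB;
    by case: (t \in I); rewrite /=; ring.
by rewrite /inner (eq_cintegral E) /cintegral /= -!Rintegral_mkcond int_cos_pi int_sin_pi.
Qed.

Lemma continuous_restr_L2 g : (forall x, 0 <= x <= pi -> {for x, continuous g}) ->
  L2 (fun t => ((g \_ `[0, pi]%classic) t)%:C).
Proof.
move=> cg; have Ig := continuous_itv_integrable cg.
have Ig2 : mu.-integrable `[0, pi] (EFin \o (fun t => g t ^+ 2)).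
  apply: continuous_itv_integrable => x /cg gx.
  by apply: (continuous_comp (f := g) (g := fun y => y ^+ 2)) => //; exact: exprn_continuous.
apply/L2P; split.
  apply: cmf_real; apply: (measurable_restrictT g (measurable_itv `[0, pi])).1.
  by have /measurable_int/measurable_EFinP := Ig.
have := (integrable_mkcond (mu := mu) _ (measurable_itv `[0, pi])).1 Ig2.
congr (is_true (integrable _ _ _)); apply/funext => t /=.
by rewrite restrict_EFin /sqn /= !patch0E; case: ifP => _; congr EFin; ring.
Qed.

(** The waves divided by sqrt pi are orthonormal, so the coefficients of an L^2 function along them
    tend to 0; their real and imaginary parts are the two integrals up to sign and scale. *)
Lemma riemann_lebesgue g : (forall x, 0 <= x <= pi -> {for x, continuous g}) ->
  \int[mu]_(t in `[0, pi]) (g t * cos (nu m * t)) @[m --> \oo] --> 0 /\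
  \int[mu]_(t in `[0, pi]) (g t * sin (nu m * t)) @[m --> \oo] --> 0.
Proof.
move=> cg; have LG := continuous_restr_L2 cg; have p0 := @pi_gt0 R.
pose q : R := Num.sqrt pi; have q0 : 0 < q by rewrite sqrtr_gt0.
have q2 : q * q = pi by rewrite -expr2 sqr_sqrtr// ltW.
pose e m : R -> R[i] := fun t => (q^-1)%:C * wave m t.
have Le m : L2 (e m) by apply: L2Z; exact: wave_L2.
have ortho : orthonormal e.
  split=> // m n; rewrite innerZ ?innerZr ?inner_wave2//; try exact: wave_L2.
  rewrite -q2; case: (m == n); apply: complexP; rewrite !cE /=; try by ring.
  by field; rewrite gt_eqF.
set G := fun t : R => _ in LG.
have H := orthonormal_coef_cvg0 ortho LG.
have E m : inner G (e m) = (q^-1)%:C * inner G (wave m).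
  rewrite innerZr//; last exact: wave_L2.
  by congr (_ * _); apply: complexP; rewrite !cE /= ?oppr0.
split.
- have := cvgnZ q (sqn_cvg0_Re H); rewrite mulr0; apply: cvgn_eq => m.
  by rewrite E inner_wave cReM /= mul0r subr0 mulrA divff ?gt_eqF// mul1r.
(* Multiplication by i turns the imaginary part into a real part, so that the same lemma applies. *)
- have H2 : sqn ((0 +i* 1) * inner G (e m)) @[m --> \oo] --> 0.
    by apply: cvgn_eq H => m; rewrite sqnM /sqn /=; ring.
  have := cvgnZ q (sqn_cvg0_Re H2); rewrite mulr0; apply: cvgn_eq => m.
  have N : \int[mu]_(t in `[0, pi]) (- (g t * sin (nu m * t))) =
      - \int[mu]_(t in `[0, pi]) (g t * sin (nu m * t)).
    under eq_Rintegral do rewrite -mulN1r.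
    rewrite RintegralZl// ?mulN1r//.
    apply: continuous_itv_integrable => x /cg gx; apply: cvgM => //.
    by eapply (@d_continuous _ (fun x => sin (nu m * x))); repeat der1.
  rewrite E inner_wave N !cE /=; move: (\int[mu]_(_ in _) _) (\int[mu]_(_ in _) _) => a b.
  by field; rewrite gt_eqF.
Qed.

Lemma continuous_scaled (h : R -> R) a x : continuous h -> {for x, continuous (fun t => h (a * t))}.
Proof.
move=> ch; apply: (continuous_comp (f := fun t => a * t) (g := h)); last exact: ch.
by cont.
Qed.

Lemma hasd_scaled (h : R -> R) a x l : hasd h (a * x) l -> hasd (fun t => h (a * t)) x (a * l).
Proof.
move=> dh; apply: d_eq; first by apply: (d_comp (h := h)); [exact: dh|repeat der1].
by cbv beta; ring.
Qed.

Lemma hasd_sum (h : nat -> R -> R) (l : nat -> R) x n :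
  (forall k, (0 < k)%N -> hasd (h k) x (l k)) ->
  hasd (fun t => \sum_(1 <= k < n.+1) h k t) x (\sum_(1 <= k < n.+1) l k).
Proof.
move=> dh; elim: n => [|n IH].
  by rewrite big_geq//; under eq_fun do rewrite big_geq//; exact: d_cst.
rewrite big_nat_recr//=; under eq_fun do rewrite big_nat_recr//=.
by apply: d_add => //; exact: dh.
Qed.

Lemma continuous_sum (h : nat -> R -> R) x n : (forall k, continuous (h k)) ->
  {for x, continuous (fun t => \sum_(1 <= k < n.+1) h k t)}.
Proof.
move=> ch; elim: n => [|n IH].
  have -> : (fun t => \sum_(1 <= k < 1) h k t) = fun=> 0.
    by apply/funext => t; rewrite big_geq.
  exact: cvg_cst.
have -> : (fun t => \sum_(1 <= k < n.+2) h k t) =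
    fun t => \sum_(1 <= k < n.+1) h k t + h n.+1 t.
  by apply/funext => t; rewrite big_nat_recr.
by apply: cvgD => //; exact: ch.
Qed.

(** Integrate [cos_kernel] over [0, pi]: every cosine integrates to 0 and the constant 1/2 leaves pi
    / 2. *)
Lemma SI_nu m : SI (nu m * pi) =
  pi / 2 - \int[mu]_(t in `[0, pi]) (rho t * sin (nu m * t)).
Proof.
have p0 := @pi_gt0 R.
have I1 : \int[mu]_(t in `[0, pi]) (2^-1 + \sum_(1 <= k < m.*2.+1) cos (k%:R * t)) = pi / 2.
  rewrite (@Rftc2 _ _ (fun t => t / 2 + \sum_(1 <= k < m.*2.+1) sin (k%:R * t) / k%:R)) ?ltW//.
  - rewrite mul0r add0r [X in _ - X]big1 => [|k _]; last by rewrite mulr0 sin0 mul0r.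
    by rewrite subr0 big1 ?addr0// => k _; rewrite sin_npi mul0r.
  - move=> x _; apply: d_add; first by der; field.
    apply: (hasd_sum (h := fun k t => sin (k%:R * t) / k%:R)) => k k0.
    by der; field; rewrite pnatr_eq0 -lt0n.
  - move=> x _; apply: cvgD; first exact: cvg_cst.
    apply: (continuous_sum (h := fun k t => cos (k%:R * t))) => k y.
    by apply: continuous_scaled; exact: continuous_cos.
have I2 : \int[mu]_(t in `[0, pi]) (nu m * sinc (nu m * t)) = SI (nu m * pi).
  rewrite (@Rftc2 _ _ (fun t => SI (nu m * t))) ?ltW//.
  - by rewrite mulr0 /SI primitive0 subr0.
  - by move=> x _; apply: hasd_scaled; exact: SI_d.
  - move=> x _; apply: cvgM; first exact: cvg_cst.
    by apply: continuous_scaled; exact: continuous_sinc.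
have E : \int[mu]_(t in `[0, pi]) (2^-1 + \sum_(1 <= k < m.*2.+1) cos (k%:R * t)) =
    \int[mu]_(t in `[0, pi]) (nu m * sinc (nu m * t) + rho t * sin (nu m * t)).
  by apply: eq_Rintegral => t; rewrite inE /= in_itv /= => /cos_kernel ->.
rewrite I1 RintegralD//= ?I2 in E; first by rewrite E addrK.
- apply: continuous_itv_integrable => x _; apply: cvgM; first exact: cvg_cst.
  by apply: continuous_scaled; exact: continuous_sinc.
- apply: continuous_itv_integrable => x /rho_continuous rx; apply: cvgM => //.
  by apply: continuous_scaled; exact: continuous_sin.
Qed.

Lemma SI_nu_cvg : SI (nu m * pi) @[m --> \oo] --> (pi / 2 : R).
Proof.
have [_ H] := riemann_lebesgue (@rho_continuous R).
have := cvgnB (cvgn_cst (pi / 2)) H; rewrite subr0; apply: cvgn_eq => m.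
by rewrite SI_nu.
Qed.

Lemma int_tan_quarter : \int[mu]_(t in `[0, pi]) (sin (t / 4) / cos (t / 4) / 2) = ln 2 :> R.
Proof.
have p0 := @pi_gt0 R.
have cp x : 0 <= x <= pi -> cos (x / 4) != 0 :> R by move=> /cos_quarter_gt0 H; rewrite gt_eqF.
rewrite (@Rftc2 _ _ (fun t => - 2 * ln (cos (t / 4)))) ?ltW//.
- rewrite mul0r cos0 ln1 mulr0 subr0.
  have q : 0 < cos (pi / 4) :> R by apply: cos_quarter_gt0; rewrite lexx ltW.
  have q2 : cos (pi / 4) ^+ 2 = 2^-1 :> R.
    have := cos2Dsin2 (pi / 4 : R); rewrite -cosBpihalf.
    have -> : pi / 4 - pi / 2 = - (pi / 4) :> R by field.
    by rewrite cosN; lra.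
  have := lnXn 2 q; rewrite q2 lnV ?posrE// => E.
  by rewrite mulNr mulr_natl -E opprK.
- move=> x xp; have q := cos_quarter_gt0 xp.
  by der; [exact: q|field; rewrite gt_eqF].
- move=> x xp; have q := cp x xp.
  eapply (@d_continuous _ (fun t => sin (t / 4) / cos (t / 4) / 2)).
  by repeat der1.
Qed.

(** The primitive is ln (tan (t/4) / t), with the singularity at 0 removed by writing it with
    [sinc]; its end values are - ln 4 and - ln pi. *)
Lemma int_rho : \int[mu]_(t in `[0, pi]) rho t = ln 4 - ln pi :> R.
Proof.
have p0 := @pi_gt0 R.
pose F t : R := ln (sinc (t / 4) / (4 * cos (t / 4))).
have Fc x : 0 <= x <= pi -> {for x, continuous F}.
  move=> xp; have q := cos_quarter_gt0 xp.
  have s0 : 0 < sinc (x / 4).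
    have [->|x0] := eqVneq x 0; first by rewrite mul0r sinc0.
    move: xp => /andP[xl xp]; have xx : 0 < x by rewrite lt_neqAle eq_sym x0.
    rewrite sinc_neq0 ?mulf_neq0// divr_gt0 ?divr_gt0// sin_gt0_pi// divr_gt0//=.
    by move: (pi : R) xp p0 => p xp p0; lra.
  apply: (continuous_comp (f := fun t => sinc (t / 4) / (4 * cos (t / 4))) (g := @ln R)); last first.
    by apply: continuous_ln; rewrite divr_gt0 ?mulr_gt0.
  apply: cvgM.
    apply: (continuous_comp (f := fun t => t / 4) (g := sinc)); last exact: continuous_sinc.
    by cont.
  eapply (@d_continuous _ (fun t => (4 * cos (t / 4))^-1)).
  by repeat der1; rewrite ?mulf_neq0 ?gt_eqF.
rewrite (@Rftc2_oo _ _ F)//; first last.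
- by move=> x; exact: rho_continuous.
- by apply: Fc; rewrite lexx ltW.
- by apply: Fc; rewrite lexx ltW.
- move=> x /andP[x0 xp]; have q : 0 < cos (x / 4) by apply: cos_quarter_gt0; rewrite !ltW.
  have s0 : 0 < sin (x / 4).
    by rewrite sin_gt0_pi// divr_gt0//=; move: (pi : R) xp p0 => p xp p0; lra.
  have D : hasd (fun t => ln (sin (t / 4) / (t * cos (t / 4)))) x (rho x).
    have n0 : x * cos (x / 4) != 0 by rewrite mulf_neq0 ?gt_eqF.
    der; [by rewrite divr_gt0 ?mulr_gt0|exact: n0|].
    rewrite /rho leNgt x0 /=.
    have t2 : x / 2 = x / 4 + x / 4 by field.
    rewrite t2 sinD; have := cos2Dsin2 (x / 4).
    move: (sin _) (cos _) s0 q n0 => s c s0 q n0 E.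
    have s1 : s * c + c * s != 0 by rewrite gt_eqF// addr_gt0// mulr_gt0.
    have -> : (2 * (s * c + c * s))^-1 = (c ^+ 2 + s ^+ 2) / (2 * (s * c + c * s)).
      by rewrite E mul1r.
    by field; rewrite s1 !gt_eqF.
  apply: near_eq_is_derive D; near=> y.
  have y0 : 0 < y by near: y; exact: lt_nbhsr.
  rewrite /F sinc_neq0 ?mulf_neq0 ?gt_eqF// [(4 * _)^-1]invfM [(y * _)^-1]invfM.
  by congr ln; move: ((cos (y / 4))^-1) (sin (y / 4)) => w s; field; rewrite gt_eqF.
- have q : 0 < cos (pi / 4) :> R by apply: cos_quarter_gt0; rewrite lexx ltW.
  rewrite /F mul0r sinc0 cos0 mulr1 mul1r sinc_neq0 ?mulf_neq0 ?gt_eqF//.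
  have <- : cos (pi / 4) = sin (pi / 4) :> R.
    rewrite -cosBpihalf; have -> : pi / 4 - pi / 2 = - (pi / 4) :> R by field.
    by rewrite cosN.
  rewrite lnV ?posrE// opprK.
  have -> : cos (pi / 4) / (pi / 4) / (4 * cos (pi / 4)) = pi^-1 :> R.
    move: (pi : R) p0 (cos _) q => p p0 c q; by field; rewrite !gt_eqF.
  by rewrite lnV ?posrE// addrC.
Unshelve. all: by end_near.
Qed.

Definition harm n : R := \sum_(1 <= k < n.+1) k%:R^-1.

(** Twice the sum over odd k: the even terms of the harmonic sum up to 2m make up half the harmonic
    sum up to m. *)
Lemma sum_odd_harm m :
  \sum_(1 <= k < m.*2.+1) ((1 - (-1) ^+ k) / k%:R) = 2 * harm m.*2 - harm m :> R.
Proof.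
rewrite /harm; elim: m => [|m IH]; first by rewrite !big_geq//; ring.
rewrite doubleS !(@big_nat_recr _ _ _ m.*2.+2 1)//= !(@big_nat_recr _ _ _ m.*2.+1 1)//=.
rewrite (@big_nat_recr _ _ _ m.+1 1)//= IH.
have -> : (-1) ^+ m.*2.+1 = -1 :> R by rewrite -signr_odd /= odd_double.
have -> : (-1) ^+ m.*2.+2 = 1 :> R by rewrite -signr_odd /= odd_double.
have -> : m.*2.+2%:R = 2 * m.+1%:R :> R by rewrite -doubleS -muln2 natrM mulrC.
have m0 : m.+1%:R != 0 :> R by rewrite pnatr_eq0.
have m1 : m.*2.+1%:R != 0 :> R by rewrite pnatr_eq0.
by move: (m.+1%:R) (m.*2.+1%:R) m0 m1 => a b a0 b0; field; rewrite a0 b0.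
Qed.

(** Integrate [sin_kernel] over [0, pi]: the sine of frequency k contributes (1 - (-1)^k) / k, the
    quarter-angle tangent ln 2, and [rho] the difference ln 4 - ln pi. *)
Lemma CIN_nu m : CIN (nu m * pi) = 2 * harm m.*2 - harm m + ln 2 - (ln 4 - ln pi)
  + \int[mu]_(t in `[0, pi]) (rho t * cos (nu m * t)).
Proof.
have p0 := @pi_gt0 R.
have I1 : \int[mu]_(t in `[0, pi]) (\sum_(1 <= k < m.*2.+1) sin (k%:R * t)) = 2 * harm m.*2 - harm m.
  rewrite (@Rftc2 _ _ (fun t => \sum_(1 <= k < m.*2.+1) - cos (k%:R * t) / k%:R)) ?ltW//.
  - rewrite -sumrB -sum_odd_harm; apply: eq_bigr => k _.
    by rewrite mulr0 cos0 cos_npi; ring.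
  - move=> x _; apply: (hasd_sum (h := fun k t => - cos (k%:R * t) / k%:R)) => k k0.
    by der; field; rewrite pnatr_eq0 -lt0n.
  - move=> x _; apply: (continuous_sum (h := fun k t => sin (k%:R * t))) => k y.
    by apply: continuous_scaled; exact: continuous_sin.
have c2 x : {for x, continuous (fun t => nu m * cinc (nu m * t))}.
  by apply: cvgM; [exact: cvg_cst|apply: continuous_scaled; exact: continuous_cinc].
have I2 : \int[mu]_(t in `[0, pi]) (nu m * cinc (nu m * t)) = CIN (nu m * pi).
  rewrite (@Rftc2 _ _ (fun t => CIN (nu m * t))) ?ltW//.
  - by rewrite mulr0 /CIN primitive0 subr0.
  - by move=> x _; apply: hasd_scaled; exact: CIN_d.
have c3 x : 0 <= x <= pi -> {for x, continuous (fun t : R => sin (t / 4) / cos (t / 4) / 2)}.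
  move=> xp; have q : cos (x / 4) != 0 by rewrite gt_eqF// cos_quarter_gt0.
  eapply (@d_continuous _ (fun t => sin (t / 4) / cos (t / 4) / 2)).
  by repeat der1.
have c4 x : 0 <= x <= pi -> {for x, continuous (fun t : R => rho t * cos (nu m * t))}.
  move=> /rho_continuous rx; apply: cvgM => //.
  by apply: continuous_scaled; exact: continuous_cos.
have E : \int[mu]_(t in `[0, pi]) (\sum_(1 <= k < m.*2.+1) sin (k%:R * t)) =
    \int[mu]_(t in `[0, pi]) (nu m * cinc (nu m * t) - sin (t / 4) / cos (t / 4) / 2 + rho t
    - rho t * cos (nu m * t)).
  by apply: eq_Rintegral => t; rewrite inE /= in_itv /= => /sin_kernel ->.
rewrite I1 in E; rewrite RintegralB//= in E; first last.
- exact: continuous_itv_integrable.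
- apply: continuous_itv_integrable => x xp; apply: cvgD; last exact: rho_continuous.
  by apply: cvgB; [exact: c2|exact: c3].
rewrite RintegralD//= in E; first last.
- by apply: continuous_itv_integrable => x; exact: rho_continuous.
- apply: continuous_itv_integrable => x xp.
  by apply: cvgB; [exact: c2|exact: c3].
rewrite RintegralB//= ?I2 ?int_tan_quarter ?int_rho in E; first last.
- by apply: continuous_itv_integrable => x xp; exact: c3.
- by apply: continuous_itv_integrable => x _; exact: c2.
by rewrite E; ring.
Qed.

Lemma ln_le_harm n : ln n.+1%:R <= harm n.
Proof.
rewrite /harm; elim: n => [|n IH]; first by rewrite ln1 big_geq.
rewrite big_nat_recr//=; apply: le_trans (lerD IH (lexx _)).
have n0 : 0 < n.+1%:R :> R by [].
have -> : n.+2%:R = n.+1%:R * (1 + n.+1%:R^-1) :> R.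
  by rewrite -natr1; field; rewrite gt_eqF.
have i0 : 0 < n.+1%:R^-1 :> R by rewrite invr_gt0.
rewrite lnM ?posrE ?addr_gt0// lerD2l le_ln1Dx// (lt_trans (ltrN10 R) i0)//.
Qed.

(** [euler_gamma] is a [limn], meaningful only once convergence is known; the sequence decreases and
    stays nonnegative. *)
Lemma gamma_cvg : (harm n - ln n%:R) @[n --> \oo] --> (euler_gamma : R).
Proof.
suff : cvgn (fun n => harm n - ln n%:R : R) by [].
(* The shift starts the sequence at index 1, from where on the logarithm is genuine and the sequence
   monotone. *)
apply/cvg_ex; suff /cvg_ex[l H] : cvgn (fun n => harm n.+1 - ln n.+1%:R : R).
  by exists l; rewrite -cvg_shiftS.
apply: nonincreasing_is_cvgn.
  apply/nonincreasing_seqP => n; rewrite /harm big_nat_recr//= -/(harm n.+1).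
  have n0 : 0 < n.+1%:R :> R by [].
  have n1 : 0 < n.+2%:R :> R by [].
  have E : n.+1%:R = n.+2%:R * (1 - n.+2%:R^-1) :> R.
    have e2 : n.+2%:R = n.+1%:R + 1 :> R by rewrite natr1.
    by move: n1; rewrite e2 => n1; field; rewrite gt_eqF.
  have q : 0 < 1 - n.+2%:R^-1 :> R by rewrite subr_gt0 invf_lt1// ltr1n.
  have H : ln n.+1%:R <= ln n.+2%:R - n.+2%:R^-1 :> R.
    rewrite {1}E lnM ?posrE// lerD2l le_ln1Dx//.
    by rewrite ltrN2 invf_lt1// ltr1n.
  by move: (harm _) (ln n.+1%:R) (ln n.+2%:R) (n.+2%:R^-1) H => S a b w H; lra.
exists 0 => _ [n _ <-]; rewrite subr_ge0.
apply: le_trans (ln_le_harm _); rewrite ler_ln ?posrE// ler_nat; exact: leqnSn.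
Qed.

End LimitValues.

(** * Asymptotics *)

Section Asymptotics.
Context {R : realType}.
Local Notation mu := (@lebesgue_measure R).
Implicit Types (f g F r s : R -> R) (a b c t u x : R) (n m k p M N : nat).

Lemma cvgn_subseq (v : nat -> R) (l : R) (phi : nat -> nat) : (forall n, (n <= phi n)%N) ->
  v n @[n --> \oo] --> l -> v (phi n) @[n --> \oo] --> l.
Proof.
move=> le_phi /cvgrPdist_le H; apply/cvgrPdist_le => e e0.
have [N _ HN] := H e e0; exists N => // n /= Nn.
by apply: HN; rewrite /= (leq_trans Nn).
Qed.

Lemma leqS_double n : (n.+1 <= n.+1.*2)%N.
Proof. by rewrite -addnn leq_addr. Qed.

(** With n = m + 1, 2 H_2n - H_n is 2 ln 2 + ln n + gamma up to o(1). Together with the constants of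
    [CIN_nu] this is ln (2 n pi) + gamma, and ln (2 n pi) differs from ln (nu n pi) by o(1). *)
Lemma CIN_nu_cvg : (CIN (nu m.+1 * pi) - ln (nu m.+1 * pi)) @[m --> \oo] --> (euler_gamma : R).
Proof.
have p0 := @pi_gt0 R.
have [H _] := riemann_lebesgue (@rho_continuous R).
have c1 := cvgn_subseq (phi := fun m => m.+1.*2) (v := fun n => harm n - ln n%:R : R) _ gamma_cvg.
have c2 := cvgn_subseq (phi := fun m => m.+1) (v := fun n => harm n - ln n%:R : R) _ gamma_cvg.
have c3 := cvgn_subseq (phi := fun m => m.+1) _ H.
have {}c1 := c1 (fun n => leq_trans (leqnSn n) (leqS_double n)).
(* This is the logarithm of the ratio of [nu m.+1] to 2 (m + 1). *)
have c4 : ln (1 + (4 * m.+1%:R)^-1) @[m --> \oo] --> (0 : R).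
  apply: (cvgn_squeeze0 (v := fun m => m.+1%:R^-1)); last exact: cvg_harmonic.
  move=> m; have m0 : 0 < m.+1%:R :> R by [].
  have i0 : 0 < (4 * m.+1%:R)^-1 :> R by rewrite invr_gt0 mulr_gt0.
  have l0 : 0 <= ln (1 + (4 * m.+1%:R)^-1) :> R by rewrite ln_ge0// lerDl ltW.
  rewrite ger0_norm//.
  apply: le_trans (le_ln1Dx (lt_trans (ltrN10 R) i0)) _.
  by rewrite lef_pV2 ?posrE ?mulr_gt0// ler_peMl// ler1n.
have := cvgnD (cvgnB (cvgnB (cvgnZ 2 c1) (c2 (fun n => leqnSn n))) c4) (c3 (fun n => leqnSn n)).
have -> : 2 * euler_gamma - euler_gamma - 0 + 0 = euler_gamma :> R by ring.
apply: cvgn_eq => m; rewrite CIN_nu.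
have m0 : 0 < m.+1%:R :> R by [].
have n0 := @nu_gt0 R m.+1.
have -> : ln (m.+1.*2%:R) = ln 2 + ln m.+1%:R :> R.
  by rewrite -muln2 natrM mulrC lnM ?posrE.
have -> : ln (1 + (4 * m.+1%:R)^-1) = ln (nu m.+1) - ln 2 - ln m.+1%:R :> R.
  have -> : 1 + (4 * m.+1%:R)^-1 = nu m.+1 / (2 * m.+1%:R) :> R.
    by rewrite /nu -muln2 natrM; field; rewrite gt_eqF.
  by rewrite ln_div ?posrE ?mulr_gt0// lnM ?posrE//; ring.
have -> : ln 4 = ln 2 + ln 2 :> R by rewrite -lnM ?posrE// -natrM.
rewrite (lnM (x := nu _)) ?posrE//; ring.
Qed.

Lemma SI_nu_cvgS : SI (nu m.+1 * pi) @[m --> \oo] --> (pi / 2 : R).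
Proof. exact: (cvgn_subseq (phi := S) _ SI_nu_cvg). Qed.

Lemma nu_pi_ge y : exists N, forall n, (N <= n)%N -> y <= nu n.+1 * pi :> R.
Proof.
exists (Num.bound `|y|) => n Nn.
have : `|y| <= n%:R by rewrite (le_trans (ltW (archi_boundP (normr_ge0 y))))// ler_nat.
move=> yn; apply: (le_trans (ler_norm y)); apply: (le_trans yn).
have n1 : n%:R <= nu n.+1 :> R.
  rewrite /nu (@le_trans _ _ n.+1.*2%:R) ?lerDl ?invr_ge0// ler_nat -addnn.
  by rewrite (leq_trans (leqnSn n)) ?leq_addr.
apply: (le_trans n1); rewrite ler_peMr ?ltW ?nu_gt0//.
by have := @pihalf_ge1 R; move: (pi : R) => p; lra.
Qed.

(* Monotonicity of [+- r t - C / t^(p+1)] compares r at x with r far out on a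
   sequence along which its limit is known. *)
Lemma tail_estimate r r' C l p (s : nat -> R) x : 0 < x ->
  (forall t, x <= t -> hasd r t (r' t)) ->
  (forall t, x <= t -> `|r' t| <= C / t ^+ p.+2) ->
  (forall y, exists N, forall n, (N <= n)%N -> y <= s n) ->
  r (s n) @[n --> \oo] --> l -> `|r x - l| <= C / x ^+ p.+1.
Proof.
move=> x0 dr br soo rl; have C0 : 0 <= C.
  have := le_trans (normr_ge0 _) (br x (lexx _)).
  by rewrite pmulr_lge0 ?invr_gt0 ?exprn_gt0.
have key (sg : R) y : sg ^+ 2 = 1 -> x <= y -> sg * r x - C / x ^+ p.+1 <= sg * r y - C / y ^+ p.+1.
  move=> sg1 xy.
  have D t : x <= t <= y -> hasd (fun t => sg * r t - C / t ^+ p.+1) t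
      (sg * r' t + p.+1%:R * (C / t ^+ p.+2)).
    move=> /andP[xt _]; have t0 : 0 < t := lt_le_trans x0 xt.
    apply: d_eq.
      apply: d_add; first by apply: d_mul; [exact: d_cst|exact: dr].
      by repeat der1; rewrite expf_neq0// gt_eqF.
    have q0 : t ^+ p != 0 by rewrite expf_neq0// gt_eqF.
    cbv beta; rewrite !exprS /=; move: (t ^+ p) q0 (p.+1%:R) => q q0 w.
    by field; rewrite q0 gt_eqF.
  have := @hasd_le _ (fun t => sg * r t - C / t ^+ p.+1)
    (fun t => sg * r' t + p.+1%:R * (C / t ^+ p.+2)) x y xy.
  apply.
  - by move=> t /andP[xt ty]; apply: D; rewrite !ltW.
  - move=> t /andP[/ltW xt _]; have t0 : 0 < t := lt_le_trans x0 xt.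
    have B := br t xt; have Ct : 0 <= C / t ^+ p.+2 := le_trans (normr_ge0 _) B.
    have P : C / t ^+ p.+2 <= p.+1%:R * (C / t ^+ p.+2) by rewrite ler_peMl// ler1n.
    have N1 : `|sg * r' t| = `|r' t|.
      have s1 : `|sg| = 1 by apply/eqP; rewrite -sqr_norm_eq1 sg1.
      by rewrite normrM s1 mul1r.
    have := ler_norm (- (sg * r' t)); rewrite normrN N1; lra.
  - by move=> t /D/d_continuous.
have B y : x <= y -> `|r x - r y| <= C / x ^+ p.+1.
  move=> xy; have Cy : 0 <= C / y ^+ p.+1 by rewrite divr_ge0// exprn_ge0// ltW// (lt_le_trans x0).
  have := key 1 y (expr1n _ _) xy; have := key (-1) y (sqrr_sign _ 1) xy.
  by rewrite ler_norml !mul1r !mulN1r => k1 k2; apply/andP; split; lra.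
apply/ler_addgt0Pr => e e0.
have [N1 HN1] := soo x; have /cvgrPdist_le/(_ e e0)[N2 _ HN2] := rl.
have h1 := B _ (HN1 _ (leq_maxl N1 N2)); have h2 := HN2 _ (leq_maxr N1 N2).
have -> : r x - l = (r x - r (s (maxn N1 N2))) - (l - r (s (maxn N1 N2))) by ring.
by rewrite (le_trans (ler_normB _ _))// lerD.
Qed.

Definition asym_f M x : R := \sum_(i < M) (-1) ^+ i * ((2 * i)`!)%:R / x ^+ (2 * i).+1.
Definition asym_g M x : R := \sum_(i < M) (-1) ^+ i * ((2 * i).+1`!)%:R / x ^+ (2 * i).+2.

Lemma asym_fS M x : asym_f M.+1 x = asym_f M x + (-1) ^+ M * ((2 * M)`!)%:R / x ^+ (2 * M).+1.
Proof. exact: big_ord_recr. Qed.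

Lemma asym_gS M x : asym_g M.+1 x = asym_g M x + (-1) ^+ M * ((2 * M).+1`!)%:R / x ^+ (2 * M).+2.
Proof. exact: big_ord_recr. Qed.

Lemma asym_f_d M x : x != 0 -> hasd (asym_f M) x (- asym_g M x).
Proof.
move=> x0; elim: M => [|M IH].
  have -> : asym_f 0 = fun=> 0 by apply/funext => y; rewrite /asym_f big_ord0.
  by rewrite /asym_g big_ord0 oppr0; exact: d_cst.
rewrite asym_gS opprD; have -> : asym_f M.+1 = fun y => asym_f M y + (-1) ^+ M * ((2 * M)`!)%:R / y ^+ (2 * M).+1.
  by apply/funext => y; exact: asym_fS.
apply: d_add => //; have q0 : x ^+ (2 * M) != 0 by rewrite expf_neq0.
apply: d_eq; first by repeat der1; rewrite expf_neq0.
rewrite factS natrM; cbv beta; rewrite !exprS /=.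
move: (x ^+ (2 * M)) q0 ((2 * M).+1%:R) ((2 * M)`!%:R) ((-1) ^+ M) => q q0 w v z.
by field; rewrite q0.
Qed.

(** Whereas f' = - g holds exactly for the truncations, g' = f - 1 / x holds up to the first omitted
    term of f. This single discrepancy is the source of all error terms. *)
Lemma asym_g_d M x : x != 0 -> hasd (asym_g M) x
  (asym_f M x - x^-1 + (-1) ^+ M * ((2 * M)`!)%:R / x ^+ (2 * M).+1).
Proof.
move=> x0; elim: M => [|M IH].
  have -> : asym_g 0 = fun=> 0 by apply/funext => y; rewrite /asym_g big_ord0.
  by apply: d_eq (d_cst _ _) _; rewrite /asym_f big_ord0 muln0 fact0 !expr1; ring.
have -> : asym_g M.+1 = fun y => asym_g M y + (-1) ^+ M * ((2 * M).+1`!)%:R / y ^+ (2 * M).+2.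
  by apply/funext => y; exact: asym_gS.
have q0 : x ^+ (2 * M) != 0 by rewrite expf_neq0.
apply: d_eq; first by apply: d_add; [exact: IH|repeat der1; rewrite expf_neq0].
rewrite asym_fS (_ : 2 * M.+1 = (2 * M).+2)%N; last by rewrite mulnS.
rewrite [(2 * M).+2`!]factS natrM; cbv beta; rewrite !exprS /=.
move: (asym_f M x) (x ^+ (2 * M)) q0 ((2 * M).+2%:R) ((2 * M).+1`!%:R) ((2 * M)`!%:R) ((-1) ^+ M) => F q q0 w v v' z.
by field; rewrite q0 x0.
Qed.

Lemma asym_bound M : exists2 K, 0 <= K & forall x, 1 <= x ->
  `|asym_f M x| <= K / x /\ `|asym_g M x| <= K / x.
Proof.
have T x n (w : R) k : 1 <= x -> `|(-1) ^+ n * w / x ^+ k.+1| <= `|w| / x.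
  move=> x1; have x0 : 0 < x := lt_le_trans ltr01 x1.
  rewrite !normrM normrX normrN1 expr1n mul1r ler_wpM2l//.
  rewrite normfV gtr0_norm ?exprn_gt0// lef_pV2 ?posrE ?exprn_gt0//.
  by rewrite exprS ler_peMr ?exprn_ege1// ltW.
elim: M => [|M [K K0 HK]].
  by exists 0 => // x _; rewrite /asym_f /asym_g !big_ord0 normr0 mul0r.
exists (K + `|(2 * M)`!%:R| + `|(2 * M).+1`!%:R|) => [|x x1]; first by rewrite !addr_ge0.
have x0 : 0 < x := lt_le_trans ltr01 x1.
have [k1 k2] := HK x x1; rewrite asym_fS asym_gS !mulrDl.
have w1 : 0 <= `|(2 * M)`!%:R| / x by rewrite divr_ge0// ltW.
have w2 : 0 <= `|(2 * M).+1`!%:R| / x by rewrite divr_ge0// ltW.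
have t1 := T x M (2 * M)`!%:R (2 * M)%N x1; have t2 := T x M (2 * M).+1`!%:R (2 * M).+1 x1.
by split; apply: (le_trans (ler_normD _ _)); lra.
Qed.

Lemma bounded_over_cvg0 (v : nat -> R) K (s : nat -> R) :
  (forall y, exists N, forall n, (N <= n)%N -> y <= s n) ->
  (forall n, 1 <= s n -> `|v n| <= K / s n) -> v n @[n --> \oo] --> 0.
Proof.
move=> soo H; apply/cvgrPdist_le => e e0.
have [N HN] := soo (1 + `|K| / e); exists N => // n /= /HN sn.
have Ke : 0 <= `|K| / e by rewrite divr_ge0// ltW.
have s1 : 1 <= s n by lra.
have s0 : 0 < s n := lt_le_trans ltr01 s1.
rewrite sub0r normrN (le_trans (H n s1))// ler_pdivrMr// (le_trans (ler_norm _))//.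
by rewrite mulrC -ler_pdivrMr//; lra.
Qed.

Lemma trig_comb_bound x (A B K : R) : `|A| <= K -> `|B| <= K ->
  `|cos x * A + sin x * B| <= K + K.
Proof.
move=> HA HB; apply: (le_trans (ler_normD _ _)); rewrite !normrM.
have hc : `|cos x| <= 1 by rewrite ler_norml cos_geN1 cos_le1.
have hs : `|sin x| <= 1 by rewrite ler_norml sin_geN1 sin_le1.
have A0 := normr_ge0 A; have B0 := normr_ge0 B.
by apply: lerD; [rewrite -[K]mul1r|rewrite -[K]mul1r]; apply: ler_pM.
Qed.

(** In the derivative of the left side everything cancels except sin x times the discrepancy of
    [asym_g_d]. The limit pi / 2 is known along [nu n.+1 * pi], where the trigonometric terms vanish
    like 1 / x. *)
Lemma SI_asymptotic M x : 0 < x ->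
  `|SI x + cos x * asym_f M.+1 x + sin x * asym_g M.+1 x - pi / 2| <=
  ((2 * M.+1)`!)%:R / x ^+ (2 * M.+1).
Proof.
move=> x0.
pose r t := SI t + cos t * asym_f M.+1 t + sin t * asym_g M.+1 t.
rewrite -[SI x + _ + _]/(r x).
have e2 : (2 * M.+1 = (2 * M).+2)%N by rewrite mulnS.
(* Only the exponent is rewritten, into the successor form that [tail_estimate] expects. *)
rewrite {2}e2; apply: (@tail_estimate r
   (fun t => sin t * ((-1) ^+ M.+1 * ((2 * M.+1)`!)%:R / t ^+ (2 * M).+3)) _ _ _ (fun n => nu n.+1 * pi)) => //.
- move=> t xt; have t0 : t != 0 by rewrite gt_eqF// (lt_le_trans x0).
  apply: d_eq.
    apply: d_add; [apply: d_add; first exact: SI_d|].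
      by apply: d_mul; [repeat der1|exact: asym_f_d].
    by apply: d_mul; [repeat der1|exact: asym_g_d].
  rewrite sinc_neq0// e2; move: (_ / _ ^+ _) (asym_f _ _) (asym_g _ _) => E F G.
  by cbv beta; ring.
- move=> t xt; have t0 : 0 < t := lt_le_trans x0 xt.
  rewrite !normrM normrX normrN1 expr1n mul1r.
  rewrite normfV [`|t ^+ _|]gtr0_norm ?exprn_gt0// normr_nat.
  have q : 0 <= (2 * M.+1)`!%:R / t ^+ (2 * M).+3 by rewrite divr_ge0// exprn_ge0// ltW.
  apply: ler_piMl => //.
  by rewrite ler_norml sin_geN1 sin_le1.
- exact: nu_pi_ge.
- have [K K0 HK] := asym_bound M.+1.
  have c0 : (cos (nu n.+1 * pi) * asym_f M.+1 (nu n.+1 * pi) + sin (nu n.+1 * pi) * asym_g M.+1 (nu n.+1 * pi)) @[n --> \oo] --> (0 : R).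
    apply: (bounded_over_cvg0 (K := K + K) nu_pi_ge) => n /HK[k1 k2].
    by rewrite [leRHS]mulrDl; exact: trig_comb_bound.
  have := cvgnD SI_nu_cvgS c0; rewrite addr0; apply: cvgn_eq => n.
  by rewrite /r addrA.
Qed.

Lemma CIN_asymptotic M x : 0 < x ->
  `|CIN x - ln x + sin x * asym_f M.+1 x - cos x * asym_g M.+1 x - euler_gamma| <=
  ((2 * M.+1)`!)%:R / x ^+ (2 * M.+1).
Proof.
move=> x0.
pose r t := CIN t - ln t + sin t * asym_f M.+1 t - cos t * asym_g M.+1 t.
rewrite -[CIN x - _ + _ - _]/(r x).
have e2 : (2 * M.+1 = (2 * M).+2)%N by rewrite mulnS.
rewrite {2}e2; apply: (@tail_estimate r
   (fun t => - cos t * ((-1) ^+ M.+1 * ((2 * M.+1)`!)%:R / t ^+ (2 * M).+3)) _ _ _ (fun n => nu n.+1 * pi)) => //.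
- move=> t xt; have tp : 0 < t := lt_le_trans x0 xt.
  have t0 : t != 0 by rewrite gt_eqF.
  apply: d_eq.
    apply: d_add; first apply: d_add; first apply: d_add; first exact: CIN_d.
    + by apply: d_opp; apply: (d_ln (f := id)); [exact: tp|exact: d_id].
    + by apply: d_mul; [repeat der1|exact: asym_f_d].
    + by apply: d_opp; apply: d_mul; [repeat der1|exact: asym_g_d].
  rewrite cinc_neq0// e2; cbv beta.
  move: ((-1) ^+ _ * _ / _) (asym_f _ _) (asym_g _ _) (cos t) (sin t) => E F G c d.
  by field.
- move=> t xt; have t0 : 0 < t := lt_le_trans x0 xt.
  rewrite !normrM normrN normrX normrN1 expr1n mul1r.
  rewrite normfV [`|t ^+ _|]gtr0_norm ?exprn_gt0// normr_nat.
  have q : 0 <= (2 * M.+1)`!%:R / t ^+ (2 * M).+3 by rewrite divr_ge0// exprn_ge0// ltW.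
  apply: ler_piMl => //.
  by rewrite ler_norml cos_geN1 cos_le1.
- exact: nu_pi_ge.
- have [K K0 HK] := asym_bound M.+1.
  have c0 : (cos (nu n.+1 * pi) * - asym_g M.+1 (nu n.+1 * pi) + sin (nu n.+1 * pi) * asym_f M.+1 (nu n.+1 * pi)) @[n --> \oo] --> (0 : R).
    apply: (bounded_over_cvg0 (K := K + K) nu_pi_ge) => n /HK[k1 k2].
    by rewrite [leRHS]mulrDl; apply: trig_comb_bound; rewrite ?normrN.
  have := cvgnD CIN_nu_cvg c0; rewrite addr0; apply: cvgn_eq => n.
  by rewrite /r; ring.
Qed.

(** The estimate above holds at every positive argument, so it upgrades the limit along one sequence
    to a limit at infinity, which the definition of [Ci] demands. *)
Lemma ln_CIN_cvg : ln s - CIN s @[s --> +oo] --> (- euler_gamma : R).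
Proof.
have [K K0 HK] := asym_bound 1.
apply/cvgrPdist_le => e e0; near=> s.
have s1 : 1 <= s by near: s; apply: nbhs_pinfty_ge; exact: num_real.
have sK : (K + K + 2) / e <= s by near: s; apply: nbhs_pinfty_ge; exact: num_real.
have s0 : 0 < s := lt_le_trans ltr01 s1.
have [k1 k2] := HK s s1; have H := CIN_asymptotic 0 s0.
have T := @trig_comb_bound s (- asym_g 1 s) (asym_f 1 s) (K / s); rewrite normrN in T.
have {}T := T k2 k1.
have q : ((2 * 1)`!)%:R / s ^+ (2 * 1) <= 2 / s.
  rewrite ler_wpM2l// lef_pV2 ?posrE ?exprn_gt0// muln1 expr2 ler_peMl// ltW//.
have Ke : (K / s + K / s) + 2 / s <= e.
  by rewrite -!mulrDl ler_pdivrMr// mulrC -ler_pdivrMr.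
have -> : - euler_gamma - (ln s - CIN s) =
   (CIN s - ln s + sin s * asym_f 1 s - cos s * asym_g 1 s - euler_gamma)
   - (cos s * - asym_g 1 s + sin s * asym_f 1 s) by ring.
apply: (le_trans (ler_normB _ _)); lra.
Unshelve. all: by end_near.
Qed.

(** On the positive half-line ln - CIN is a primitive of cos x / x, and its limit at infinity is -
    gamma. *)
Lemma CiE t : 0 < t -> Ci t = euler_gamma + ln t - CIN t.
Proof.
move=> t0; rewrite /Ci.
have H : (\int[mu]_(x in `[t, s]) (cos x / x)) @[s --> +oo] --> - euler_gamma - (ln t - CIN t).
  have C : ln s - CIN s - (ln t - CIN t) @[s --> +oo] --> - euler_gamma - (ln t - CIN t).
    by apply: cvgB; [exact: ln_CIN_cvg|exact: cvg_cst].
  apply: cvg_trans C; apply: near_eq_cvg; near=> s.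
  have ts : t <= s by near: s; apply: nbhs_pinfty_ge; exact: num_real.
  rewrite (@Rftc2 _ _ (fun x => ln x - CIN x))// => x /andP[tx _].
    have xp : 0 < x := lt_le_trans t0 tx; have x0 : x != 0 by rewrite gt_eqF.
    apply: d_eq.
      apply: d_add; first by apply: (d_ln (f := id)); [exact: xp|exact: d_id].
      by apply: d_opp; exact: CIN_d.
    by rewrite cinc_neq0//; field.
  have xp : 0 < x := lt_le_trans t0 tx; have x0 : x != 0 by rewrite gt_eqF.
  by eapply (@d_continuous _ (fun x => cos x / x)); repeat der1.
by rewrite (cvg_lim _ H)//; ring.
Unshelve. all: by end_near.
Qed.

(** The factor of cos x in the trace expansion, sorted by powers: the term of g with index n - 1
    joins the term of x f with index n, which leaves the 1 of x f and the last term of g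
    unpaired. *)
Lemma asym_cos N x : x != 0 -> x * asym_f N.+1 x + asym_g N.+1 x =
  1 + \sum_(1 <= n < N.+1) (-1) ^+ n * (((2 * n)`!)%:R - ((2 * n - 1)`!)%:R) / x ^+ (2 * n)
  + (-1) ^+ N * ((2 * N).+1`!)%:R / x ^+ (2 * N).+2.
Proof.
move=> x0; elim: N => [|N IH].
  rewrite asym_fS asym_gS /asym_f /asym_g !big_ord0 big_geq// muln0 !fact0 (factS 0) fact0 expr0.
  by field.
rewrite asym_fS asym_gS big_nat_recr//= mulrDr addrACA IH (_ : 2 * N.+1 = (2 * N).+2)%N; last by rewrite mulnS.
rewrite subSS subn0; move: (\sum_(_ <= _ < _) _) => S.
have q0 : x ^+ (2 * N) != 0 by rewrite expf_neq0.
rewrite !exprS; move: (x ^+ (2 * N)) q0 ((2 * N).+3`!%:R) ((2 * N).+2`!%:R) ((2 * N).+1`!%:R) ((-1) ^+ N) => q q0 a b c z.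
by field; rewrite q0 x0.
Qed.

(** The factor of sin x. Terms of equal index pair off without remainder, and those of index 0
    cancel. *)
Lemma asym_sin N x : x != 0 -> x * asym_g N.+1 x - asym_f N.+1 x =
  \sum_(1 <= n < N.+1) (-1) ^+ n * (((2 * n + 1)`!)%:R - ((2 * n)`!)%:R) / x ^+ (2 * n + 1).
Proof.
move=> x0; elim: N => [|N IH].
  rewrite asym_fS asym_gS /asym_f /asym_g !big_ord0 big_geq// muln0 !fact0 (factS 0) fact0 expr0.
  by field.
rewrite asym_fS asym_gS big_nat_recr//= -IH (_ : 2 * N.+1 = (2 * N).+2)%N; last by rewrite mulnS.
rewrite addn1; move: (asym_f _ _) (asym_g _ _) => F G.
have q0 : x ^+ (2 * N) != 0 by rewrite expf_neq0.
rewrite !exprS; move: (x ^+ (2 * N)) q0 ((2 * N).+3`!%:R) ((2 * N).+2`!%:R) ((-1) ^+ N) => q q0 a b z.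
by field; rewrite q0 x0.
Qed.

End Asymptotics.

(** * The closed form of the trace and its expansion *)

Lemma bset_itv (R : realType) (a b : R) : bset `[a, b]%classic.
Proof.
split; first exact: measurable_itv.
exists (Num.bound (`|a| + `|b|)) => x; rewrite /= in_itv /= => /andP[ax xb].
have : `|x| <= `|a| + `|b|.
  have := ler_norm b; have := ler_norm (- a); rewrite normrN ler_norml => h1 h2.
  have := normr_ge0 a; have := normr_ge0 b => h3 h4.
  by apply/andP; split; lra.
move=> xab; apply: (le_trans xab); apply/ltW/archi_boundP.
by rewrite addr_ge0.
Qed.

(** Once [Si] and [Ci] are expressed by [SI] and [CIN], the isolated terms c, ln c, gamma and ln (2
    pi) cancel and [trace_sqE] remains. *)
Lemma trace_opS_square (R : realType) (c : R) : 0 < c ->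
  trace (opS `[0, c] `[0, 1] \o opS `[0, c] `[0, 1]) =
    (c - ln c / pi ^+ 2 - (1 + euler_gamma + ln (2 * pi)) / pi ^+ 2
     + (2 / pi * c * (Si (2 * pi * c) - pi / 2)
        + cos (2 * pi * c) / pi ^+ 2
        + Ci (2 * pi * c) / pi ^+ 2))%:C.
Proof.
move=> c0; have p0 := @pi_gt0 R; have x0 : 0 < 2 * pi * c by rewrite !mulr_gt0.
rewrite trace_opS2; [|exact: bset_itv..].
congr (_%:C); rewrite trace_sqE// SiE ?ltW// CiE//.
rewrite (lnM (x := 2 * pi)) ?posrE ?mulr_gt0//.
have p1 : pi != 0 :> R by rewrite gt_eqF.
move: (CIN _) (SI _) (cos _) (ln c) (ln (2 * pi)) (euler_gamma) => C S k l l2 g.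
by move: (pi : R) p1 => p p1; field.
Qed.

(** The error of the expansion written through the errors of the two asymptotic lemmas and the
    sorted factors of cosine and sine. Transcendental values are replaced by field variables, so
    that the identity is purely algebraic. *)
Lemma trace_error_identity (R : fieldType) (p c l l2 lx S C k s F G a b g : R) :
  p != 0 -> (2 : R) != 0 ->
  (c - l / p ^+ 2 - (1 + g + l2) / p ^+ 2
     + (2 / p * c * (S - p / 2) + k / p ^+ 2 + (g + lx - C) / p ^+ 2))
   - (c - l / p ^+ 2 - (1 + g + l2) / p ^+ 2 - k / p ^+ 2 * a - s / p ^+ 2 * b) =
  ((2 * p * c) * (S + k * F + s * G - p / 2) - (C - lx + s * F - k * G - g)
     + k * (1 + a - ((2 * p * c) * F + G)) - s * (((2 * p * c) * G - F) - b)) / p ^+ 2.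
Proof. by move=> p0 t0; field; rewrite t0 p0. Qed.

Theorem theorem1p15 (R : realType) :
  let S_ (c : R) := opS `[0, c] `[0, 1] in
  (forall c : R, 0 < c ->
     trace (S_ c \o S_ c) =
       (c - ln c / pi ^+ 2 - (1 + euler_gamma + ln (2 * pi)) / pi ^+ 2
        + (2 / pi * c * (Si (2 * pi * c) - pi / 2)
           + cos (2 * pi * c) / pi ^+ 2
           + Ci (2 * pi * c) / pi ^+ 2))%:C)
  /\
  (forall N : nat,
     exists K : R, \forall c \near +oo,
       Normc.normc (trace (S_ c \o S_ c) -
       (c - ln c / pi ^+ 2 - (1 + euler_gamma + ln (2 * pi)) / pi ^+ 2
        - cos (2 * pi * c) / pi ^+ 2 *
            \sum_(1 <= n < N.+1) (-1) ^+ n *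
              (((2 * n)`!)%:R - ((2 * n - 1)`!)%:R) / (2 * pi * c) ^+ (2 * n)
        - sin (2 * pi * c) / pi ^+ 2 *
            \sum_(1 <= n < N.+1) (-1) ^+ n *
              (((2 * n + 1)`!)%:R - ((2 * n)`!)%:R)
              / (2 * pi * c) ^+ (2 * n + 1))%:C)
       <= K / c ^+ (2 * N + 2)).
Proof.
move=> S_; split=> [|N]; first exact: trace_opS_square.
have [k2 k3 k4] : [/\ 2 * N + 2 <= 2 * N.+2, 2 * N + 2 <= (2 * N).+3 &
  2 * N + 2 <= (2 * N).+4]%N by split; lia.
have p0 := @pi_gt0 R; have p1 : pi != 0 :> R by rewrite gt_eqF.
have pi1 : 1 <= pi :> R by have := @pihalf_ge1 R; move: (pi : R) => p; lra.
pose f1 : R := ((2 * N.+2)`!)%:R; pose f2 : R := ((2 * N).+3`!)%:R.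
pose f3 : R := ((2 * N).+2`!)%:R; pose f4 : R := ((2 * N).+1`!)%:R.
(* In order: the errors of [SI] and [CIN], the cosine term of index N + 1 with the unpaired term of
   [asym_cos], and the sine term of index N + 1. *)
exists (f1 + f1 + (f3 + f4 + f2) + (f2 + f3)); near=> c.
have c1 : 1 <= c by near: c; apply: nbhs_pinfty_ge; exact: num_real.
have c0 : 0 < c := lt_le_trans ltr01 c1.
pose x := 2 * pi * c.
have cx : c <= x by rewrite /x ler_peMl ?ltW//; move: (pi : R) pi1 => p; lra.
have x1 : 1 <= x := le_trans c1 cx.
have x0 : 0 < x := lt_le_trans ltr01 x1; have xn : x != 0 by rewrite gt_eqF.
rewrite trace_opS_square// -rmorphB normc_real /= -/x.
(* The error of [SI] gets multiplied by x, so order [N] would give only x^-(2N+1); one more term is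
   carried. *)
have H1 := SI_asymptotic N.+1 x0; have H2 := CIN_asymptotic N.+1 x0.
have F1 := asym_cos N.+1 xn; have F2 := asym_sin N.+1 xn.
(* The extra term of index N + 1 is split off both sums and counted as error. *)
rewrite big_nat_recr//= in F1; rewrite big_nat_recr//= in F2.
rewrite (SiE (ltW x0)) (CiE x0).
set Sc := \sum_(_ <= _ < _) _ in F1 *; set Ss := \sum_(_ <= _ < _) _ in F2 *.
have e2 : (2 * N.+1 = (2 * N).+2)%N by rewrite mulnS.
rewrite e2 subSS subn0 in F1; rewrite e2 addn1 in F2.
rewrite -/f1 in H1 H2; rewrite -/f2 -/f3 -/f4 in F1; rewrite -/f2 -/f3 in F2.
pose v := (c ^+ (2 * N + 2))^-1.
have v0 : 0 <= v by rewrite invr_ge0 exprn_ge0// ltW.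
have xv k : (2 * N + 2 <= k)%N -> 0 <= (x ^+ k)^-1 <= v.
  move=> Nk; rewrite invr_ge0 exprn_ge0 ?(ltW x0)//= /v lef_pV2 ?posrE ?exprn_gt0//.
  apply: (@le_trans _ _ (x ^+ (2 * N + 2))); first by apply: lerXn2r; rewrite ?nnegrE// ltW.
  exact: ler_weXn2l x1 _ _ Nk.
have [f10 f20 f30 f40] : [/\ 0 <= f1, 0 <= f2, 0 <= f3 & 0 <= f4] by [].
set E1 := SI x + _ + _ - _ in H1; set E2 := CIN x - _ + _ - _ - _ in H2.
have D : (c - ln c / pi ^+ 2 - (1 + euler_gamma + ln (2 * pi)) / pi ^+ 2
     + (2 / pi * c * (SI x - pi / 2) + cos x / pi ^+ 2
        + (euler_gamma + ln x - CIN x) / pi ^+ 2))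
   - (c - ln c / pi ^+ 2 - (1 + euler_gamma + ln (2 * pi)) / pi ^+ 2
      - cos x / pi ^+ 2 * Sc - sin x / pi ^+ 2 * Ss) =
   (x * E1 - E2 + cos x * (1 + Sc - (x * asym_f N.+2 x + asym_g N.+2 x))
     - sin x * ((x * asym_g N.+2 x - asym_f N.+2 x) - Ss)) / pi ^+ 2.
  exact: trace_error_identity.
have sg (w : R) k : (2 * N + 2 <= k)%N -> `|(-1) ^+ N.+1 * w / x ^+ k| <= `|w| * v.
  move=> Nk; rewrite !normrM normrX normrN1 expr1n mul1r ler_wpM2l//.
  by have /andP[q1 q2] := xv k Nk; rewrite ger0_norm.
have B1 : `|x * E1| <= f1 * v.
  rewrite normrM gtr0_norm//; apply: (le_trans (ler_wpM2l (ltW x0) H1)).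
  have -> : (2 * N.+2 = (2 * N).+3.+1)%N by rewrite !mulnS.
  have -> : x * (f1 / x ^+ (2 * N).+4) = f1 * (x ^+ (2 * N).+3)^-1.
    by rewrite exprS; field; rewrite xn expf_neq0.
  rewrite ler_wpM2l//; have [] := andP (xv (2 * N).+3 _) => //.
have B2 : `|E2| <= f1 * v.
  apply: (le_trans H2); rewrite ler_wpM2l//; have [] := andP (xv (2 * N.+2)%N _) => //.
have B3 : `|1 + Sc - (x * asym_f N.+2 x + asym_g N.+2 x)| <= (f3 + f4) * v + f2 * v.
  rewrite F1; set T1 := _ * _ / x ^+ (2 * N).+2; set T2 := _ * _ / x ^+ (2 * N).+4.
  have -> : 1 + Sc - (1 + (Sc + T1) + T2) = - T1 - T2 by ring.
  rewrite (le_trans (ler_normB _ _))// normrN; apply: lerD.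
    apply: (le_trans (sg _ _ _)); first by rewrite addn2.
    by rewrite ler_wpM2r// (le_trans (ler_normB _ _))// !ger0_norm.
  apply: (le_trans (sg _ _ _)); first exact: k4.
  by rewrite ger0_norm.
have B4 : `|x * asym_g N.+2 x - asym_f N.+2 x - Ss| <= (f2 + f3) * v.
  rewrite F2 [Ss + _]addrC addrK; apply: (le_trans (sg _ _ _)); first by rewrite addn2 leqW.
  by rewrite ler_wpM2r// (le_trans (ler_normB _ _))// !ger0_norm.
have hc : `|cos x| <= 1 by rewrite ler_norml cos_geN1 cos_le1.
have hs : `|sin x| <= 1 by rewrite ler_norml sin_geN1 sin_le1.
have B5 := ler_pM (normr_ge0 _) (normr_ge0 _) hc B3.
have B6 := ler_pM (normr_ge0 _) (normr_ge0 _) hs B4.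
rewrite D normrM normfV.
have pi2 : 1 <= `|pi ^+ 2 : R| by rewrite ger0_norm ?exprn_ge0 ?exprn_ege1// ltW.
rewrite ler_pdivrMr ?(lt_le_trans ltr01)//.
set Z := _ + _ - _; have BZ : `|Z| <= (f1 + f1 + (f3 + f4 + f2) + (f2 + f3)) * v.
  apply: (le_trans (ler_normB _ _)); rewrite mulrDl normrM; apply: lerD; last by rewrite -[leRHS]mul1r.
  apply: (le_trans (ler_normD _ _)); rewrite mulrDl normrM; apply: lerD; last by rewrite mulrDl -[leRHS]mul1r.
  by apply: (le_trans (ler_normB _ _)); rewrite mulrDl lerD.
apply: (le_trans BZ); rewrite -[leLHS]mulr1 ler_wpM2l// mulr_ge0//.
by rewrite !addr_ge0.
Unshelve. all: by end_near.
Qed.
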